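(* Let $k$ be an algebraically closed field of characteristic $p\ge 7$. (a) Let $H$ be a hyperelliptic curve of genus $4$ over $k$ with $\mathrm{Aut}(H)\supset\mathbf D_4$. Then $H$ is birational to $C_1\times_{\mathbb P^1}C_2$ for some genus-$2$ curves $C_1$ and $C_2$ over $k$ with $C_1\cong C_2$ that share exactly $5$ ramification points. In fact, one can take $C_1=C_{\lambda_1,\lambda_2,\lambda_3}$ and $C_2=C_{\lambda_1,\lambda_2,\lambda_3'}$ in Rosenhain form with $\lambda_3\ne\lambda_3'$ satisfying $c_2c_3=c_4c_5=1$, where $$c_2=\frac{\lambda_3'}{\lambda_3},\quad c_3=\frac{1-\lambda_3'}{1-\lambda_3},\quad c_4=\frac{\lambda_1-\lambda_3'}{\lambda_1-\lambda_3},\quad c_5=\frac{\lambda_2-\lambda_3'}{\lambda_2-\lambda_3}.$$ (b) Conversely, if $\lambda_1,\lambda_2,\lambda_3,\lambda_3'\in k\smallsetminus\{0,1\}$ are mutually distinct and the elements $c_2,c_3,c_4,c_5$ defined by the formulas in (a) satisfy $c_2c_3=c_4c_5=1$, then $C_{\lambda_1,\lambda_2,\lambda_3}$ and $C_{\lambda_1,\lambda_2,\lambda_3'}$ are isomorphic to each other, and $C_{\lambda_1,\lambda_2,\lambda_3}\times_{\mathbb P^1}C_{\lambda_1,\lambda_2,\lambda_3'}$ is birational to a hyperelliptic curve of genus $4$ whose automorphism group contains $\mathbf D_4$.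
   Context: Curves are non-singular projective; isomorphisms and automorphisms are over $k$. For mutually distinct $\lambda,\mu,\nu\in k\smallsetminus\{0,1\}$, $C_{\lambda,\mu,\nu}$ is the genus-2 curve in Rosenhain form $y^2=x(x-1)(x-\lambda)(x-\mu)(x-\nu)$. Genus-2 curves are viewed as double covers of $\mathbb P^1$ by the coordinate $x$ (hyperelliptic structure), the fiber product is taken over this $\mathbb P^1$, and ''sharing exactly 5 ramification points'' means that exactly 5 of their 6 branch points in $\mathbb P^1$ coincide. The $\lambda_i,\lambda_3'$ in (a) are mutually distinct elements of $k\smallsetminus\{0,1\}$. $\mathbf D_4$ is the dihedral group of order 8, and $\mathrm{Aut}(H)\supset\mathbf D_4$ means that $\mathrm{Aut}(H)$ has a subgroup isomorphic to $\mathbf D_4$. *)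

(* Defs.v *)
From HB Require Import structures.
From mathcomp Require Import all_boot all_order all_algebra.
From mathcomp Require Import all_fingroup all_solvable all_field.

Set Implicit Arguments.
Unset Strict Implicit.
Unset Printing Implicit Defensive.

Import Order.TTheory GRing.Theory Num.Theory.
Local Open Scope ring_scope.

(* Throughout, k is algebraically closed in the intended use.  Non-singular   *)
(* projective curves over k are handled through their function fields: the    *)
(* contravariant equivalence with function fields of transcendence degree 1   *)
(* over k turns a curve with a finite morphism x to P^1 into a finite         *)
(* extension of k(x), isomorphisms of curves over k into field isomorphisms   *)
(* that are the identity on k, and points into normalized discrete valuations *)
(* trivial on k.  Every function field is a finite extension of some k(x), so *)
(* choosing x is no restriction; notions attached to the bare curve (genus,   *)
(* isomorphism, automorphisms, hyperellipticity) do not refer to it.          *)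
Notation rat_fun k := {fraction {poly k}}.
Notation curve k := (fieldExtType (rat_fun k)).

Section Curves.

Variable k : fieldType.
Implicit Types E F H C : curve k.

Definition const E (a : k) : E := (tofrac a%:P)%:A.

(* Points; the value of v at 0 is irrelevant. *)
Definition place E (v : E -> int) : Prop :=
  [/\ forall a : k, a != 0 -> v (const E a) = 0,
      forall f g : E, f != 0 -> g != 0 -> v (f * g) = v f + v g,
      forall f g : E, f != 0 -> g != 0 -> f + g != 0 ->
        Order.min (v f) (v g) <= v (f + g)
    & exists2 t : E, t != 0 & v t = 1].

Definition in_local_ring E (v : E -> int) (f : E) : Prop :=
  f = 0 \/ 0 <= v f.

Definition derivation E (D : E -> E) : Prop :=
  [/\ forall f g, D (f + g) = D f + D g,
      forall f g, D (f * g) = f * D g + g * D f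
    & forall a : k, D (const E a) = 0].

(* Rational differential forms are tested on the derivations over k, which    *)
(* separate them because the space of such forms is finite dimensional over   *)
(* the function field.                                                        *)
Definition differential_neq0 E (h : E) : Prop :=
  exists D, derivation D /\ D h != 0.

(* f dh is regular at v when it is a finite sum of forms a db with a, b       *)
(* regular at v.                                                              *)
Definition regular_at E (v : E -> int) (f h : E) : Prop :=
  exists s : seq (E * E),
    (forall ab, ab \in s -> in_local_ring v ab.1 /\ in_local_ring v ab.2) /\
    (forall D, derivation D -> f * D h = \sum_(ab <- s) ab.1 * D ab.2).

Definition has_dim E (V : E -> Prop) (n : nat) : Prop :=
  exists b : 'I_n -> E,
    (forall f, V f <->
       exists c : 'I_n -> k, f = \sum_i const E (c i) * b i) /\
    (forall c : 'I_n -> k, \sum_i const E (c i) * b i = 0 ->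
       forall i, c i = 0).

(* The genus is the dimension of the space of everywhere regular differential *)
(* forms.  Rational forms are a one-dimensional space over the function       *)
(* field, hence each is f dh for a unique f as soon as dh is non-zero.        *)
Definition has_genus E (g : nat) : Prop :=
  exists2 h : E, differential_neq0 h &
    has_dim (fun f => forall v, place v -> regular_at v f h) g.

Definition curve_iso E F (f : {rmorphism E -> F}) : Prop :=
  bijective f /\ forall a : k, f (const E a) = const F a.

Definition isomorphic E F : Prop :=
  exists f : {rmorphism E -> F}, curve_iso f.

(* An embedding of the dihedral group of order 8 into the automorphism group. *)
Definition aut_contains_D4 H : Prop :=
  exists phi : 'D_8 -> {rmorphism H -> H},
    [/\ forall s, curve_iso (phi s),
        forall s t, phi (s * t)%g =1 phi s \o phi t
      & forall s t, phi s =1 phi t -> s = t].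

Definition double_cover E : Prop := \dim {:E} = 2%N.

Definition hyperelliptic H (g : nat) : Prop :=
  [/\ (2 <= g)%N, has_genus H g
    & exists E, double_cover E /\ isomorphic E H].

Definition genus2_double_cover C : Prop := double_cover C /\ has_genus C 2.

(* Points of P^1 over k are represented in [option k]; [None] is infinity. *)
Definition local_param (a : option k) : rat_fun k :=
  if a is Some c then tofrac ('X - c%:P) else (tofrac 'X)^-1.

Definition branch_point C (a : option k) : Prop :=
  exists v : C -> int, place v /\ 2 <= v (local_param a)%:A.

Definition share_branch_points C1 C2 (n : nat) : Prop :=
  exists s : seq (option k),
    [/\ uniq s, size s = n
      & forall a, a \in s <-> branch_point C1 a /\ branch_point C2 a].

(* The total ring of rational functions of the fiber product of C1 and C2     *)
(* over P^1 is the tensor product of their function fields over k(x), every   *)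
(* component being dominant over P^1 by flatness.  So H is birational to the  *)
(* fiber product when its function field is, over k, that tensor product;     *)
(* the latter is specified as the pushout of commutative rings.               *)
(* The coordinate carried by H itself plays no role here.                     *)
Definition birational_fiber_product H C1 C2 : Prop :=
  exists (i1 : {rmorphism C1 -> H}) (i2 : {rmorphism C2 -> H}),
    [/\ forall a : k, i1 (const C1 a) = const H a,
        forall r : rat_fun k, i1 r%:A = i2 r%:A
      & forall (A : comPzRingType)
               (j1 : {rmorphism C1 -> A}) (j2 : {rmorphism C2 -> A}),
          (forall r : rat_fun k, j1 r%:A = j2 r%:A) ->
          exists h : {rmorphism H -> A},
            [/\ h \o i1 =1 j1, h \o i2 =1 j2
              & forall h' : {rmorphism H -> A},
                  h' \o i1 =1 j1 -> h' \o i2 =1 j2 -> h' =1 h]].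

Definition rosenhain_poly (l m n : k) : {poly k} :=
  'X * ('X - 1) * ('X - l%:P) * ('X - m%:P) * ('X - n%:P).

Lemma frac_numden (r : rat_fun k) :
  exists n d : {poly k}, d != 0 /\ r * tofrac d = tofrac n.
Proof.
elim/quotW: r => x; exists (frac x).1, (frac x).2; split; first exact: denom_ratioP.
unlock FracField.tofrac; rewrite -[LHS]FracField.pi_mul.
apply/eqmodP => /=; rewrite FracField.equivfE /FracField.mulf.
by rewrite !numden_Ratio ?mulf_neq0 ?denom_ratioP ?oner_neq0 // !mulr1 mulrC.
Qed.

Lemma size_rosenhain_poly l m n : size (rosenhain_poly l m n) = 6%N.
Proof.
rewrite /rosenhain_poly -polyC1 -!mulrA mulrC size_mulX ?mulf_neq0 ?polyXsubC_eq0 //.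
by rewrite !size_mul ?mulf_neq0 ?polyXsubC_eq0 ?size_XsubC.
Qed.

Lemma rosenhain_irreducible l m n :
  irreducible_poly ('X^2 - (tofrac (rosenhain_poly l m n))%:P).
Proof.
move: (rosenhain_poly l m n) (size_rosenhain_poly l m n) => f szf.
apply: cubic_irreducible => [|r]; first by rewrite size_XnsubC.
apply/negP; rewrite /root !hornerE subr_eq0 => /eqP r2.
have [a [b [b0 rb]]] := frac_numden r.
have f0 : f != 0 by rewrite -size_poly_eq0 szf.
have /eqP : tofrac (a ^+ 2) = tofrac (f * b ^+ 2).
  by rewrite [RHS]tofracM !tofracXn -rb exprMn r2.
rewrite tofrac_eq => /eqP ab.
have a0 : a != 0 by rewrite -sqrf_eq0 ab mulf_neq0 ?sqrf_eq0.
have /(congr1 (fun p : {poly k} => odd (size p))) := ab.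
rewrite !expr2 /= !size_mul ?mulf_neq0 // szf.
move: a0 b0; rewrite -!size_poly_gt0.
case: (size a) (size b) => [|i] [|j] //= _ _.
by rewrite add0n !addnS /= !addnn !odd_double.
Qed.

(* The smooth projective model of y^2 = x(x-1)(x-l)(x-m)(x-n), as a double    *)
(* cover of P^1 by x, i.e. k(x)(y); the right-hand side has odd degree, so    *)
(* the equation in y is irreducible for all l, m, n.                          *)
Definition rosenhain_curve (l m n : k) : curve k :=
  projT1 (sigT_of_sigT2 (irredp_FAdjoin (rosenhain_irreducible l m n))).

Lemma rosenhain_curveP l m n :
  double_cover (rosenhain_curve l m n) /\
  exists y : rosenhain_curve l m n,
    y ^+ 2 = (tofrac (rosenhain_poly l m n))%:A /\ <<1; y>>%VS = fullv.
Proof.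
rewrite /double_cover /rosenhain_curve.
case: (irredp_FAdjoin _) => /= L dimL [y ry gy]; split.
  by rewrite dimL size_XnsubC.
exists y; split=> //; apply/eqP; rewrite -subr_eq0; move: ry.
by rewrite rmorphB /= map_polyXn map_polyC /root !hornerE.
Qed.

End Curves.

(* Main.v *)
From HB Require Import structures.
Require Import Defs.
From mathcomp Require Import all_boot all_order all_algebra.
From mathcomp Require Import all_fingroup all_solvable all_field.
From mathcomp Require Import zify ring.

Set Implicit Arguments.
Unset Strict Implicit.
Unset Printing Implicit Defensive.

Import Order.TTheory GRing.Theory Num.Theory.
Local Open Scope ring_scope.

(** Write [k(x, y)] for a function field with [y^2 = f(x)], [f] separable.

    Suppose that the dihedral group of order 8 acts on such a field of genus 4,
    through [R] of order 4 and an involution [S] with [S R = R^3 S]. The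
    regular differentials are the [P(x) dx / y] with [deg P < 4]
    ([regular_forms]), so their ratios generate a subfield that every
    automorphism preserves: automorphisms act on [x] by Moebius
    transformations ([model_mobius]). After moving fixed points, [R x] is a
    multiple [a x] of [x]. If [R^2] moved [x], then [a] would be a primitive
    fourth root of unity, which is impossible as [R^4] is trivial and [f] is
    separable of degree 9 or 10 ([genus4_order4]). So [R^2] is the
    hyperelliptic involution [y -> -y], [R x = - x], and [S], whose action on [x] commutes with that
    of [R], can be normalized to [S x = 1/x]. This forces [f] to be odd and
    palindromic of degree 9 ([dihedral_normal_form]). With [u = x + 1/x] it
    reads, up to a constant,
      [f = x^5 (u^2 - a^2) (u^2 - b^2)]       ([branch_poly]).

    Then [v1 = y (1 + x) / x^3] and [v2 = y (1 - x) / x^3] satisfy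
      [v1^2 = (u^2 - a^2) (u^2 - b^2) (u + 2)],
      [v2^2 = (u^2 - a^2) (u^2 - b^2) (u - 2)],
    and [k(x, y)] is generated by [u], [v1], [v2]. The curves of [k(u, v1)] and
    [k(u, v2)] have genus 2, are exchanged by [u -> -u], and their branch points
    differ only in [-2] and [2]; they are linearly disjoint over [k(u)] because
    [x -> 1/x] fixes [k(u, v1)] and negates [v2] ([fiber_product]). The affine
    coordinate in which [a] and [- a] become 0 and 1 gives the Rosenhain form
    with [l1 + l2 = 1 = l3 + l3'], and this is what the two conditions on
    [c2], ..., [c5] say ([rosenhain_relations]). For the converse the
    computation is read backwards: [a] and [b] are recovered from [l3] and [l1], and [R], [S]
    are written down on [y^2 = branch_poly a b (x)] ([branch_curve_D4]).

    The genus is computed from its definition by derivations and places. A form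
    [P(x) dx / y] is regular where [x] has no pole, thanks to a Bezout relation
    between [f] and [f'], and at the poles of [x] by the same argument for the
    coordinates [1/x], [y / x^(g+1)]. Conversely, each point [(a, b)] of the
    affine curve gives a place ([place_over]) whose valuation ring is a
    localization of [k[x, y]] preserved by [y d/dx]; so a regular [z dx] has
    [z y] in all these localizations, hence in [k[x, y]], and the same at
    infinity bounds the degree. *)

(** * Constants, evaluation of polynomials, double roots *)

Section Evaluation.

Variable k : fieldType.
Variable E : curve k.

Fact const_is_zmod_morphism : zmod_morphism (const E).
Proof. by move=> a b; rewrite /const polyCB tofracB scalerBl. Qed.

Fact const_is_monoid_morphism : monoid_morphism (const E).
Proof.
split=> [|a b]; first by rewrite /const tofrac1 scale1r.
by rewrite /const polyCM tofracM -scalerA -scalerAl mul1r.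
Qed.

HB.instance Definition _ :=
  GRing.isZmodMorphism.Build k E (const E) const_is_zmod_morphism.
HB.instance Definition _ :=
  GRing.isMonoidMorphism.Build k E (const E) const_is_monoid_morphism.

Definition pev (x : E) (P : {poly k}) : E := (map_poly (const E) P).[x].

Fact pev_is_zmod_morphism x : zmod_morphism (pev x).
Proof. by move=> a b; rewrite /pev rmorphB hornerD hornerN. Qed.

Fact pev_is_monoid_morphism x : monoid_morphism (pev x).
Proof.
by split=> [|a b]; rewrite /pev ?rmorph1 ?hornerC // rmorphM hornerM.
Qed.

HB.instance Definition _ x :=
  GRing.isZmodMorphism.Build {poly k} E (pev x) (pev_is_zmod_morphism x).
HB.instance Definition _ x :=
  GRing.isMonoidMorphism.Build {poly k} E (pev x) (pev_is_monoid_morphism x).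

Lemma pevX x : pev x 'X = x.
Proof. by rewrite /pev map_polyX hornerX. Qed.

Lemma pevC x a : pev x a%:P = const E a.
Proof. by rewrite /pev map_polyC hornerC. Qed.

Lemma pev_XsubC x a : pev x ('X - a%:P) = x - const E a.
Proof. by rewrite rmorphB /= pevX pevC. Qed.

Lemma pevZ x a P : pev x (a *: P) = const E a * pev x P.
Proof. by rewrite -mul_polyC rmorphM /= pevC. Qed.

Lemma pev_sum x (P : {poly k}) n : (size P <= n)%N ->
  pev x P = \sum_(i < n) const E P`_i * x ^+ i.
Proof.
move=> sP; rewrite /pev (@horner_coef_wide _ n) ?size_map_poly //.
by apply: eq_bigr => i _; rewrite coef_map.
Qed.

Lemma pev_comp x (P Q : {poly k}) : pev x (P \Po Q) = pev (pev x Q) P.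
Proof. by rewrite /pev map_comp_poly horner_comp. Qed.

Lemma pevD x P Q : pev x (P + Q) = pev x P + pev x Q.
Proof. exact: rmorphD. Qed.

Lemma pevN x P : pev x (- P) = - pev x P.
Proof. exact: rmorphN. Qed.

Lemma pevM x P Q : pev x (P * Q) = pev x P * pev x Q.
Proof. exact: rmorphM. Qed.

Lemma pevXn x P n : pev x (P ^+ n) = pev x P ^+ n.
Proof. exact: rmorphXn. Qed.

Lemma pev0 x : pev x 0 = 0.
Proof. exact: rmorph0. Qed.

Lemma pev1 x : pev x 1 = 1.
Proof. exact: rmorph1. Qed.

Definition pevE := (pevXn, pevD, pevN, pevM, pev0, pev1, pevX, pevC, pevZ).

End Evaluation.

Lemma pev_morph (k : fieldType) (E F : curve k) (h : {rmorphism E -> F}) :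
  (forall a : k, h (const E a) = const F a) ->
  forall x P, h (pev x P) = pev (h x) P.
Proof.
move=> hc x P; rewrite /pev -horner_map -map_poly_comp /=; congr (_.[_]).
exact: eq_map_poly.
Qed.

Section Transcendental.

Variable k : closedFieldType.

Definition transcendental (E : curve k) (x : E) :=
  forall P : {poly k}, pev x P = 0 -> P = 0.

(** A polynomial relation splits into linear factors. *)
Lemma transcendentalP (E : curve k) (x : E) :
  (forall a, x != const E a) -> transcendental x.
Proof.
move=> xc P; have [rs ->] := closed_field_poly_normal P.
rewrite pevZ rmorph_prod /= => /eqP; rewrite mulf_eq0 => /orP[|].
  by rewrite fmorph_eq0 => /eqP ->; rewrite scale0r.
by rewrite prodf_seq_eq0 => /hasP[r _]; rewrite pev_XsubC subr_eq0 (negPf (xc r)).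
Qed.

Lemma transcendental_neq (E : curve k) (x : E) a :
  transcendental x -> x != const E a.
Proof.
move=> tx; apply/negP => /eqP xa; have := tx ('X - a%:P).
rewrite pev_XsubC xa subrr => /(_ erefl) /eqP.
by rewrite polyXsubC_eq0.
Qed.

Lemma transcendental_neq0 (E : curve k) (x : E) :
  transcendental x -> x != 0.
Proof. by move/(transcendental_neq 0); rewrite rmorph0. Qed.

Lemma pev_eq0 (E : curve k) (x : E) P :
  transcendental x -> (pev x P == 0) = (P == 0).
Proof.
by move=> tx; apply/eqP/eqP => [/tx // | ->]; rewrite rmorph0.
Qed.

Lemma pev_inj (E : curve k) (x : E) : transcendental x -> injective (pev x).
Proof.
by move=> tx P Q e; apply/subr0_eq/tx; rewrite rmorphB /= e subrr.
Qed.

End Transcendental.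

Section SimpleRoots.

Variable k : closedFieldType.

Lemma double_root (f : {poly k}) :
  ~~ separable_poly f -> exists a, ('X - a%:P) ^+ 2 %| f.
Proof.
rewrite separable_poly.unlock => /closed_rootP[r].
rewrite root_gcd => /andP[/factor_theorem[q fq]].
rewrite fq derivM derivXsubC /root !hornerE subrr mulr0 add0r.
by move=> /factor_theorem[s ->]; exists r; rewrite -mulrA -expr2 dvdp_mull.
Qed.

Lemma separable_sqrP (f : {poly k}) :
  reflect (f != 0 /\ forall a, ~~ (('X - a%:P) ^+ 2 %| f))
          (separable_poly f).
Proof.
apply: (iffP idP) => [sf | [f0 nsq]].
  split=> [|a]; first exact: separable_poly_neq0.
  apply/negP => sq; have [h _] := separable_polyP sf.
  have := h ('X - a%:P) ('X - a%:P); rewrite -expr2 => /(_ sq).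
  by rewrite coprimepp size_XsubC.
by apply/negPn/negP => /double_root[a]; apply/negP.
Qed.

Lemma separable_factor (f : {poly k}) a :
  separable_poly f -> root f a ->
  exists g, f = ('X - a%:P) * g /\ g.[a] != 0.
Proof.
move=> sf /factor_theorem[g fg]; exists g; split; first by rewrite mulrC.
apply/negP => ga; have /separable_sqrP[_ /(_ a)/negP[]] := sf.
have [s e] := factor_theorem _ _ ga; by rewrite fg e -mulrA -expr2 dvdp_mull.
Qed.

End SimpleRoots.

(** * Hyperelliptic models *)

Section Models.

Variable k : closedFieldType.

(** The field [k(x, y)] with [y^2 = f(x)]. The coordinate [x] is part of the data,
    rather than the one over which the field was constructed, so that one field
    can be compared with itself in several coordinates. *)
Record model (E : curve k) (x y : E) (f : {poly k}) : Prop := Model {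
  model_sep : separable_poly f;
  model_size : (1 < size f)%N;
  model_sqr : y ^+ 2 = pev x f;
  model_tr : transcendental x;
  model_gen : forall z, exists A B C : {poly k},
    C != 0 /\ z * pev x C = pev x A + pev x B * y }.

(** At a root of [f], the left side has even and the right side odd multiplicity. *)
Lemma sqr_separable (f A B : {poly k}) :
  separable_poly f -> (1 < size f)%N -> A ^+ 2 = B ^+ 2 * f -> B = 0.
Proof.
move=> sf f1 e; apply/eqP/negPn/negP => B0.
have f0 := separable_poly_neq0 sf.
have [a ra] : exists a, root f a by apply/closed_rootP; rewrite gtn_eqF.
have [g [fg ga]] := separable_factor sf ra.
have A0 : A != 0 by rewrite -sqrf_eq0 e mulf_neq0 ?sqrf_eq0.
have g0 : g != 0 by apply/eqP => g0; rewrite g0 horner0 eqxx in ga.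
have := congr1 (mup a) e.
rewrite fg !expr2 !mupM ?mulf_neq0 ?polyXsubC_eq0 //.
rewrite (mupNroot ga) -{1}['X - _]expr1 mup_XsubCX eqxx.
by move=> /(congr1 odd); rewrite !oddD !addbb.
Qed.

Section OneModel.

Variables (E : curve k) (x y : E) (f : {poly k}).
Hypothesis m : model x y f.

Lemma model_indep A B : pev x A + pev x B * y = 0 -> A = 0 /\ B = 0.
Proof.
move=> e; suff B0 : B = 0.
  split=> //; apply: (model_tr m); move: e.
  by rewrite B0 pev0 mul0r addr0.
apply: (@sqr_separable f A); [exact: model_sep m | exact: model_size m |].
apply: (pev_inj (model_tr m)); rewrite !pevE -(model_sqr m).
by rewrite -exprMn; apply/eqP; rewrite eqf_sqr -addr_eq0 e eqxx orbT.
Qed.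

Lemma model_inj A B A' B' :
  pev x A + pev x B * y = pev x A' + pev x B' * y -> A = A' /\ B = B'.
Proof.
move=> e; have [|/subr0_eq-> /subr0_eq->] // := @model_indep (A - A') (B - B').
by rewrite !pevE mulrBl addrACA -opprD e subrr.
Qed.

Lemma model_y_neq0 : y != 0.
Proof.
apply/eqP => y0; have [|_ /eqP] := @model_indep 0 1.
  by rewrite y0 mulr0 pev0 addr0.
by rewrite oner_eq0.
Qed.

Lemma model_rep : exists r : E -> {poly k} * {poly k} * {poly k},
  forall z, (r z).2 != 0 /\
    z * pev x (r z).2 = pev x (r z).1.1 + pev x (r z).1.2 * y.
Proof.
have ex z : exists r : {poly k} * {poly k} * {poly k},
    (r.2 != 0) && (z * pev x r.2 == pev x r.1.1 + pev x r.1.2 * y).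
  have [A [B [C [C0 e]]]] := model_gen m z.
  by exists (A, B, C); rewrite /= C0 e eqxx.
exists (fun z => xchoose (ex z)) => z.
by have /andP[C0 /eqP] := xchooseP (ex z).
Qed.

Lemma model_cross z A B C A' B' C' :
  z * pev x C = pev x A + pev x B * y ->
  z * pev x C' = pev x A' + pev x B' * y ->
  A * C' = A' * C /\ B * C' = B' * C.
Proof.
move=> e e'; apply: model_inj; rewrite !pevE.
rewrite mulrAC -mulrDl -e [_ * y]mulrAC -mulrDl -e'.
by rewrite -!mulrA [pev x C' * _]mulrC.
Qed.

(** The universal property of [k(x, y)], the source of all automorphisms and
    embeddings below. *)
Lemma model_hom (F : curve k) (x1 y1 : F) :
  transcendental x1 -> y1 ^+ 2 = pev x1 f ->
  exists h : {rmorphism E -> F},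
    [/\ forall a : k, h (const E a) = const F a, h x = x1 & h y = y1].
Proof.
move=> t1 e1; have [r rP] := model_rep.
pose h z := (pev x1 (r z).1.1 + pev x1 (r z).1.2 * y1) / pev x1 (r z).2.
have n1 C : C != 0 -> pev x1 C != 0 by rewrite pev_eq0.
have hE z A B C : C != 0 -> z * pev x C = pev x A + pev x B * y ->
    h z = (pev x1 A + pev x1 B * y1) / pev x1 C.
  move=> C0 e; rewrite /h; have [D0] := rP z.
  case: (r z) D0 => [[A' B'] C'] /= D0 e'.
  have [eA eB] := model_cross e e'.
  apply/eqP; rewrite eqr_div ?n1 // !mulrDl -![_ * y1 * _]mulrAC.
  by rewrite -!pevM eA eB.
have h_zmod : zmod_morphism h.
  move=> z w; have [D0] := rP w; have [C0] := rP z.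
  case: (r z) C0 => [[A B] C] /= C0 ez; case: (r w) D0 => [[A' B'] D] /= D0 ew.
  rewrite (hE _ _ _ _ C0 ez) (hE _ _ _ _ D0 ew).
  rewrite (hE (z - w) (A * D - A' * C) (B * D - B' * C) (C * D)) ?mulf_neq0 //.
    by rewrite !pevE; field; rewrite !n1.
  rewrite !pevE mulrBl [z * _]mulrA ez [_ * pev x D]mulrC mulrA ew.
  by ring.
have h_mon : monoid_morphism h.
  split=> [|z w].
    by rewrite (hE 1 1 0 1) ?oner_neq0 // !pevE mul0r addr0 ?divr1 ?mulr1.
  have [D0] := rP w; have [C0] := rP z.
  case: (r z) C0 => [[A B] C] /= C0 ez; case: (r w) D0 => [[A' B'] D] /= D0 ew.
  rewrite (hE _ _ _ _ C0 ez) (hE _ _ _ _ D0 ew).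
  rewrite (hE (z * w) (A * A' + B * B' * f) (A * B' + A' * B) (C * D)).
  - rewrite !pevE -e1; field; rewrite !n1 //.
  - by rewrite mulf_neq0.
  rewrite !pevE mulrACA ez ew -(model_sqr m).
  by ring.
pose hM : {rmorphism E -> F} := HB.pack h
  (GRing.isZmodMorphism.Build _ _ h h_zmod)
  (GRing.isMonoidMorphism.Build _ _ h h_mon).
exists hM; split=> [a||] /=.
- rewrite (hE _ a%:P 0 1) ?oner_neq0 ?pevE;
  by rewrite ?pevE ?mul0r ?addr0 ?divr1 ?mulr1.
- rewrite (hE _ 'X 0 1) ?oner_neq0 ?pevE;
  by rewrite ?pevE ?mul0r ?addr0 ?divr1 ?mulr1.
- rewrite (hE _ 0 1 1) ?oner_neq0 ?pevE;
  by rewrite ?pevE ?mul1r ?add0r ?divr1 ?mulr1.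
Qed.

(** The target is only a ring, so inverses are compared through uniqueness of
    inverses in it. *)
Lemma model_hom_eq (A : comPzRingType) (g h : {rmorphism E -> A}) :
  (forall a : k, g (const E a) = h (const E a)) -> g x = h x -> g y = h y ->
  g =1 h.
Proof.
move=> ec ex ey; have e P : g (pev x P) = h (pev x P).
  elim/poly_ind: P => [|P a IH]; first by rewrite !pev0 !rmorph0.
  by rewrite !pevE !(rmorphD, rmorphM) /= IH ex ec.
move=> z; have [P [Q [C [C0 ez]]]] := model_gen m z.
have C1 : pev x C != 0 by rewrite pev_eq0 //; exact: model_tr m.
rewrite -[z](mulfK C1) ez !(rmorphM, rmorphD) /= !e ey; congr (_ * _).
have u : h (pev x C) * h (pev x C)^-1 = 1 by rewrite -rmorphM divff ?rmorph1.
have v : g (pev x C)^-1 * h (pev x C) = 1.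
  by rewrite -e -rmorphM mulVf ?rmorph1.
by rewrite -[LHS]mulr1 -u mulrA v mul1r.
Qed.

End OneModel.

Lemma model_iso (E F : curve k) (s : {rmorphism E -> F}) x y f :
  curve_iso s -> model x y f -> model (s x) (s y) f.
Proof.
move=> [[t st ts] sc] m; split.
- exact: model_sep m.
- exact: model_size m.
- by rewrite -rmorphXn /= (model_sqr m) (pev_morph sc).
- move=> P; rewrite -(pev_morph sc) => /eqP; rewrite fmorph_eq0.
  by rewrite (pev_eq0 _ (model_tr m)) => /eqP.
- move=> z; have [A [B [C [C0 e]]]] := model_gen m (t z).
  exists A, B, C; split=> //; rewrite -!(pev_morph sc).
  by rewrite -rmorphM -rmorphD -e rmorphM ts.
Qed.

End Models.

(** * Changes of coordinates *)

Section Reversal.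

Variable k : closedFieldType.
Implicit Types P Q f : {poly k}.

(** [X^n P(1/X)]: reversal inside the space of polynomials of degree at most
    [n], so that a branch point at infinity shows up as a root at 0. *)
Definition revp n P := \poly_(i < n.+1) P`_(n - i).

Lemma coef_revp n P i : (revp n P)`_i = if (i <= n)%N then P`_(n - i) else 0.
Proof. by rewrite coef_poly ltnS. Qed.

Lemma size_revp n P : (size (revp n P) <= n.+1)%N.
Proof. exact: size_poly. Qed.

Lemma revpK n P : (size P <= n.+1)%N -> revp n (revp n P) = P.
Proof.
move=> sP; apply/polyP => i; rewrite !coef_revp leq_subr.
case: leqP => h; first by rewrite subKn.
by rewrite nth_default // (leq_trans sP h).
Qed.

Lemma pev_revp (E : curve k) (x : E) n P : x != 0 -> (size P <= n.+1)%N ->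
  pev x^-1 (revp n P) * x ^+ n = pev x P.
Proof.
move=> x0 sP; rewrite (pev_sum _ (size_revp n P)) (pev_sum _ sP) mulr_suml.
rewrite (reindex_inj rev_ord_inj); apply: eq_bigr => i _ /=.
have iP : (i <= n)%N by rewrite -ltnS.
rewrite coef_revp subSS leq_subr subKn // -mulrA; congr (_ * _).
by rewrite exprVn; apply: (canLR (mulKf _));
   rewrite ?expf_neq0 // -exprD subnK.
Qed.

Lemma revp_XsubC n a P : (size P <= n.+1)%N ->
  revp n.+1 (('X - a%:P) * P) = (1 - a *: 'X) * revp n P.
Proof.
move=> sP; apply/polyP => i; rewrite coef_revp !mulrBl mul1r -scalerAl.
rewrite -['X * P]mulrC -['X * revp _ _]mulrC mul_polyC !coefB !coefZ !coefMX !coef_revp.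
case: i => [|i] /=.
  by rewrite [P`_n.+1]nth_default // !subn0 !mulr0.
rewrite ltnS subSS; case: (ltngtP i n) => [lt_in|lt_ni|->] /=.
- rewrite subn_eq0 leqNgt lt_in /=; congr (P`_ _ - _).
  by rewrite subnS.
- by rewrite mulr0 subr0.
- by rewrite subnn eqxx.
Qed.

(** A double root [a != 0] of the reversal is a double root [1/a] of [f], and a
    double root 0 would lower the degree of [f] by 2. *)
Lemma separable_revp n f : separable_poly f ->
  (n.+1 < size f <= n.+3)%N -> separable_poly (revp n.+2 f).
Proof.
move=> sf /andP[f1 f3]; have f2 : (size f <= n.+3)%N by [].
have [f0 nsq] := separable_sqrP _ sf.
apply/separable_sqrP; split=> [|a].
  by apply: contra_neq f0 => r0; rewrite -(revpK f2) r0; apply/polyP => i;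
     rewrite coef_revp !coef0 if_same.
apply/negP => /dvdpP[G]; rewrite expr2 mulrC -mulrA => eG.
have [G0|G0] := eqVneq G 0.
  have : f = 0; last by move/eqP; rewrite (negPf f0).
  by rewrite -(revpK f2) eG G0 !mulr0; apply/polyP => i;
     rewrite coef_revp !coef0 if_same.
have sG : (size G <= n.+1)%N.
  have := size_revp n.+2 f; rewrite eG !size_mul ?mulf_neq0 ?polyXsubC_eq0 //.
  by rewrite !size_XsubC.
have := revpK f2; rewrite eG revp_XsubC; last first.
  by rewrite size_mul ?polyXsubC_eq0 // size_XsubC.
rewrite revp_XsubC // mulrA => ef.
have [a0|a0] := eqVneq a 0.
  move: f1; rewrite -ef a0 scale0r subr0 !mul1r.
  by rewrite ltnNge size_revp.
have /negP[] := nsq a^-1; rewrite -ef expr2.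
suff -> : 1 - a *: 'X = (- a) *: ('X - a^-1%:P).
  by apply: dvdp_mulr; rewrite -scalerAl -scalerAr !dvdpZr ?oppr_eq0.
by rewrite scalerBr scaleNr -[_ *: _%:P]mul_polyC -polyCM mulNr mulfV // polyCN opprK addrC.
Qed.

Lemma size_revp_bounds n f : separable_poly f -> (n.+1 < size f <= n.+3)%N ->
  (n.+1 < size (revp n.+2 f) <= n.+3)%N.
Proof.
move=> sf /andP[f1 f3]; rewrite size_revp andbT ltnNge; apply/negP => s.
have [f0 nsq] := separable_sqrP _ sf.
have /negP[] := nsq 0; rewrite subr0.
set r := revp n.+2 f in s *.
rewrite -(revpK f3) -/r; move: r s => r s; apply/dvdpP; exists (revp n r); apply/polyP => i.
rewrite coefMXn !coef_revp; case: i => [|[|i]] //=.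
- by rewrite subn0 nth_default // (leq_trans s).
- by rewrite subn1 nth_default.
- by rewrite !ltnS !subSS subn0.
Qed.

End Reversal.

Section ModelChanges.

Variable k : closedFieldType.
Variables (E : curve k) (x y : E) (f : {poly k}).
Hypothesis m : model x y f.

Lemma model_affine a b : a != 0 ->
  model (const E a * x + const E b) y (f \Po (a^-1 *: ('X - b%:P))).
Proof.
move=> a0; set L := a^-1 *: _; set x1 := _ + _.
have ca : const E a != 0 by rewrite fmorph_eq0.
have xL : pev x1 L = x.
  by rewrite /L pevZ pev_XsubC /x1 addrK fmorphV mulKf.
have LM : ('X \Po L) \Po (a *: 'X + b%:P) = 'X.
  rewrite comp_polyX /L comp_polyZ comp_polyB comp_polyX comp_polyC addrK.
  by rewrite scalerA mulVf // scale1r.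
split.
- have [f0 nsq] := separable_sqrP _ (model_sep m).
  have fE : f = (f \Po L) \Po (a *: 'X + b%:P).
    by rewrite -comp_polyA -[L]comp_polyX LM comp_polyXr.
  apply/separable_sqrP; split=> [|c].
    by apply: contra_neq f0 => fL; rewrite fE fL comp_poly0.
  apply/negP => /(dvdp_comp_poly (a *: 'X + b%:P)); rewrite -fE rmorphXn /=.
  have -> : ('X - c%:P) \Po (a *: 'X + b%:P) = a *: ('X - ((c - b) / a)%:P).
    rewrite comp_polyB comp_polyX comp_polyC scalerBr -mul_polyC -mul_polyC -polyCM.
    by rewrite [a * _]mulrC divfK // polyCB; ring.
  by rewrite exprZn dvdpZl ?expf_neq0 // (negPf (nsq _)).
- rewrite size_comp_poly2; first exact: model_size m.
  by rewrite size_scale ?invr_eq0 // size_XsubC.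
- by rewrite pev_comp xL (model_sqr m).
- apply: transcendentalP => c; apply/negP => /eqP e.
  have := transcendental_neq ((c - b) / a) (model_tr m).
  rewrite fmorph_div rmorphB /= -e /x1 addrK mulrC => /eqP[].
  by rewrite mulKf.
- move=> z; have [A [B [C [C0 e]]]] := model_gen m z.
  exists (A \Po L), (B \Po L), (C \Po L); rewrite !pev_comp xL; split=> //.
  apply: contra_neq C0 => C0; apply: (model_tr m).
  by rewrite -xL -pev_comp C0 pev0.
Qed.

Lemma model_scale_y c : c != 0 -> model x (const E c * y) (c ^+ 2 *: f).
Proof.
move=> c0; have cc : const E c != 0 by rewrite fmorph_eq0.
have c2 : c ^+ 2 != 0 by rewrite expf_neq0.
split.
- have [f0 nsq] := separable_sqrP _ (model_sep m).
  apply/separable_sqrP; split=> [|a]; first by rewrite scaler_eq0 negb_or c2.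
  by rewrite dvdpZr.
- by rewrite size_scale // (model_size m).
- by rewrite pevZ exprMn (model_sqr m) rmorphXn.
- exact: model_tr m.
- move=> z; have [A [B [C [C0 e]]]] := model_gen m z.
  exists A, (c^-1 *: B), C; split=> //.
  by rewrite e pevZ fmorphV; congr (_ + _); field.
Qed.

(** The chart at infinity. *)
Lemma model_inv g : (g.*2.+1 < size f <= g.*2.+3)%N ->
  model x^-1 (y / x ^+ g.+1) (revp g.*2.+2 f).
Proof.
move=> sf; have x0 := transcendental_neq0 (model_tr m).
have [f1 f2] := andP sf.
have sr := size_revp_bounds (model_sep m) sf.
have tr' : transcendental x^-1.
  apply: transcendentalP => c; apply/negP => /eqP e.
  have := transcendental_neq c^-1 (model_tr m).
  by rewrite fmorphV /= -e invrK eqxx.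
split=> //.
- by rewrite separable_revp // (model_sep m).
- by case/andP: sr => sr _; apply: leq_trans sr.
- rewrite expr_div_n (model_sqr m) -(pev_revp x0 f2) -exprM.
  by rewrite muln2 doubleS mulfK ?expf_neq0.
- move=> z; have [A [B [C [C0 e]]]] := model_gen m z.
  pose n := maxn (size A) (maxn (size B) (size C)).
  have sA : (size A <= n.+1)%N by rewrite leqW // leq_maxl.
  have sB : (size B <= n.+1)%N by rewrite leqW // !leq_max leqnn orbT.
  have sC : (size C <= n.+1)%N by rewrite leqW // !leq_max leqnn !orbT.
  exists (revp n A * 'X^(g.+1)), (revp n B), (revp n C * 'X^(g.+1)); split.
    rewrite mulf_neq0 ?expf_neq0 ?polyX_eq0 //.
    apply: contra_neq C0 => rC; apply: (model_tr m).
    by rewrite -(pev_revp x0 sC) rC pev0 mul0r.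
  have xn : x ^+ n != 0 by rewrite expf_neq0.
  have e' : z * pev x^-1 (revp n C) =
            pev x^-1 (revp n A) + pev x^-1 (revp n B) * y.
    apply: (mulIf xn); rewrite mulrDl -mulrA (pev_revp x0 sC) e.
    by rewrite (pev_revp x0 sA) mulrAC (pev_revp x0 sB).
  by rewrite !pevE mulrA e' mulrDl exprVn -mulrA.
Qed.

End ModelChanges.

(** * Derivations *)

Section Derivations.

Variable k : closedFieldType.
Variable E : curve k.

Section OneDerivation.

Variable D : E -> E.
Hypothesis dD : derivation D.

Lemma derD u v : D (u + v) = D u + D v.
Proof. by case: dD. Qed.

Lemma derM u v : D (u * v) = u * D v + v * D u.
Proof. by case: dD. Qed.

Lemma der_const a : D (const E a) = 0.
Proof. by case: dD. Qed.

Lemma der0 : D 0 = 0.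
Proof. by rewrite -[in LHS](rmorph0 (const E)) der_const. Qed.

Lemma der_div u v : v != 0 -> D (u / v) = (D u * v - u * D v) / v ^+ 2.
Proof.
move=> v0; have := derM (u / v) v; rewrite divfK // => ->.
by field.
Qed.

Lemma der_pev x P : D (pev x P) = pev x P^`() * D x.
Proof.
elim/poly_ind: P => [|P a IH]; first by rewrite deriv0 !pevE mul0r der0.
rewrite !derivE !pevE derD derM IH der_const.
by ring.
Qed.

End OneDerivation.

Hypothesis two_neq0 : 2%:R != 0 :> k.

Lemma curve_two_neq0 : 2%:R != 0 :> E.
Proof. by rewrite -(rmorph_nat (const E)) fmorph_eq0. Qed.

Variables (x y : E) (f : {poly k}).
Hypothesis m : model x y f.

Lemma der_y D : derivation D -> 2%:R * y * D y = pev x f^`() * D x.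
Proof.
move=> dD; rewrite -(der_pev dD) -(model_sqr m) expr2 (derM dD).
by ring.
Qed.

(** A derivation over [k] is determined by its value at [x], since
    [2 y Dy = f'(x) Dx]. Hence equality of forms can be tested on [d/dx] alone. *)
Lemma der_line D1 D2 z : derivation D1 -> derivation D2 ->
  D2 x * D1 z = D1 x * D2 z.
Proof.
move=> d1 d2; have [A [B [C [C0 e]]]] := model_gen m z.
have C1 : pev x C != 0 by rewrite pev_eq0 //; exact: model_tr m.
have y2 : 2%:R * y != 0.
  by rewrite mulf_neq0 ?curve_two_neq0 ?(model_y_neq0 m).
have h D : derivation D -> D z * (pev x C * (2%:R * y)) = D x *
    ((pev x A^`() + pev x B^`() * y - z * pev x C^`()) * (2%:R * y)
     + pev x B * pev x f^`()).
  move=> dD; have := congr1 D e.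
  rewrite !(derM dD, derD dD) !(der_pev dD) => e1.
  have e2 := der_y dD.
  have -> : D z * (pev x C * (2%:R * y)) =
    (z * (pev x C^`() * D x) + pev x C * D z) * (2%:R * y) -
    z * (pev x C^`() * D x) * (2%:R * y) by ring.
  rewrite e1.
  have -> : forall a b c d y' w : E, (a + (b * c + d)) * (2%:R * y') - w =
    a * (2%:R * y') + b * (2%:R * y' * c) + d * (2%:R * y') - w by move=> *; ring.
  by rewrite e2; ring.
apply: (mulIf (mulf_neq0 C1 y2)).
by rewrite -!mulrA !h //; ring.
Qed.

(** On [k[x, y]] the Leibniz rule forces [D y = f'(x) / 2y]; the quotient rule
    then extends [D] to the field, independently of the chosen fraction. *)
Lemma der_exists : exists2 D : E -> E, derivation D & D x = 1.
Proof.
have [r rP] := model_rep m.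
have y0 := model_y_neq0 m; have t0 := curve_two_neq0.
pose eta := pev x f^`() / (2%:R * y).
have etaE : eta * (2%:R * y) = pev x f^`() by rewrite divfK ?mulf_neq0.
pose d A B := pev x A^`() + pev x B^`() * y + pev x B * eta.
pose D z := (d (r z).1.1 (r z).1.2 - z * pev x (r z).2^`()) / pev x (r z).2.
have n1 C : C != 0 -> pev x C != 0 by rewrite pev_eq0 //; exact: model_tr m.
have DE z A B C : C != 0 -> z * pev x C = pev x A + pev x B * y ->
    D z = (d A B - z * pev x C^`()) / pev x C.
  move=> C0 e; rewrite /D; have [D0] := rP z.
  case: (r z) D0 => [[A' B'] C'] /= D0 e'.
  have [eA eB] := model_cross m e e'.
  apply/eqP; rewrite eqr_div ?n1 //; apply/eqP.
  have dE P Q R : d (P * R) (Q * R) =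
      d P Q * pev x R + (pev x P + pev x Q * y) * pev x R^`().
    by rewrite /d !(derivD, derivM) !(pevD, pevM); ring.
  have : d (A * C') (B * C') = d (A' * C) (B' * C) by rewrite eA eB.
  rewrite !dE -e -e' => h.
  have -> : (d A' B' - z * pev x C'^`()) * pev x C =
    (d A' B' * pev x C + z * pev x C' * pev x C^`()) -
    z * pev x C' * pev x C^`() - z * pev x C * pev x C'^`() by ring.
  by rewrite -h; ring.
exists D; last first.
  rewrite (DE _ 'X 0 1) ?oner_neq0 // /d ?derivE ?pevE; last by ring.
  by rewrite divr1; ring.
split=> [u v|u v|a].
- have [V0] := rP v; have [U0] := rP u.
  case: (r u) U0 => [[A B] U] /= U0 eu; case: (r v) V0 => [[A' B'] V] /= V0 ev.
  rewrite (DE _ _ _ _ U0 eu) (DE _ _ _ _ V0 ev).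
  rewrite (DE (u + v) (A * V + A' * U) (B * V + B' * U) (U * V)) ?mulf_neq0 //.
  - have -> : d (A * V + A' * U) (B * V + B' * U) = d A B * pev x V
      + (pev x A + pev x B * y) * pev x V^`() + d A' B' * pev x U
      + (pev x A' + pev x B' * y) * pev x U^`().
      by rewrite /d !(derivD, derivM) !(pevD, pevM); ring.
    by rewrite -eu -ev derivM !(pevD, pevM); field; rewrite !n1.
  - rewrite !pevE.
    have -> : (u + v) * (pev x U * pev x V) =
      (u * pev x U) * pev x V + (v * pev x V) * pev x U by ring.
    by rewrite eu ev; ring.
- have [V0] := rP v; have [U0] := rP u.
  case: (r u) U0 => [[A B] U] /= U0 eu; case: (r v) V0 => [[A' B'] V] /= V0 ev.
  rewrite (DE _ _ _ _ U0 eu) (DE _ _ _ _ V0 ev).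
  rewrite (DE (u * v) (A * A' + B * B' * f) (A * B' + A' * B) (U * V)).
  - have -> : d (A * A' + B * B' * f) (A * B' + A' * B) =
      d A B * (pev x A' + pev x B' * y) + d A' B' * (pev x A + pev x B * y).
      rewrite /d !(derivD, derivM) !(pevD, pevM) -etaE -(model_sqr m).
      by ring.
    by rewrite -eu -ev derivM !(pevD, pevM); field; rewrite !n1.
  - by rewrite mulf_neq0.
  - by rewrite !pevE mulrACA eu ev -(model_sqr m); ring.
- rewrite (DE _ a%:P 0 1) ?oner_neq0 // /d ?derivE ?pevE; last by ring.
  by rewrite divr1; ring.
Qed.

End Derivations.

(** * Places and regularity of the standard forms *)

Section LocalRings.

Variable k : closedFieldType.
Variables (E : curve k) (v : E -> int).
Hypothesis pv : place v.

Lemma place_const a : a != 0 -> v (const E a) = 0.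
Proof. by case: pv => h _ _ _; exact: h. Qed.

Lemma place_M f g : f != 0 -> g != 0 -> v (f * g) = v f + v g.
Proof. by case: pv => _ h _ _; exact: h. Qed.

Lemma place_X f n : f != 0 -> v (f ^+ n) = v f *+ n.
Proof.
move=> f0; elim: n => [|n IH].
  by rewrite expr0 -(rmorph1 (const E)) place_const ?oner_neq0.
by rewrite exprS place_M ?expf_neq0 // IH mulrS.
Qed.

Lemma place_N f : v (- f) = v f.
Proof.
have [->|f0] := eqVneq f 0; first by rewrite oppr0.
have n1 : - 1 != 0 :> k by rewrite oppr_eq0 oner_neq0.
rewrite -mulN1r -(rmorphN1 (const E)) place_M ?fmorph_eq0 //.
by rewrite place_const // add0r.
Qed.

Lemma place_V f : f != 0 -> v f^-1 = - v f.
Proof.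
move=> f0; apply/eqP; rewrite -addr_eq0 -place_M ?invr_eq0 // mulVf //.
by rewrite -(rmorph1 (const E)) place_const ?oner_neq0.
Qed.

Lemma place_D n f g : f != 0 -> g != 0 -> f + g != 0 ->
  n <= v f -> n <= v g -> n <= v (f + g).
Proof.
case: pv => _ _ h _ f0 g0 fg0 nf ng; apply: le_trans (h _ _ f0 g0 fg0).
by rewrite le_min nf ng.
Qed.

Lemma local_ring_const a : in_local_ring v (const E a).
Proof.
have [->|a0] := eqVneq a 0; first by rewrite rmorph0; left.
by right; rewrite place_const.
Qed.

Lemma local_ringD f g :
  in_local_ring v f -> in_local_ring v g -> in_local_ring v (f + g).
Proof.
have [->|f0] := eqVneq f 0; first by rewrite add0r.
have [->|g0] := eqVneq g 0; first by rewrite addr0.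
move=> [/eqP|vf]; first by rewrite (negPf f0).
move=> [/eqP|vg]; first by rewrite (negPf g0).
have [->|fg0] := eqVneq (f + g) 0; [by left | right].
exact: place_D.
Qed.

Lemma local_ringM f g :
  in_local_ring v f -> in_local_ring v g -> in_local_ring v (f * g).
Proof.
have [->|f0] := eqVneq f 0; first by rewrite mul0r; left.
have [->|g0] := eqVneq g 0; first by rewrite mulr0; left.
move=> [/eqP|vf]; first by rewrite (negPf f0).
move=> [/eqP|vg]; first by rewrite (negPf g0).
by right; rewrite place_M // addr_ge0.
Qed.

Lemma local_ring_pev x P : in_local_ring v x -> in_local_ring v (pev x P).
Proof.
move=> ox; elim/poly_ind: P => [|P a IH]; first by rewrite pev0; left.
rewrite !pevE; apply: local_ringD; last exact: local_ring_const.
exact: local_ringM.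
Qed.

Lemma local_ring_sqrt f : in_local_ring v (f ^+ 2) -> in_local_ring v f.
Proof.
have [->|f0] := eqVneq f 0; first by left.
move=> [/eqP|]; first by rewrite sqrf_eq0 (negPf f0).
by rewrite place_X // pmulrn_lge0 //; right.
Qed.

End LocalRings.

Section RegularForms.

Variable k : closedFieldType.
Hypothesis two_neq0 : 2%:R != 0 :> k.
Variable E : curve k.

Lemma regular_at_change (v : E -> int) z h z' h' :
  (forall D, derivation D -> z * D h = z' * D h') ->
  regular_at v z h -> regular_at v z' h'.
Proof.
move=> e [s [so se]]; exists s; split=> // D dD.
by rewrite -e // se.
Qed.

(** With [1 = U f + W f'] the form [dx / y] equals [U y dx + 2 W dy], which has
    no pole where [x] has none. *)
Lemma regular_finite (x y : E) f v P : model x y f -> place v ->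
  in_local_ring v x -> regular_at v (pev x P / y) x.
Proof.
move=> m pv ox; have y0 := model_y_neq0 m.
have oy : in_local_ring v y.
  apply: (local_ring_sqrt pv); rewrite (model_sqr m).
  exact: local_ring_pev.
have := model_sep m; rewrite separable_poly.unlock => /Bezout_eq1_coprimepP[[U W] /= UW].
exists [:: (pev x (P * U) * y, x); (pev x (2%:R *: (P * W)), y)]; split.
  move=> ab; rewrite !inE => /orP[] /eqP -> /=; split=> //.
    by apply: local_ringM => //; apply: local_ring_pev.
  exact: local_ring_pev.
move=> D dD; rewrite big_cons big_seq1 /=.
have e1 := congr1 (pev x) UW; rewrite !pevE in e1.
apply: (mulIf y0); rewrite mulrAC divfK // !pevE rmorph_nat.
have -> : (pev x P * pev x U * y * D x + 2 * (pev x P * pev x W) * D y) * y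
  = pev x P * pev x U * y ^+ 2 * D x + pev x P * pev x W * (2 * y * D y) by ring.
rewrite (der_y m dD) (model_sqr m) -[LHS]mul1r -e1.
by ring.
Qed.

Lemma der_inv (D : E -> E) x : derivation D -> x != 0 ->
  D x^-1 = - D x / x ^+ 2.
Proof.
move=> dD x0; rewrite -[x^-1]mul1r (der_div dD) //.
by rewrite -(rmorph1 (const E)) (der_const dD) rmorph1 mul0r add0r mul1r.
Qed.

(** Where [x] has a pole, the form is [- P'(x') dx' / y'] in the chart
    [x' = 1/x], [y' = y / x^(g+1)], with [P'] the reversal of [P] in degree
    [g - 1]; the bound on [P] makes [P'] a polynomial. *)
Lemma regular_everywhere (x y : E) f g v (P : {poly k}) : model x y f -> place v ->
  (g.*2.+1 < size f <= g.*2.+3)%N -> (size P <= g)%N ->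
  regular_at v (pev x P / y) x.
Proof.
move=> m pv sf sP; have x0 := transcendental_neq0 (model_tr m).
have y0 := model_y_neq0 m.
have [vx|vx] := lerP 0 (v x).
  by apply: regular_finite m pv _; right.
have m' := model_inv m sf.
have ox' : in_local_ring v x^-1.
  by right; rewrite (place_V pv) // oppr_ge0 ltW.
case: g => [|g] in sf sP m' *.
  move: sP; rewrite leqn0 size_poly_eq0 => /eqP ->; rewrite pev0 mul0r.
  exists [::]; split=> // D _; by rewrite mul0r big_nil.
have := regular_finite (- revp g P) m' pv ox'; apply: regular_at_change.
move=> D dD; rewrite (der_inv dD x0) pevN.
rewrite -[in RHS](pev_revp x0 sP) 2!exprS.
by field; rewrite x0 y0 expf_neq0.
Qed.

End RegularForms.

(** * Places from evaluations *)

(** A subring of a function field, parametrized by [rho], has an evaluation [ev]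
    into the constants. When the kernel of [ev] is generated by [t] up to
    localization, the order of vanishing along [t] is a place. The parameters
    live in a [choiceType] because the order is extracted from a chosen
    factorization. *)
Section PlaceOfEvaluation.
Variable k : closedFieldType.
Variables (E : curve k) (T : choiceType) (rho : T -> E) (ev : T -> k).

Definition has_value (z : E) (c : k) := exists2 s, rho s = z & ev s = c.

Hypothesis value_uniq : forall z c d, has_value z c -> has_value z d -> c = d.
Hypothesis value_const : forall c, has_value (const E c) c.
Hypothesis valueD : forall z w c d,
  has_value z c -> has_value w d -> has_value (z + w) (c + d).
Hypothesis valueM : forall z w c d,
  has_value z c -> has_value w d -> has_value (z * w) (c * d).

Definition local_unit z := exists2 c, has_value z c & c != 0.

Variable t : E.
Hypothesis t_neq0 : t != 0.
Hypothesis value_t : has_value t 0.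
Hypothesis factor_t : forall s, rho s != 0 -> exists n u w,
  [/\ local_unit u, local_unit w & rho s * u = t ^+ n * w].
Hypothesis fraction_ring : forall z, exists s s',
  rho s' != 0 /\ z * rho s' = rho s.

Lemma value_tX n : (0 < n)%N -> has_value (t ^+ n) 0.
Proof.
elim: n => // -[|n] IH _; first exact: value_t.
by rewrite exprS -[0](mul0r 0); apply: valueM => //; apply: IH.
Qed.

Lemma local_unitM z w : local_unit z -> local_unit w -> local_unit (z * w).
Proof.
move=> [c zc c0] [d wd d0]; exists (c * d); first exact: valueM.
by rewrite mulf_neq0.
Qed.

Lemma local_unit1 : local_unit 1.
Proof.
exists 1; last exact: oner_neq0.
by rewrite -(rmorph1 (const E)); apply: value_const.
Qed.

Lemma local_unit_neq0 z : local_unit z -> z != 0.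
Proof.
move=> [c zc c0]; apply: contra_neq c0 => z0; apply: value_uniq zc _.
by rewrite z0 -(rmorph0 (const E)); apply: value_const.
Qed.

(** If [m < n], cancelling [t^m] would write the unit [u] as a multiple of [t]. *)
Lemma local_unit_order s c n m u w : has_value s c -> local_unit u ->
  local_unit w -> s * t ^+ n * w = t ^+ m * u -> (n <= m)%N.
Proof.
move=> sc [d ud d0] [e we e0] h; rewrite leqNgt; apply/negP => lt_mn.
have tm : t ^+ m != 0 by rewrite expf_neq0.
have hu : u = s * t ^+ (n - m) * w.
  apply: (mulfI tm); rewrite -h -{1}(subnK (ltnW lt_mn)) exprD.
  by rewrite mulrA [LHS]mulrAC [RHS]mulrC -!mulrA.
have u0 : has_value u (c * 0 * e).
  rewrite hu; apply: valueM => //; apply: valueM => //; apply: value_tX.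
  by rewrite subn_gt0.
by move: d0; rewrite (value_uniq ud u0) mulr0 mul0r eqxx.
Qed.

(** The order is [m - n]; two exponents avoid negative powers of [t]. *)
Definition order_of z n m := exists u w,
  [/\ local_unit u, local_unit w & z * t ^+ n * u = t ^+ m * w].

Lemma order_exists z : z != 0 -> exists n m, order_of z n m.
Proof.
move=> z0; have [s [s' [s0 e]]] := fraction_ring z.
have rs0 : rho s != 0 by rewrite -e mulf_neq0.
have [m [u [w [hu hw h]]]] := factor_t rs0.
have [n [u' [w' [hu' hw' h']]]] := factor_t s0.
exists n, m, (w' * u), (w * u'); split; [exact: local_unitM.. |].
have -> : z * t ^+ n * (w' * u) = z * (t ^+ n * w') * u by ring.
by rewrite -h' mulrA e mulrAC h mulrA.
Qed.

Lemma order_fun : exists v : E -> int, forall z n m, z != 0 ->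
  order_of z n m -> v z = m%:Z - n%:Z.
Proof.
have ex z : exists r : nat * nat * (T * T), (z == 0) ||
    [&& ev r.2.1 != 0, ev r.2.2 != 0 &
        z * t ^+ r.1.1 * rho r.2.1 == t ^+ r.1.2 * rho r.2.2].
  have [->|z0] := eqVneq z 0.
    by have [s [s' _]] := fraction_ring 0; exists (0%N, 0%N, (s, s')).
  have [n [m [u [w [[c [s <- <-] c0] [d [s' <- <-] d0] e]]]]] := order_exists z0.
  by exists (n, m, (s, s')); rewrite /= c0 d0 e eqxx.
exists (fun z => (xchoose (ex z)).1.2%:Z - (xchoose (ex z)).1.1%:Z).
move=> z n m z0 [u [w [hu hw e]]].
have := xchooseP (ex z); move: (xchoose (ex z)) => [[n' m'] [s s']] /=.
rewrite (negPf z0) /= => /and3P[c0 d0 /eqP e'].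
have hs : local_unit (rho s) by exists (ev s) => //; exists s.
have hs' : local_unit (rho s') by exists (ev s') => //; exists s'.
have [c uc _] := hu.
have e1 : t ^+ (m' + n) * (rho s' * u) = t ^+ (m + n') * (rho s * w).
  have -> : t ^+ (m' + n) * (rho s' * u) = t ^+ m' * rho s' * (t ^+ n * u).
    by rewrite exprD; ring.
  rewrite -e'; have -> : z * t ^+ n' * rho s * (t ^+ n * u) =
    z * t ^+ n * u * (t ^+ n' * rho s) by ring.
  by rewrite e exprD; ring.
have l1 : (m' + n <= m + n')%N.
  apply: (@local_unit_order 1 1 _ _ (rho s * w) (rho s' * u)).
  - by rewrite -(rmorph1 (const E)); apply: value_const.
  - exact: local_unitM.
  - exact: local_unitM.
  - by rewrite mul1r.
have l2 : (m + n' <= m' + n)%N.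
  apply: (@local_unit_order 1 1 _ _ (rho s' * u) (rho s * w)).
  - by rewrite -(rmorph1 (const E)); apply: value_const.
  - exact: local_unitM.
  - exact: local_unitM.
  - by rewrite mul1r.
lia.
Qed.

Lemma place_of_evaluation : exists v : E -> int,
  [/\ place v, v t = 1, forall u, local_unit u -> v u = 0
    & forall z, in_local_ring v z -> exists u s,
        [/\ local_unit u, exists c, has_value s c & z * u = s]].
Proof.
have [v vE] := order_fun.
have v_unit u : local_unit u -> v u = 0.
  move=> hu; rewrite (vE _ 0%N 0%N) ?subrr ?local_unit_neq0 //.
  by exists 1, u; split=> //; [exact: local_unit1 | rewrite expr0 !mulr1 mul1r].
have vt : v t = 1.
  rewrite (vE _ 0%N 1%N) //; exists 1, 1.
  by split; [exact: local_unit1.. | rewrite expr0 expr1 !mulr1].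
have v_ge z n m u s c : z != 0 -> local_unit u -> has_value s c ->
    z * t ^+ n * u = s * t ^+ m -> m%:Z - n%:Z <= v z.
  move=> z0 hu sc e; have [n' [m' o]] := order_exists z0.
  rewrite (vE _ _ _ z0 o); have [u' [w' [hu' hw' e']]] := o.
  suff : (m + n' <= m' + n)%N by lia.
  apply: (@local_unit_order s c _ _ (w' * u) u') => //; first exact: local_unitM.
  have -> : s * t ^+ (m + n') * u' = s * t ^+ m * (t ^+ n' * u').
    by rewrite exprD; ring.
  rewrite -e; have -> : z * t ^+ n * u * (t ^+ n' * u') =
    z * t ^+ n' * u' * (t ^+ n * u) by ring.
  by rewrite e' exprD; ring.
exists v; split=> //; last first.
  move=> z [->|vz].
    exists 1, 0; split; [exact: local_unit1 | exists 0 | by rewrite mul0r].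
    by rewrite -(rmorph0 (const E)); apply: value_const.
  have [z0|z0] := eqVneq z 0.
    exists 1, 0; split; [exact: local_unit1 | exists 0 | by rewrite z0 mul0r].
    by rewrite -(rmorph0 (const E)); apply: value_const.
  have [n [m o]] := order_exists z0.
  move: vz; rewrite (vE _ _ _ z0 o); have [u [w [hu hw e]]] := o => nm.
  have le_nm : (n <= m)%N by lia.
  have [d wd d0] := hw.
  exists u, (t ^+ (m - n) * w); split=> //.
    have [->|nm0] := eqVneq n m.
      by exists d; rewrite subnn expr0 mul1r.
    by exists (0 * d); apply: valueM => //; apply: value_tX; lia.
  have tn : t ^+ n != 0 by rewrite expf_neq0.
  apply: (mulfI tn); rewrite [RHS]mulrA -exprD subnKC // -e.
  by ring.
split=> [a a0|f g f0 g0|f g f0 g0 fg0|].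
- by apply: v_unit; exists a.
- have [n [m o]] := order_exists f0; have [n' [m' o']] := order_exists g0.
  rewrite (vE _ _ _ f0 o) (vE _ _ _ g0 o').
  have [u [w [hu hw e]]] := o; have [u' [w' [hu' hw' e']]] := o'.
  rewrite (vE _ (n + n')%N (m + m')%N); [lia | by rewrite mulf_neq0 |].
  exists (u * u'), (w * w'); split; [exact: local_unitM.. |].
  rewrite !exprD; have -> : f * g * (t ^+ n * t ^+ n') * (u * u') =
    (f * t ^+ n * u) * (g * t ^+ n' * u') by ring.
  by rewrite e e'; ring.
- wlog: f g f0 g0 fg0 / v f <= v g => [h|le_fg].
    case/orP: (le_total (v f) (v g)) => le; first exact: h.
    by rewrite minC addrC; apply: h => //; rewrite addrC.
  rewrite (min_idPl le_fg).
  have [n [m o]] := order_exists f0; have [n' [m' o']] := order_exists g0.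
  move: le_fg; rewrite (vE _ _ _ f0 o) (vE _ _ _ g0 o') => le_fg.
  have [u [w [hu hw e]]] := o; have [u' [w' [hu' hw' e']]] := o'.
  have le1 : (m + n' <= m' + n)%N by lia.
  have -> : m%:Z - n%:Z = (m + n')%:Z - (n + n')%:Z by lia.
  have [c uc c0] := hu; have [c' uc' c0'] := hu'.
  have [d wd d0] := hw; have [d' wd' d0'] := hw'.
  have [q vq] : exists q, has_value (t ^+ (m' + n - (m + n'))) q.
    have [->|h] := posnP (m' + n - (m + n'))%N; last first.
      by exists 0; apply: value_tX.
    by exists 1; rewrite expr0 -(rmorph1 (const E)); apply: value_const.
  apply: (v_ge _ _ _ (u * u') (w * u' + t ^+ (m' + n - (m + n')) * w' * u)
    (d * c' + q * d' * c)) => //.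
  + exact: local_unitM.
  + by apply: valueD; apply: valueM => //; apply: valueM.
  + have -> : (f + g) * t ^+ (n + n') * (u * u') =
      (f * t ^+ n * u) * (t ^+ n' * u') + (g * t ^+ n' * u') * (t ^+ n * u).
      by rewrite exprD; ring.
    rewrite e e'; have -> : t ^+ m' * w' * (t ^+ n * u) =
      t ^+ (m' + n) * w' * u by rewrite exprD; ring.
    by rewrite -{1}(subnK le1) exprD [t ^+ (m + n')]exprD; ring.
- by exists t.
Qed.

End PlaceOfEvaluation.

(** * Places above the affine line *)

Section PlacesOfModel.

Variable k : closedFieldType.
Hypothesis two_neq0 : 2%:R != 0 :> k.
Variables (E : curve k) (x y : E) (f : {poly k}).
Hypothesis m : model x y f.

Definition affine_fun (p : {poly k} * {poly k}) : E :=
  pev x p.1 + pev x p.2 * y.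

Definition affine_conj (p : {poly k} * {poly k}) := (p.1, - p.2).

Definition affine_mul (p q : {poly k} * {poly k}) :=
  (p.1 * q.1 + p.2 * q.2 * f, p.1 * q.2 + p.2 * q.1).

Definition affine_norm (p : {poly k} * {poly k}) :=
  p.1 ^+ 2 - p.2 ^+ 2 * f.

Lemma affine_funM p q :
  affine_fun (affine_mul p q) = affine_fun p * affine_fun q.
Proof. by rewrite /affine_fun !pevE /= -(model_sqr m); ring. Qed.

Lemma affine_funD p q : affine_fun (p.1 + q.1, p.2 + q.2) =
  affine_fun p + affine_fun q.
Proof. by rewrite /affine_fun !pevE /=; ring. Qed.

Lemma affine_fun_inj : injective affine_fun.
Proof. by case=> A B [A' B'] /(model_inj m)[/= -> ->]. Qed.

Lemma affine_fun0 : affine_fun (0, 0) = 0.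
Proof. by rewrite /affine_fun !pevE mul0r addr0. Qed.

Lemma affine_fun_eq0 p : (affine_fun p == 0) = (p == (0, 0)).
Proof. by rewrite -affine_fun0 (inj_eq affine_fun_inj). Qed.

Lemma affine_fun_poly P : affine_fun (P, 0) = pev x P.
Proof. by rewrite /affine_fun /= pev0 mul0r addr0. Qed.

Lemma affine_normE p :
  affine_fun p * affine_fun (affine_conj p) = pev x (affine_norm p).
Proof. by rewrite /affine_fun !pevE /= -(model_sqr m); ring. Qed.

Lemma affine_norm_eq0 p : (affine_norm p == 0) = (p == (0, 0)).
Proof.
rewrite -(pev_eq0 _ (model_tr m)) -affine_normE mulf_eq0 !affine_fun_eq0.
by rewrite -!pair_eqE /= oppr_eq0 orbb.
Qed.

Section OnePoint.

Variables a b : k.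
Hypothesis ab : b ^+ 2 = f.[a].

Definition affine_ev (p : {poly k} * {poly k}) := p.1.[a] + p.2.[a] * b.

Lemma affine_evM p q : affine_ev (affine_mul p q) = affine_ev p * affine_ev q.
Proof. by rewrite /affine_ev /= !hornerE -ab; ring. Qed.

(** A uniformizer at the point [(a, b)]: where [b = 0], the function [x - a]
    vanishes to order 2. *)
Definition affine_param : E := if b == 0 then y else x - const E a.

Notation unit_at := (local_unit affine_fun affine_ev).

Lemma unit_at_affine p : affine_ev p != 0 -> unit_at (affine_fun p).
Proof. by move=> h; exists (affine_ev p) => //; exists p. Qed.

Lemma unit_atM z w : unit_at z -> unit_at w -> unit_at (z * w).
Proof.
move=> [c [p <- <-] c0] [d [q <- <-] d0]; rewrite -affine_funM.
by apply: unit_at_affine; rewrite affine_evM mulf_neq0.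
Qed.

Lemma unit_at1 : unit_at 1.
Proof.
rewrite -(pev1 x) -affine_fun_poly; apply: unit_at_affine.
by rewrite /affine_ev /= !hornerE oner_neq0.
Qed.

Lemma affine_param_XsubC : exists j u w,
  [/\ unit_at u, unit_at w & (x - const E a) * u = affine_param ^+ j * w].
Proof.
rewrite /affine_param; case: eqP => b0; last first.
  by exists 1%N, 1, 1; split; [exact: unit_at1.. | rewrite expr1].
have ra : root f a by rewrite /root -ab b0 expr0n.
have [g [fg ga]] := separable_factor (model_sep m) ra.
exists 2%N, (pev x g), 1; split; last first.
- by rewrite mulr1 (model_sqr m) fg pevE pev_XsubC.
- exact: unit_at1.
rewrite -affine_fun_poly; apply: unit_at_affine.
by rewrite /affine_ev /= horner0 mul0r addr0.
Qed.

(** After common factors [x - a] are removed, an element vanishing at [(a, b)] is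
    treated as follows. If [b != 0], its conjugate does not vanish there, and
    its norm, a polynomial in [x], carries the order of vanishing. If [b = 0],
    write [f = (X - a) g]; then [y] divides [p] once up to the unit [g]. *)
Lemma affine_factor p : affine_fun p != 0 -> exists n u w,
  [/\ unit_at u, unit_at w & affine_fun p * u = affine_param ^+ n * w].
Proof.
have [N] := ubnP (size p.1 + size p.2); elim: N => // N IH in p * => sN p0.
have [/andP[/factor_theorem[A eA] /factor_theorem[B eB]]|nr] :=
  boolP (root p.1 a && root p.2 a).
  have ep : affine_fun p = affine_fun (A, B) * (x - const E a).
    by rewrite /affine_fun eA eB !pevM pev_XsubC /=; ring.
  have p1 : affine_fun (A, B) != 0.
    by apply: contra_neq p0 => h; rewrite ep h mul0r.
  have sAB : (size A + size B < N)%N.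
    move: sN; rewrite ltnS; apply: leq_trans; rewrite eA eB.
    have sz (C : {poly k}) : size (C * ('X - a%:P)) = (size C + (C != 0%R))%N.
      have [->|C0] := eqVneq C 0; first by rewrite mul0r size_poly0.
      by rewrite size_mul ?polyXsubC_eq0 // size_XsubC addn2 addn1.
    rewrite !sz; move: p1; rewrite affine_fun_eq0 -pair_eqE /= negb_and.
    move: (size A) (size B) => i j.
    by case: (A != 0); case: (B != 0) => //= _; rewrite ?addn0 ?addn1; lia.
  have [n [u [w [hu hw e]]]] := IH (A, B) sAB p1.
  have [j [u' [w' [hu' hw' e']]]] := affine_param_XsubC.
  exists (n + j)%N, (u * u'), (w * w'); split; [exact: unit_atM.. |].
  rewrite exprD ep; have -> : affine_fun (A, B) * (x - const E a) * (u * u') =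
    affine_fun (A, B) * u * ((x - const E a) * u') by ring.
  by rewrite e e'; ring.
have [ep0|ep] := eqVneq (affine_ev p) 0; last first.
  exists 0%N, 1, (affine_fun p); split; first exact: unit_at1.
    exact: unit_at_affine.
  by rewrite expr0 mulr1 mul1r.
rewrite /affine_param; have [b0|b0] := eqVneq b 0.
  have p1a : p.1.[a] = 0 by move: ep0; rewrite /affine_ev b0 mulr0 addr0.
  have p2a : p.2.[a] != 0 by move: nr; rewrite /root p1a eqxx.
  have [A eA] : exists A, p.1 = A * ('X - a%:P).
    by apply/factor_theorem; rewrite /root p1a.
  have ra : root f a by rewrite /root -ab b0 expr0n.
  have [g [fg ga]] := separable_factor (model_sep m) ra.
  exists 1%N, (pev x g), (affine_fun (g * p.2, A)); split.
  - rewrite -affine_fun_poly; apply: unit_at_affine.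
    by rewrite /affine_ev /= horner0 mul0r addr0.
  - apply: unit_at_affine; rewrite /affine_ev /= b0 mulr0 addr0 hornerM.
    by rewrite mulf_neq0.
  - rewrite expr1 /affine_fun /= eA !pevM pev_XsubC.
    have e := model_sqr m; rewrite fg pevM pev_XsubC in e.
    have -> : y * (pev x g * pev x p.2 + pev x A * y) =
      y * pev x g * pev x p.2 + pev x A * y ^+ 2 by ring.
    by rewrite e; ring.
have c0 : affine_ev (affine_conj p) != 0.
  apply: contraNN nr => /eqP.
  have -> : affine_ev (affine_conj p) = p.1.[a] - p.2.[a] * b.
    by rewrite /affine_ev /= hornerN mulNr.
  move=> h; have h1 : 2%:R * p.1.[a] = 0.
    have -> : 2%:R * p.1.[a] = (p.1.[a] - p.2.[a] * b) + affine_ev p.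
      by rewrite /affine_ev; ring.
    by rewrite h ep0 addr0.
  have h2 : 2%:R * (p.2.[a] * b) = 0.
    have -> : 2%:R * (p.2.[a] * b) = affine_ev p - (p.1.[a] - p.2.[a] * b).
      by rewrite /affine_ev; ring.
    by rewrite h ep0 subr0.
  move/eqP: h1; rewrite mulf_eq0 (negPf two_neq0) /= /root => ->.
  by move/eqP: h2; rewrite !mulf_eq0 (negPf two_neq0) (negPf b0) orbF.
have N0 : affine_norm p != 0 by rewrite affine_norm_eq0 -affine_fun_eq0.
have [n [q]] := multiplicity_XsubC (affine_norm p) a.
rewrite N0 /= => qa eN.
exists n, (affine_fun (affine_conj p)), (pev x q); split.
- exact: unit_at_affine.
- rewrite -affine_fun_poly; apply: unit_at_affine.
  by rewrite /affine_ev /= horner0 mul0r addr0.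
- by rewrite affine_normE eN pevM pevXn pev_XsubC mulrC.
Qed.

Lemma place_over : exists v : E -> int,
  [/\ place v, v affine_param = 1,
      forall p, affine_ev p != 0 -> v (affine_fun p) = 0
    & forall z, in_local_ring v z -> exists q p,
        affine_ev q != 0 /\ z * affine_fun q = affine_fun p].
Proof.
have [||||||||v [pv vt vu vz]] :=
    @place_of_evaluation k E _ affine_fun affine_ev _ _ _ _ affine_param.
- by move=> z c d [p <- <-] [q /affine_fun_inj <- <-].
- move=> c; exists (c%:P, 0).
    by rewrite affine_fun_poly pevC.
  by rewrite /affine_ev /= !hornerE.
- move=> z w c d [p <- <-] [q <- <-]; exists (p.1 + q.1, p.2 + q.2).
    exact: affine_funD.
  by rewrite /affine_ev /= !hornerD mulrDl addrACA.
- move=> z w c d [p <- <-] [q <- <-]; exists (affine_mul p q).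
    exact: affine_funM.
  exact: affine_evM.
- rewrite /affine_param; case: ifP => _; first exact: model_y_neq0 m.
  by rewrite subr_eq0 transcendental_neq //; exact: model_tr m.
- rewrite /affine_param; case: eqP => b0.
    by exists (0, 1); rewrite /affine_fun /affine_ev /= ?b0 ?hornerE ?pevE;
       rewrite ?mul1r ?add0r.
  exists ('X - a%:P, 0); first by rewrite affine_fun_poly pev_XsubC.
  by rewrite /affine_ev /= !hornerE subrr.
- exact: affine_factor.
- move=> z; have [A [B [C [C0 e]]]] := model_gen m z.
  exists (A, B), (C, 0); rewrite affine_fun_poly; split=> //.
  by rewrite pev_eq0 //; exact: model_tr m.
exists v; split=> //; first by move=> p /unit_at_affine; apply: vu.
move=> z /vz[u [s [[c [q <- <-] c0] [d [p <- _]] e]]].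
by exists q, p.
Qed.

End OnePoint.

End PlacesOfModel.

(** * Regular differential forms *)

Section RegularDifferentials.

Variable k : closedFieldType.
Hypothesis two_neq0 : 2%:R != 0 :> k.
Variable E : curve k.

Section Integrality.

Variables (x y : E) (f : {poly k}).
Hypothesis m : model x y f.

Notation rho := (affine_fun x y).

Definition integral z := exists p, z = rho p.

Lemma integralD z w : integral z -> integral w -> integral (z + w).
Proof.
move=> [p ->] [q ->]; exists (p.1 + q.1, p.2 + q.2).
by rewrite affine_funD.
Qed.

Lemma integralM z w : integral z -> integral w -> integral (z * w).
Proof.
by move=> [p ->] [q ->]; exists (affine_mul f p q); rewrite (affine_funM m).
Qed.

Lemma integral_pev P : integral (pev x P).
Proof. by exists (P, 0); rewrite affine_fun_poly. Qed.

Lemma integralN z : integral z -> integral (- z).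
Proof.
move=> iz; rewrite -mulN1r -(pev1 x) -pevN.
exact: integralM (integral_pev _) iz.
Qed.

Lemma integral_rho p : integral (rho p).
Proof. by exists p. Qed.

Lemma integral_der D p : derivation D -> D x = 1 -> integral (y * D (rho p)).
Proof.
move=> dD Dx; exists (p.2^`() * f + 2%:R^-1 *: (p.2 * f^`()), p.1^`()).
have c2 := curve_two_neq0 E two_neq0.
have e : y * D y = pev x f^`() / 2%:R.
  apply: (mulIf c2); rewrite divfK //.
  by have := der_y m dD; rewrite Dx mulr1 => <-; ring.
rewrite /affine_fun /= (derD dD) (derM dD) !(der_pev dD) Dx !pevE.
rewrite fmorphV rmorph_nat -(model_sqr m).
have -> : y * (pev x p.1^`() * 1 + (pev x p.2 * D y + y * (pev x p.2^`() * 1)))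
  = pev x p.1^`() * y + pev x p.2 * (y * D y) + pev x p.2^`() * y ^+ 2 by ring.
by rewrite e; ring.
Qed.

Section OnePoint.

Variables a b : k.
Hypothesis ab : b ^+ 2 = f.[a].

(** The local ring of [k[x, y]] at [(a, b)]. *)
Definition localized z := exists2 q, affine_ev a b q != 0 & integral (z * rho q).

Lemma localizedD z w : localized z -> localized w -> localized (z + w).
Proof.
move=> [q q0 iz] [r r0 iw]; exists (affine_mul f q r).
  by rewrite (affine_evM ab) mulf_neq0.
rewrite (affine_funM m).
have -> : (z + w) * (rho q * rho r) = z * rho q * rho r + w * rho r * rho q.
  by ring.
by apply: integralD; apply: integralM => //; apply: integral_rho.
Qed.

Lemma localizedM z w : localized z -> localized w -> localized (z * w).
Proof.
move=> [q q0 iz] [r r0 iw]; exists (affine_mul f q r).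
  by rewrite (affine_evM ab) mulf_neq0.
by rewrite (affine_funM m) mulrACA; apply: integralM.
Qed.

Lemma localized0 : localized 0.
Proof.
exists (1, 0); first by rewrite /affine_ev /= !hornerE oner_neq0.
by rewrite mul0r -(pev0 x); apply: integral_pev.
Qed.

Lemma localized_der D z : derivation D -> D x = 1 -> localized z ->
  localized (y * D z).
Proof.
move=> dD Dx [q q0 [p e]]; exists (affine_mul f q q).
  by rewrite (affine_evM ab) mulf_neq0.
have e' : y * D (rho p) = y * (z * D (rho q)) + y * (rho q * D z).
  by rewrite -e (derM dD) mulrDr.
have -> : y * D z * rho (affine_mul f q q) =
    y * D (rho p) * rho q + - (rho p * (y * D (rho q))).
  by rewrite (affine_funM m) e' -e; ring.
apply: integralD; first by apply: integralM; [exact: integral_der | exact: integral_rho].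
by apply/integralN/integralM; [exact: integral_rho | exact: integral_der].
Qed.

(** The derivation [y d/dx] preserves every local ring above the affine line, so
    no regular form [z dx] can have [z y] outside of it. *)
Lemma regular_localized z :
  (forall v, place v -> regular_at v z x) -> localized (z * y).
Proof.
move=> reg; have [v [pv _ _ vO]] := place_over two_neq0 m ab.
have [D dD Dx] := der_exists two_neq0 m.
have [s [so se]] := reg v pv; have {}se := se D dD.
rewrite Dx mulr1 in se; rewrite se mulr_suml big_seq.
apply: (big_ind localized); [exact: localized0 | exact: localizedD |].
have vO' u : in_local_ring v u -> localized u.
  by move=> /vO[q [p [q0 e]]]; exists q => //; exists p.
move=> i /so[i1 i2].
have -> : i.1 * D i.2 * y = i.1 * (y * D i.2) by ring.
apply: localizedM; first exact: vO'.
by apply: localized_der => //; apply: vO'.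
Qed.

End OnePoint.

(** Elements lying in the local ring of every affine point lie in [k[x, y]]:
    a common denominator, if not constant, can be lowered at any of its roots. *)
Lemma localized_integral w :
  (forall a b, b ^+ 2 = f.[a] -> localized a b w) -> integral w.
Proof.
move=> loc; pose I P := integral (w * pev x P).
(* the denominators of [w] avoid both points above [a], so some norm avoids [a] *)
have I_avoid a : exists2 P, I P & P.[a] != 0.
  have [b ab] := solve_monicpoly (fun i => if i == 0%N then f.[a] else 0) (ltn0Sn 1).
  rewrite !big_ord_recl big_ord0 /= expr0 mulr1 mul0r !addr0 in ab.
  have ab' : (- b) ^+ 2 = f.[a] by rewrite sqrrN.
  have norm q : integral (w * rho q) -> I (affine_norm f q).
    move=> h; rewrite /I -(affine_normE m) mulrA.
    by apply: integralM => //; apply: integral_rho.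
  have normE q : (affine_norm f q).[a] = affine_ev a b q * affine_ev a (- b) q.
    by rewrite /affine_norm /affine_ev !hornerE -ab; ring.
  have [q q0 iq] := loc a b ab; have [r r0 ir] := loc a _ ab'.
  have [q1|q1] := eqVneq (affine_ev a (- b) q) 0; last first.
    by exists (affine_norm f q); [exact: norm | rewrite normE mulf_neq0].
  have [r1|r1] := eqVneq (affine_ev a b r) 0; last first.
    by exists (affine_norm f r); [exact: norm | rewrite normE mulf_neq0].
  have evD c : affine_ev a c (q.1 + r.1, q.2 + r.2) = affine_ev a c q + affine_ev a c r.
    by rewrite /affine_ev /= !hornerD mulrDl addrACA.
  exists (affine_norm f (q.1 + r.1, q.2 + r.2)).
    by apply: norm; rewrite affine_funD mulrDr; apply: integralD.
  by rewrite normE !evD q1 r1 addr0 add0r mulf_neq0.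
have I_red N (P : {poly k}) : (size P <= N)%N -> P != 0 -> I P -> integral w.
  elim: N P => [|N IH] P sP P0 IP.
    by move: sP; rewrite leqn0 size_poly_eq0 (negPf P0).
  have [/eqP/size_poly1P[c c0 Pc]|/closed_rootP[a /factor_theorem[Q PQ]]] :=
      eqVneq (size P) 1%N.
    have -> : w = w * pev x P * pev x (c^-1)%:P.
      by rewrite Pc -mulrA -pevM -polyCM divff // pev1 mulr1.
    by apply: integralM => //; apply: integral_pev.
  have Q0 : Q != 0 by apply: contra_neq P0 => Q0; rewrite PQ Q0 mul0r.
  apply: (IH Q) => //.
    by move: sP; rewrite PQ size_mul ?polyXsubC_eq0 // size_XsubC addn2.
  have [C IC Ca] := I_avoid a.
  have [C1 eC] : exists C1, C - C.[a]%:P = C1 * ('X - a%:P).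
    by apply/factor_theorem; rewrite /root !hornerE subrr.
  have eQ : Q = C.[a]^-1 *: (C * Q - P * C1).
    apply: (canRL (scalerK Ca)); rewrite -mul_polyC.
    have -> : C = C1 * ('X - a%:P) + C.[a]%:P by rewrite -eC subrK.
    by rewrite PQ !hornerE subrr mulr0 add0r; ring.
  rewrite /I eQ !pevE.
  have -> : w * (const E C.[a]^-1 * (pev x C * pev x Q - pev x P * pev x C1)) =
    pev x (C.[a]^-1)%:P * (w * pev x C * pev x Q + - (w * pev x P * pev x C1)).
    by rewrite pevC; ring.
  apply: integralM; first exact: integral_pev.
  by apply: integralD; [|apply: integralN]; apply: integralM => //; apply: integral_pev.
have [A [B [C [C0 e]]]] := model_gen m w.
apply: (I_red (size C) C) => //; rewrite /I e.
by exists (A, B).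
Qed.

End Integrality.

(** For a regular [z dx], the element [z y] is integral in the affine chart, and
    the corresponding element is integral in the chart at infinity. *)
Theorem regular_forms (x y : E) f g z : model x y f ->
  (g.*2.+1 < size f <= g.*2.+3)%N ->
  (forall v, place v -> regular_at v z x) <->
  exists2 P : {poly k}, (size P <= g)%N & z = pev x P / y.
Proof.
move=> m sf; have x0 := transcendental_neq0 (model_tr m).
have y0 := model_y_neq0 m.
split=> [reg|[P sP ->] v pv]; last exact: (regular_everywhere m pv sf sP).
have [[A B] eAB] : integral x y (z * y).
  by apply: (localized_integral m) => a b ab; apply: (regular_localized m).
have m' := model_inv m sf.
have [[A' B'] eAB'] : integral x^-1 (y / x ^+ g.+1) (- (z * x ^+ 2) * (y / x ^+ g.+1)).
  apply: (localized_integral m') => a b ab; apply: (regular_localized m' ab).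
  move=> v /reg; apply: regular_at_change => D dD.
  by rewrite (der_inv dD x0); field.
pose N := maxn (size A') (size B').
have sA : (size A' <= N.+1)%N by rewrite leqW // leq_maxl.
have sB : (size B' <= N.+1)%N by rewrite leqW // leq_maxr.
rewrite /affine_fun /= in eAB eAB'.
have xg : x ^+ g.+1 != 0 by rewrite expf_neq0.
(* [z y] in both charts, cleared of denominators: the powers of [x] force
   [B = 0] and bound the degree of [A] *)
have e : pev x (A * 'X^(N.+2)) + pev x (B * 'X^(N.+2)) * y =
    pev x (- (revp N A' * 'X^(g.+1))) + pev x (- revp N B') * y.
  have eA := pev_revp x0 (size_revp N A'); rewrite (revpK sA) in eA.
  have eB := pev_revp x0 (size_revp N B'); rewrite (revpK sB) in eB.
  rewrite !pevE -eA -eB.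
  have -> : pev x A * x ^+ N.+2 + pev x B * x ^+ N.+2 * y = z * y * x ^+ 2 * x ^+ N.
    by rewrite eAB !exprS; ring.
  have -> : z * y * x ^+ 2 * x ^+ N =
      - (- (z * x ^+ 2) * (y / x ^+ g.+1)) * x ^+ g.+1 * x ^+ N by field.
  by rewrite eAB'; field.
have [hA hB] := model_inj m e.
have B0 : B = 0.
  apply/eqP/negPn/negP => B0; have := congr1 (fun P : {poly k} => size P) hB.
  rewrite /= size_mulXn // size_polyN => h.
  by have := size_revp N B'; rewrite -h; lia.
exists A; last by rewrite -[LHS](mulfK y0) eAB B0 pev0 mul0r addr0.
have [->|A0] := eqVneq A 0; first by rewrite size_poly0.
have := congr1 (fun P : {poly k} => size P) hA.
rewrite /= size_mulXn // size_polyN => h.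
have A1 : revp N A' != 0.
  apply: contra_neq A0 => r0; apply/eqP; rewrite -size_poly_eq0.
  by move: h; rewrite r0 mul0r size_poly0.
have := size_revp N A'; move: h; rewrite size_mulXn //.
by move: (size A) (size (revp N A')) => i j; lia.
Qed.

Lemma regular_forms_dim (x y : E) f g : model x y f ->
  (g.*2.+1 < size f <= g.*2.+3)%N ->
  has_dim (fun z => forall v, place v -> regular_at v z x) g.
Proof.
move=> m sf; have y0 := model_y_neq0 m.
have size_row (c : 'I_g -> k) : (size (rVpoly (\row_i c i)) <= g)%N.
  exact: size_poly.
have sumE (c : 'I_g -> k) : \sum_i const E (c i) * (x ^+ i / y) =
    pev x (rVpoly (\row_i c i)) / y.
  rewrite (pev_sum _ (size_row c)) mulr_suml; apply: eq_bigr => i _.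
  by rewrite coef_rVpoly_ord mxE mulrA.
exists (fun i => x ^+ i / y); split=> [z|c].
  split=> [/(regular_forms z m sf)[P sP ->]|[c ->]].
    exists (fun i => P`_i); rewrite (pev_sum _ sP) mulr_suml.
    by apply: eq_bigr => i _; rewrite mulrA.
  by apply/(regular_forms _ m sf); exists (rVpoly (\row_i c i));
    [exact: size_row | exact: sumE].
rewrite sumE => /eqP; rewrite mulf_eq0 invr_eq0 (negPf y0) orbF.
rewrite (pev_eq0 _ (model_tr m)) => /eqP c0 i.
have := coef_rVpoly_ord (\row_i c i) i.
by rewrite c0 coef0 mxE.
Qed.

Corollary genus_of_model (x y : E) f g : model x y f ->
  (g.*2.+1 < size f <= g.*2.+3)%N -> has_genus E g.
Proof.
move=> m sf; have [D dD Dx] := der_exists two_neq0 m.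
exists x; first by exists D; rewrite Dx oner_neq0.
exact: regular_forms_dim m sf.
Qed.

End RegularDifferentials.

(** * Uniqueness of the genus and of the hyperelliptic coordinate *)

Section Dimension.

Variable k : closedFieldType.
Variable E : curve k.

Lemma has_dim_leq (V : E -> Prop) n1 n2 :
  has_dim V n1 -> has_dim V n2 -> (n1 <= n2)%N.
Proof.
move=> [b [Vb fb]] [b' [Vb' _]].
have coords i : exists c : {ffun 'I_n2 -> k}, b i == \sum_j const E (c j) * b' j.
  have /Vb'[c e] : V (b i).
    apply/Vb; exists (fun j => (j == i)%:R).
    rewrite (bigD1 i) //= eqxx rmorph1 mul1r big1 ?addr0 // => j /negPf ->.
    by rewrite rmorph0 mul0r.
  exists [ffun j => c j]; rewrite e; apply/eqP.
  by apply: eq_bigr => j _; rewrite ffunE.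
pose M := \matrix_(i, j) xchoose (coords i) j.
have bE i : b i = \sum_j const E (M i j) * b' j.
  rewrite [LHS](eqP (xchooseP (coords i))).
  by apply: eq_bigr => j _; rewrite mxE.
suff fM : row_free M by rewrite -(eqP fM) rank_leq_col.
rewrite -kermx_eq0; apply/eqP/row_matrixP => r; rewrite row0.
set u := row r _; have uM : u *m M = 0 by rewrite -row_mul mulmx_ker row0.
apply/rowP => i; rewrite [RHS]mxE; apply: (fb (fun i => u 0 i)).
under eq_bigr => j _ do rewrite bE mulr_sumr.
rewrite exchange_big /= big1 // => j _.
have /rowP/(_ j) := uM; rewrite !mxE => e.
rewrite (eq_bigr (fun i => const E (u 0 i * M i j) * b' j)); last first.
  by move=> l _; rewrite rmorphM mulrA.
by rewrite -mulr_suml -rmorph_sum e rmorph0 mul0r.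
Qed.

Lemma has_dim_inj (V : E -> Prop) n1 n2 :
  has_dim V n1 -> has_dim V n2 -> n1 = n2.
Proof.
by move=> h1 h2; apply/eqP; rewrite eqn_leq !(has_dim_leq (V := V)).
Qed.

Lemma has_dim_scale (V W : E -> Prop) s n : s != 0 ->
  (forall z, V z <-> W (z * s)) -> has_dim V n -> has_dim W n.
Proof.
move=> s0 VW [b [Vb fb]]; exists (fun i => b i * s).
have sumE (c : 'I_n -> k) : \sum_i const E (c i) * (b i * s) =
    (\sum_i const E (c i) * b i) * s.
  by rewrite mulr_suml; apply: eq_bigr => i _; rewrite mulrA.
split=> [z|c].
  rewrite -{1}(divfK s0 z) -VW Vb.
  split=> -[c e]; exists c; first by rewrite sumE -e divfK.
  by rewrite e sumE mulfK.
rewrite sumE => /eqP; rewrite mulf_eq0 (negPf s0) orbF => /eqP.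
exact: fb.
Qed.

End Dimension.

Section CanonicalMap.

Variable k : closedFieldType.
Hypothesis two_neq0 : 2%:R != 0 :> k.
Variable E : curve k.

(** Forms are a line, so passing from [dh] to [dx] scales all coefficients by one
    element [s], the derivative of [h]. *)
Lemma regular_forms_change (x y : E) f h : model x y f ->
  differential_neq0 h -> exists2 s, s != 0 &
  forall z, (forall v, place v -> regular_at v z h) <->
            (forall v, place v -> regular_at v (z * s) x).
Proof.
move=> m [D0 [dD0 D0h]]; have [D dD Dx] := der_exists two_neq0 m.
have e D' : derivation D' -> D' h = D h * D' x.
  by move=> dD'; have := der_line two_neq0 m h dD' dD; rewrite Dx mul1r mulrC.
exists (D h).
  by apply: contra_neq D0h => Dh; rewrite e // Dh mul0r.
by move=> z; split=> reg v /reg; apply: regular_at_change => D' dD';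
   rewrite (e D' dD') mulrA.
Qed.

(** The genus is independent of the form [dh] used to express differentials. *)
Theorem genus_uniq (x y : E) f g g' : model x y f ->
  (g.*2.+1 < size f <= g.*2.+3)%N -> has_genus E g' -> g' = g.
Proof.
move=> m sf [h h0 dim_h]; have [s s0 sE] := regular_forms_change m h0.
have dim_x := regular_forms_dim two_neq0 m sf.
apply: (has_dim_inj _ dim_x).
exact: has_dim_scale s0 _ dim_h.
Qed.

Section TwoModels.

Variables (x y x1 y1 : E) (f f1 : {poly k}) (g : nat).
Hypothesis m : model x y f.
Hypothesis m1 : model x1 y1 f1.
Hypothesis sf : (g.*2.+1 < size f <= g.*2.+3)%N.
Hypothesis sf1 : (g.*2.+1 < size f1 <= g.*2.+3)%N.

Lemma forms_transfer : exists2 s, s != 0 &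
  forall Q : {poly k}, (size Q <= g)%N ->
  exists2 P : {poly k}, (size P <= g)%N & pev x1 Q / y1 * s = pev x P / y.
Proof.
have [D dD Dx] := der_exists two_neq0 m1.
have h0 : differential_neq0 x1 by exists D; rewrite Dx oner_neq0.
have [s s0 sE] := regular_forms_change m h0; exists s => // Q sQ.
apply/(regular_forms two_neq0 _ m sf)/sE/(regular_forms two_neq0 _ m1 sf1).
by exists Q.
Qed.

(** Ratios of regular differentials form a canonical subfield, generated by any
    such [x]. The [x1^i] for [i < g] have a common denominator of degree less
    than [g], which leaves only degree one for [x1] itself. *)
Theorem model_mobius : (1 < g)%N -> exists a b c d,
  x1 * (const E c * x + const E d) = const E a * x + const E b /\
  a * d - b * c != 0.
Proof.
move=> g1; have [s s0 sE] := forms_transfer.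
have tx := model_tr m; have tx1 := model_tr m1.
have y0 := model_y_neq0 m; have y10 := model_y_neq0 m1.
have x10 := transcendental_neq0 tx1.
have powE i : (i < g)%N -> exists2 P : {poly k}, (size P <= g)%N &
    x1 ^+ i / y1 * s = pev x P / y.
  move=> ig; have [|P sP e] := sE 'X^i; first by rewrite size_polyXn.
  by exists P; rewrite // -e pevXn pevX.
have [P0 sP0 e0] := powE 0%N (ltnW g1).
have [P1 sP1 e1] := powE 1%N g1.
have gm : (g.-1 < g)%N by rewrite prednK // ltnW.
have [Pn sPn en] := powE _ gm.
have ratio i P : x1 ^+ i / y1 * s = pev x P / y -> x1 ^+ i * pev x P0 = pev x P.
  move=> e; apply: (mulIf (invr_neq0 y0)); rewrite -mulrA -e -e0.
  by rewrite expr0; ring.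
have r1 := ratio _ _ e1; have rn := ratio _ _ en; rewrite expr1 in r1.
have P00 : P0 != 0.
  apply: contra_neq s0 => P00; move: e0; rewrite P00 pev0 mul0r expr0 mul1r.
  by move/eqP; rewrite mulf_eq0 invr_eq0 (negPf y10) => /eqP.
pose d := gcdp P0 P1; pose p := P0 %/ d; pose q := P1 %/ d.
have d0 : d != 0 by rewrite gcdp_eq0 (negPf P00).
have pE : P0 = p * d by rewrite divpK ?dvdp_gcdl.
have qE : P1 = q * d by rewrite divpK ?dvdp_gcdr.
have p0 : p != 0 by apply: contra_neq P00 => h; rewrite pE h mul0r.
have pq : coprimep p q by rewrite coprimep_div_gcd // P00.
have x1pq : x1 * pev x p = pev x q.
  have dx : pev x d != 0 by rewrite pev_eq0.
  by apply: (mulIf dx); rewrite -mulrA -!pevM -pE -qE.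
(* coprimality makes [p^(g-1)] divide [P0] and [q^(g-1)] divide [Pn], so [p] and
   [q] have degree at most one *)
have polE : q ^+ g.-1 * P0 = p ^+ g.-1 * Pn.
  apply: (pev_inj tx); rewrite !pevE -x1pq exprMn -rn; ring.
have size_le (r P : {poly k}) : r ^+ g.-1 %| P -> P != 0 -> (size P <= g)%N ->
    (size r <= 2)%N.
  move=> rP P_0 sP; have := leq_trans (dvdp_leq P_0 rP) sP.
  have [->|r0] := eqVneq r 0; first by rewrite size_poly0.
  have rn0 : r ^+ g.-1 != 0 by rewrite expf_neq0.
  have := size_exp r g.-1.
  rewrite (polySpred rn0) (polySpred r0) /=.
  move: (size _).-1 (size r).-1 => i j ->; rewrite -[X in (_ < X)%N](ltn_predK g1) ltnS.
  by rewrite ltnS -{2}[g.-1]mul1n leq_pmul2r // -subn1 subn_gt0.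
have sp : (size p <= 2)%N.
  apply: size_le P00 sP0; rewrite -(@Gauss_dvdpr _ _ (q ^+ g.-1)).
    by rewrite polE dvdp_mulr.
  by rewrite coprimep_expl // coprimep_expr.
have Pn0 : Pn != 0.
  rewrite -(pev_eq0 _ tx) -rn mulf_neq0 ?expf_neq0 // pev_eq0 //.
have sq : (size q <= 2)%N.
  apply: size_le Pn0 sPn; rewrite -(@Gauss_dvdpr _ _ (p ^+ g.-1)).
    by rewrite -polE dvdp_mulr.
  by rewrite coprimep_expl // coprimep_expr // coprimep_sym.
exists q`_1, q`_0, p`_1, p`_0.
have lin (r : {poly k}) : (size r <= 2)%N ->
    pev x r = const E r`_1 * x + const E r`_0.
  move=> sr; rewrite (pev_sum _ sr) !big_ord_recl big_ord0 /= addr0 expr0 mulr1.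
  by rewrite addrC expr1.
have e := x1pq; rewrite !lin // in e; split=> //.
apply/negP; rewrite subr_eq0 => /eqP det0.
have pev0 : const E p`_1 * x + const E p`_0 != 0 by rewrite -lin // pev_eq0.
have [c0|c0] := eqVneq p`_1 0.
  have d0' : p`_0 != 0.
    by apply: contra_neq pev0 => h; rewrite c0 h !rmorph0 mul0r addr0.
  have a0 : q`_1 = 0.
    by apply/eqP; move/eqP: det0; rewrite c0 mulr0 mulf_eq0 (negPf d0') orbF.
  move: e; rewrite c0 a0 !rmorph0 !mul0r !add0r => e.
  have /eqP[] := transcendental_neq (q`_0 / p`_0) tx1.
  by rewrite fmorph_div /= -e mulfK // fmorph_eq0.
have /eqP[] := transcendental_neq (q`_1 / p`_1) tx1.
have cc : const E p`_1 != 0 by rewrite fmorph_eq0.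
rewrite fmorph_div /=; apply: (mulIf cc); rewrite divfK //; apply: (mulIf pev0).
rewrite mulrAC e mulrDl [RHS]mulrDr.
have := congr1 (const E) det0; rewrite !rmorphM /= => e'.
by rewrite -e'; ring.
Qed.

End TwoModels.

(** Each of [1/y] and [1/y1] is a polynomial in [x] times the other. *)
Theorem model_same_x (x y y1 : E) f f1 g : model x y f -> model x y1 f1 ->
  (g.*2.+1 < size f <= g.*2.+3)%N -> (g.*2.+1 < size f1 <= g.*2.+3)%N ->
  (0 < g)%N -> exists2 c, c != 0 & y1 = const E c * y.
Proof.
move=> m m1 sf sf1 g0.
have y0 := model_y_neq0 m; have y10 := model_y_neq0 m1.
have inv z z1 F F1 : model x z F -> model x z1 F1 ->
   (g.*2.+1 < size F <= g.*2.+3)%N -> (g.*2.+1 < size F1 <= g.*2.+3)%N ->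
   exists P, z^-1 = pev x P / z1.
  move=> n n1 sF sF1.
  have : forall v, place v -> regular_at v z^-1 x.
    apply/(regular_forms two_neq0 _ n sF); exists 1; first by rewrite size_poly1.
    by rewrite pev1 mul1r.
  by move/(regular_forms two_neq0 _ n1 sF1) => [P _ ->]; exists P.
have [P eP] := inv _ _ _ _ m m1 sf sf1.
have [Q eQ] := inv _ _ _ _ m1 m sf1 sf.
have PQ : P * Q = 1.
  apply: (pev_inj (model_tr m)); rewrite !pevE; apply: (mulIf (invr_neq0 y0)).
  by rewrite mul1r -mulrA -eQ -eP.
have [P0 Q0] : P != 0 /\ Q != 0.
  by have := oner_neq0 {poly k}; rewrite -PQ mulf_eq0 negb_or => /andP.
have /size_poly1P[c c0 Pc] : size P == 1%N.
  have := congr1 (fun R : {poly k} => size R) PQ; rewrite /= size_mul // size_poly1.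
  rewrite -size_poly_gt0 in P0; rewrite -size_poly_gt0 in Q0.
  by move: (size P) (size Q) P0 Q0 => i j; lia.
exists c => //; apply: (mulIf (invr_neq0 y0)); rewrite mulfK //.
by rewrite eP Pc pevC; field.
Qed.

End CanonicalMap.

(** * Automorphisms in genus 4 *)

Section Genus4Automorphisms.

Variable k : closedFieldType.
Hypothesis two_neq0 : 2%:R != 0 :> k.

Lemma sqrt_exists (c : k) : exists d, d ^+ 2 = c.
Proof.
have [d] := solve_monicpoly (fun i => if i == 0%N then c else 0) (ltn0Sn 1).
by rewrite !big_ord_recl big_ord0 /= expr0 mulr1 mul0r !addr0; exists d.
Qed.

Variable H : curve k.

Definition genus4_model (x y : H) (f : {poly k}) :=
  model x y f /\ (9 < size f <= 11)%N.

Lemma genus4_affine x y f a b : a != 0 -> genus4_model x y f ->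
  exists f1, genus4_model (const H a * x + const H b) y f1.
Proof.
move=> a0 [m sf]; exists (f \Po (a^-1 *: ('X - b%:P))); split.
  exact: model_affine.
by rewrite size_comp_poly2 // size_scale ?invr_eq0 // size_XsubC.
Qed.

Lemma genus4_inv x y f : genus4_model x y f ->
  genus4_model x^-1 (y / x ^+ 5) (revp 10 f).
Proof.
move=> [m sf]; split; first exact: (@model_inv _ _ _ _ _ m 4).
exact: (@size_revp_bounds _ 8 f (model_sep m)).
Qed.

Lemma genus4_iso (s : {rmorphism H -> H}) x y f : curve_iso s ->
  genus4_model x y f -> genus4_model (s x) (s y) f.
Proof. by move=> si [m sf]; split=> //; apply: model_iso. Qed.

Lemma genus4_same_x x y y1 f f1 : genus4_model x y f -> genus4_model x y1 f1 ->
  exists2 c, c != 0 & y1 = const H c * y.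
Proof.
move=> [m sf] [m1 sf1].
exact: (@model_same_x _ two_neq0 _ _ _ _ _ _ 4 m m1 sf sf1).
Qed.

Lemma genus4_mobius x y x1 y1 f f1 :
  genus4_model x y f -> genus4_model x1 y1 f1 ->
  exists a b c d, x1 * (const H c * x + const H d) = const H a * x + const H b
    /\ a * d - b * c != 0.
Proof.
move=> [m sf] [m1 sf1].
exact: (@model_mobius _ two_neq0 _ _ _ _ _ _ _ 4 m m1 sf sf1).
Qed.

(** A Moebius transformation becomes affine when one of its fixed points is moved
    to infinity. *)
Lemma genus4_affine_action (R : {rmorphism H -> H}) x y f :
  curve_iso R -> genus4_model x y f ->
  exists x1 y1 f1 a b, [/\ genus4_model x1 y1 f1, a != 0
    & R x1 = const H a * x1 + const H b].
Proof.
move=> Ri m; have Rc := Ri.2.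
have tx := model_tr m.1.
have [a [b [c [d [e det]]]]] := genus4_mobius m (genus4_iso Ri m).
have cE u : u != 0 -> const H u != 0 by rewrite fmorph_eq0.
have [c0|c0] := eqVneq c 0.
  have d0 : d != 0 by apply: contra_neq det => d0; rewrite d0 c0 !mulr0 subr0.
  have a0 : a != 0 by apply: contra_neq det => a0; rewrite a0 c0 mul0r mulr0 subr0.
  exists x, y, f, (a / d), (b / d); split=> //; first by rewrite mulf_neq0 ?invr_eq0.
  apply: (mulIf (cE _ d0)); move: e; rewrite c0 rmorph0 mul0r add0r => ->.
  by rewrite !fmorph_div /=; field; rewrite cE.
(* [r] is a fixed point of the Moebius transformation induced on [x] *)
have [r er] : exists r, c * r ^+ 2 + (d - a) * r - b = 0.
  have [r] := solve_monicpoly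
    (fun i => if i == 0%N then b / c else (a - d) / c) (ltn0Sn 1).
  rewrite !big_ord_recl big_ord0 /= expr0 mulr1 expr1 addr0 => er.
  by exists r; rewrite er; field.
have [f1 m1] := genus4_affine (- r) (oner_neq0 k) m.
have xr : x - const H r != 0 by rewrite subr_eq0 transcendental_neq.
have {}m1 : genus4_model (x - const H r) y f1.
  by move: m1; rewrite rmorph1 mul1r rmorphN.
have m2 := genus4_inv m1.
have arc : a - r * c != 0.
  apply: contra_neq det => arc.
  have -> : b = c * r ^+ 2 + (d - a) * r by apply/eqP; rewrite eq_sym -subr_eq0 er.
  have -> : a * d - (c * r ^+ 2 + (d - a) * r) * c = (a - r * c) * (d + r * c) by ring.
  by rewrite arc mul0r.
have cdr : c * r + d != 0.
  apply: contra_neq det => h.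
  have -> : b = c * r ^+ 2 + (d - a) * r by apply/eqP; rewrite eq_sym -subr_eq0 er.
  have -> : a * d - (c * r ^+ 2 + (d - a) * r) * c = (a - r * c) * (c * r + d) by ring.
  by rewrite h mulr0.
exists (x - const H r)^-1, (y / (x - const H r) ^+ 5), (revp 10 f1),
  ((c * r + d) / (a - r * c)), (c / (a - r * c)); split=> //.
  by rewrite mulf_neq0 ?invr_eq0.
rewrite fmorphV rmorphB /= Rc !fmorph_div /= rmorphB rmorphD !rmorphM /=.
have := congr1 (const H) er; rewrite !(rmorphB, rmorphD, rmorphM, rmorphXn) rmorph0 /=.
have := cE _ arc; rewrite rmorphB rmorphM /=.
have := Rc; move: e xr => e xr _ arc' er'.
have Rxr : R x - const H r != 0.
  by rewrite -Rc -rmorphB fmorph_eq0.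
have e' : (R x - const H r) * (const H c * x + const H d) =
   (const H a - const H r * const H c) * (x - const H r).
  rewrite mulrBl e; apply/eqP; rewrite -subr_eq0 -oppr_eq0 -er'; apply/eqP.
  by ring.
apply: (mulfI Rxr); rewrite divff //.
apply: (mulIf xr).
have -> : (R x - const H r) * ((const H c * const H r + const H d) /
     (const H a - const H r * const H c) / (x - const H r) +
     const H c / (const H a - const H r * const H c)) * (x - const H r) =
  (R x - const H r) * (const H c * x + const H d) /
    (const H a - const H r * const H c) by field; rewrite arc'.
by rewrite e' mul1r; field.
Qed.

(** Since 4 is not zero in [k], a non-trivial translation does not have order
    dividing 4; any other affine map fixes a finite point, which is moved
    to 0. *)
Lemma genus4_diagonal (R : {rmorphism H -> H}) x y f :
  curve_iso R -> (forall z, R (R (R (R z))) = z) -> genus4_model x y f ->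
  exists x1 y1 f1 a, [/\ genus4_model x1 y1 f1, a != 0 & R x1 = const H a * x1].
Proof.
move=> Ri R4 m; have Rc := Ri.2.
have [x1 [y1 [f1 [a [b [m1 a0 e]]]]]] := genus4_affine_action Ri m.
have [a1|a1] := eqVneq a 1.
  exists x1, y1, f1, a; split=> //; suff b0 : b = 0 by rewrite e b0 rmorph0 addr0.
  have e1 : R x1 = x1 + const H b by rewrite e a1 rmorph1 mul1r.
  have := R4 x1; rewrite !(e1, rmorphD) /= !Rc -!addrA => /eqP.
  rewrite -subr_eq0 [x1 + _]addrC addrK -!rmorphD /= fmorph_eq0 => /eqP b4.
  have : 2%:R * 2%:R * b = 0 by rewrite -b4; ring.
  by move/eqP; rewrite !mulf_eq0 (negPf two_neq0) => /eqP.
have a1' : a - 1 != 0 by rewrite subr_eq0.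
have [f2 m2] := genus4_affine (b / (a - 1)) (oner_neq0 k) m1.
exists (const H 1 * x1 + const H (b / (a - 1))), y1, f2, a; split=> //.
rewrite rmorph1 mul1r rmorphD /= Rc e mulrDr -addrA -!rmorphM -!rmorphD.
by congr (_ + const H _); field.
Qed.

End Genus4Automorphisms.

(** * Dihedral actions in genus 4 *)

Lemma coef_comp_scaleX (R : comNzRingType) (P : {poly R}) a i :
  (P \Po (a *: 'X))`_i = a ^+ i * P`_i.
Proof.
elim/poly_ind: P i => [|P c IH] i; first by rewrite comp_poly0 coef0 mulr0.
rewrite comp_poly_MXaddC -scalerAr !coefD !coefC coefZ !coefMX IH.
case: i => [|i] /=; first by rewrite expr0 mulr0 !add0r mul1r.
by rewrite !addr0 exprS mulrA.
Qed.

Section DihedralNormalForm.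

Variable k : closedFieldType.
Hypothesis two_neq0 : 2%:R != 0 :> k.
Variable H : curve k.

Lemma sqr_eq1 (c : k) : c ^+ 2 = 1 -> c = 1 \/ c = -1.
Proof. by move/eqP; rewrite sqrf_eq1 => /orP[] /eqP ->; [left|right]. Qed.

Lemma opp1_neq1 : (-1 : k) != 1.
Proof. by rewrite eq_sym -subr_eq0 opprK. Qed.

(** [y] and [R y] are square roots over the same coordinate line, hence
    proportional; comparing their squares gives the coefficients. *)
Lemma genus4_scaling (R : {rmorphism H -> H}) x y f a :
  curve_iso R -> genus4_model x y f -> a != 0 -> R x = const H a * x ->
  exists c, [/\ c != 0, R y = const H c * y
    & forall i, a ^+ i * f`_i = c ^+ 2 * f`_i].
Proof.
move=> Ri m a0 Rx; have [f1 m1] := genus4_affine 0 a0 m.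
have {}m1 : genus4_model (R x) y f1 by rewrite Rx; move: m1; rewrite rmorph0 addr0.
have [c c0 Ry] := genus4_same_x two_neq0 m1 (genus4_iso Ri m).
exists c; split=> // i.
suff e : f \Po (a *: 'X) = c ^+ 2 *: f by rewrite -coef_comp_scaleX e coefZ.
apply: (pev_inj (model_tr m.1)).
rewrite pev_comp !pevZ pevX -Rx -(pev_morph Ri.2) -(model_sqr m.1).
by rewrite !rmorphXn /= Ry exprMn.
Qed.

Lemma genus4_fix_x (s : {rmorphism H -> H}) x y f :
  curve_iso s -> genus4_model x y f -> s x = x -> s y = y \/ s y = - y.
Proof.
move=> si m sx; have := genus4_scaling si m (oner_neq0 k).
rewrite rmorph1 mul1r => /(_ sx)[c [c0 -> cf]].
have /sqr_eq1[->|->] : c ^+ 2 = 1.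
- have f0 : lead_coef f != 0 by rewrite lead_coef_eq0 (separable_poly_neq0 (model_sep m.1)).
  by apply: (mulIf f0); rewrite -cf expr1n.
- by left; rewrite rmorph1 mul1r.
- by right; rewrite rmorphN rmorph1 mulN1r.
Qed.

(** Otherwise [a^2 = -1] and [R y = c y] with [c^4 = 1], and [c^2 = a^i] whenever
    the coefficient of [X^i] in [f] is not zero. Degree 9 gives [c^2 = a], so
    [c^4 = -1]; degree 10 gives [c^2 = -1], so the coefficients of [1] and [X]
    vanish and [f] has a double root. *)
Lemma genus4_order4 (R : {rmorphism H -> H}) x y f a :
  curve_iso R -> (forall z, R (R (R (R z))) = z) ->
  genus4_model x y f -> a != 0 -> R x = const H a * x -> a ^+ 2 = 1.
Proof.
move=> Ri R4 m a0 Rx; have Rc := Ri.2.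
have [c [c0 Ry cf]] := genus4_scaling Ri m a0 Rx.
have iter4 z b : z != 0 -> R z = const H b * z -> b ^+ 4 = 1.
  move=> z0 Rz; apply: (fmorph_inj (const H)); rewrite rmorph1.
  apply: (mulIf z0); rewrite mul1r -{2}(R4 z) !(Rz, rmorphM) /= !Rc.
  by ring.
have a4 := iter4 _ _ (transcendental_neq0 (model_tr m.1)) Rx.
have c4 := iter4 _ _ (model_y_neq0 m.1) Ry.
have c2 : c ^+ 2 ^+ 2 = 1 by rewrite -exprM.
have /sqr_eq1[//|a2] : a ^+ 2 ^+ 2 = 1 by rewrite -exprM.
have c_of i : f`_i != 0 -> c ^+ 2 = a ^+ i by move=> fi; apply: (mulIf fi).
have sf := m.2; have f0 := separable_poly_neq0 (model_sep m.1).
have [f10 f9] : f`_10 = 0 /\ f`_9 = 0; last first.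
  have : (lead_coef f == 0) = false by rewrite lead_coef_eq0 (negPf f0).
  rewrite lead_coefE; have : (size f == 10%N) || (size f == 11%N) by move: sf; lia.
  by case/orP => /eqP -> /=; rewrite ?f9 ?f10 eqxx.
have a10 : a ^+ 10 = -1.
  by rewrite (exprM a 2 5) a2 -signr_odd expr1.
have a9 : a ^+ 9 = a by rewrite exprS (exprM a 2 4) a2 -signr_odd expr0 mulr1.
split; apply/eqP/negPn/negP => /c_of cE.
- rewrite a10 in cE.
  have f_0 : f`_0 = 0.
    apply/eqP/negPn/negP => /c_of; rewrite cE expr0 => /eqP.
    by rewrite (negPf opp1_neq1).
  have f_1 : f`_1 = 0.
    apply/eqP/negPn/negP => /c_of; rewrite cE expr1 => h.
    by move/eqP: a2; rewrite -h sqrrN expr1n eq_sym (negPf opp1_neq1).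
  have [_ /(_ 0)/negP[]] := separable_sqrP _ (model_sep m.1).
  rewrite subr0; apply/dvdpP; exists (drop_poly 2 f).
  apply/polyP => i; rewrite coefMXn coef_drop_poly.
  by case: ltnP => h; [case: i h => [|[|]] | rewrite subnK].
- by move: c2; rewrite cE a9 a2 => /eqP; rewrite (negPf opp1_neq1).
Qed.

Variables R S : {rmorphism H -> H}.
Hypothesis Ri : curve_iso R.
Hypothesis Si : curve_iso S.
Hypothesis R4 : forall z, R (R (R (R z))) = z.
Hypothesis S2 : forall z, S (S z) = z.
Hypothesis SR : forall z, S (R z) = R (R (R (S z))).
Hypothesis nR2 : ~ (forall z, R (R z) = z).
Hypothesis nS : ~ (forall z, S z = z).
Hypothesis nSR2 : ~ (forall z, S z = R (R z)).
Hypothesis nSR : ~ (forall z, S (R z) = z).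
Hypothesis nSR3 : ~ (forall z, S (R z) = R (R z)).

Lemma curve_iso_comp (s t : {rmorphism H -> H}) :
  curve_iso s -> curve_iso t -> curve_iso (s \o t).
Proof.
move=> [bs cs] [bt ct]; split; first exact: bij_comp.
by move=> a /=; rewrite ct cs.
Qed.

Lemma iso_eq (s t : {rmorphism H -> H}) x y f : curve_iso s -> curve_iso t ->
  genus4_model x y f -> s x = t x -> s y = t y -> forall z, s z = t z.
Proof.
move=> si ti m ex ey; apply: (model_hom_eq m.1) => // a.
by rewrite si.2 ti.2.
Qed.

Lemma curve_iso_id : curve_iso (idfun : {rmorphism H -> H}).
Proof. by split=> //; exists idfun. Qed.

(** [R^2] fixes [x] but is not trivial, so [R^2 y = - y], that is [c^2 = -1];
    comparing coefficients, [f(- X) = - f(X)]. *)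
Lemma dihedral_R x y f a : genus4_model x y f -> a != 0 ->
  R x = const H a * x ->
  R x = - x /\ exists c, [/\ c ^+ 2 = -1, R y = const H c * y
    & forall i, ~~ odd i -> f`_i = 0].
Proof.
move=> m a0 Rx; have Rc := Ri.2.
have a2 := genus4_order4 Ri R4 m a0 Rx.
have [c [c0 Ry cf]] := genus4_scaling Ri m a0 Rx.
have R2x : R (R x) = x.
  by rewrite Rx rmorphM /= Rc Rx mulrA -rmorphM -expr2 a2 rmorph1 mul1r.
have R2y : R (R y) = const H (c ^+ 2) * y.
  by rewrite Ry rmorphM /= Rc Ry mulrA -rmorphM -expr2.
have RRi := curve_iso_comp Ri Ri.
have ncy : c ^+ 2 <> 1.
  move=> c2; apply: nR2 => z.
  apply: (iso_eq RRi curve_iso_id m) => //=.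
  by rewrite R2y c2 rmorph1 mul1r.
have y0 := model_y_neq0 m.1.
have c21 : c ^+ 2 = -1.
  have [/=|/=] := genus4_fix_x RRi m R2x; rewrite R2y => e.
    by case: ncy; apply: (fmorph_inj (const H)); apply: (mulIf y0); rewrite e rmorph1 mul1r.
  by apply: (fmorph_inj (const H)); apply: (mulIf y0); rewrite e rmorphN1 mulN1r.
have a1 : a = -1.
  have [a1|//] := sqr_eq1 a2.
  have x1 : R x = x by rewrite Rx a1 rmorph1 mul1r.
  case: nR2 => z; apply: (iso_eq RRi curve_iso_id m) => //=.
  by have [e|e] := genus4_fix_x Ri m x1; rewrite e ?rmorphN /= e ?opprK.
split; first by rewrite Rx a1 rmorphN1 mulN1r.
exists c; split=> // i io; have := cf i.
rewrite c21 a1 -signr_odd (negPf io) expr0 mul1r mulN1r => /eqP.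
rewrite -addr_eq0 -mulr2n -mulr_natl mulf_eq0 (negPf two_neq0).
by move/eqP.
Qed.

Lemma dihedral_fix_x (s : {rmorphism H -> H}) x y f c : curve_iso s ->
  genus4_model x y f -> R x = - x -> c ^+ 2 = -1 -> R y = const H c * y ->
  s x = x -> (forall z, s z = z) \/ (forall z, s z = R (R z)).
Proof.
move=> si m Rx c2 Ry sx; have Rc := Ri.2.
have [e|e] := genus4_fix_x si m sx; [left | right] => z.
  exact: (iso_eq si curve_iso_id m).
apply: (iso_eq si (curve_iso_comp Ri Ri) m) => /=.
  by rewrite Rx rmorphN /= Rx opprK.
by rewrite e Ry rmorphM /= Rc Ry mulrA -rmorphM -expr2 c2 rmorphN1 mulN1r.
Qed.

(** On [x], the action of [S] commutes with [x -> -x], so it is [x -> e x] or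
    [x -> b / x]. In the first case [e^2 = 1], and [S] or [S R] would fix
    [x] without being [1] or [R^2]. *)
Lemma dihedral_S x y f a : genus4_model x y f -> a != 0 ->
  R x = const H a * x -> exists2 b, b != 0 & S x = const H b / x.
Proof.
move=> m a0 Rx0; have [Rx [e [e2 Ry _]]] := dihedral_R m a0 Rx0.
have Rc := Ri.2; have Sc := Si.2; have tx := model_tr m.1.
have x0 := transcendental_neq0 tx.
have fix_x s si := @dihedral_fix_x s _ _ _ _ si m Rx e2 Ry.
have cE u : u != 0 -> const H u != 0 by rewrite fmorph_eq0.
have R2c z : R (R (S z)) = S (R (R z)) by rewrite !SR !R4.
have RSx : R (S x) = - S x.
  have h : S (R x) = R (S x).
    by rewrite SR R2c Rx rmorphN /= Rx opprK.
  by rewrite -h Rx rmorphN.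
have [a' [b [c [d [eS det]]]]] := genus4_mobius two_neq0 m (genus4_iso Si m).
have eS' := congr1 R eS.
rewrite !(rmorphM, rmorphD) /= !Rc RSx Rx in eS'.
have pol : (- 2%:R * a' * c) *: 'X^2 + (2%:R * b * d)%:P = 0.
  apply: tx; rewrite !pevE !(rmorphM, rmorphN) /= rmorph_nat.
  have -> : - 2%:R * const H a' * const H c * x ^+ 2 + 2%:R * const H b * const H d
     = (const H a' * - x + const H b) * (const H c * x + const H d)
     + (const H a' * x + const H b) * (const H c * - x + const H d) by ring.
  by rewrite -eS -eS'; ring.
have ac : a' * c = 0.
  have := congr1 (fun P : {poly k} => P`_2) pol.
  rewrite coefD coefZ coefXn coefC coef0 /= mulr1 addr0 => /eqP.
  by rewrite -mulrA mulf_eq0 oppr_eq0 (negPf two_neq0) => /eqP.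
have bd : b * d = 0.
  have := congr1 (fun P : {poly k} => P`_0) pol.
  rewrite coefD coefZ coefXn coefC coef0 /= mulr0 add0r => /eqP.
  by rewrite -mulrA mulf_eq0 (negPf two_neq0) => /eqP.
have [a'0|a'0] := eqVneq a' 0.
  have /andP[b0 c0] : (b != 0) && (c != 0).
    by rewrite -negb_or -mulf_eq0; apply: contra_neq det => h; rewrite h a'0 mul0r subr0.
  have d0 : d = 0 by move/eqP: bd; rewrite mulf_eq0 (negPf b0) => /eqP.
  exists (b / c); first by rewrite mulf_neq0 ?invr_eq0.
  move: eS; rewrite a'0 d0 !rmorph0 mul0r add0r addr0 fmorph_div /= => eS.
  by rewrite -eS; field; rewrite x0 cE.
have c0 : c = 0 by move/eqP: ac; rewrite mulf_eq0 (negPf a'0) => /eqP.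
have d0 : d != 0 by apply: contra_neq det => d0; rewrite d0 c0 !mulr0 subr0.
have b0 : b = 0 by move/eqP: bd; rewrite mulf_eq0 (negPf d0) orbF => /eqP.
have Sx : S x = const H (a' / d) * x.
  apply: (mulIf (cE _ d0)); move: eS; rewrite c0 b0 !rmorph0 mul0r add0r addr0 => ->.
  by rewrite fmorph_div /=; field; rewrite cE.
have /sqr_eq1[h|h] : (a' / d) ^+ 2 = 1.
- apply: (fmorph_inj (const H)); apply: (mulIf x0); rewrite rmorph1 mul1r.
  by have h := S2 x; rewrite Sx rmorphM /= Sc Sx mulrA -rmorphM in h.
- by have [|/nS|/nSR2] := fix_x S Si; first by rewrite Sx h rmorph1 mul1r.
- have [|/nSR|/nSR3] // := fix_x (S \o R) (curve_iso_comp Si Ri).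
  by rewrite /= Rx rmorphN /= Sx h rmorphN1 mulN1r opprK.
Qed.

(** Scaling makes [S x = 1/x]. Then [S y = e y / x^5] with [e^2 = 1], because [S]
    is an involution, and both sides of this equation have the same square. *)
Theorem dihedral_normal_form (x y : H) f : genus4_model x y f ->
  exists (x1 y1 : H) f1, [/\ genus4_model x1 y1 f1,
    forall i, ~~ odd i -> f1`_i = 0 & f1 = revp 10 f1].
Proof.
move=> m0; have [x1 [y1 [f1 [a [m1 a0 Rx1]]]]] := genus4_diagonal two_neq0 Ri R4 m0.
have Rc := Ri.2; have Sc := Si.2.
have [b b0 Sx1] := dihedral_S m1 a0 Rx1.
have [d db] := sqrt_exists b.
have d0 : d != 0 by rewrite -sqrf_eq0 db.
have [f2 m2] := genus4_affine 0 (invr_neq0 d0) m1.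
set x2 := const H d^-1 * x1; have {}m2 : genus4_model x2 y1 f2.
  by move: m2; rewrite rmorph0 addr0.
have cd : const H d != 0 by rewrite fmorph_eq0.
have x10 := transcendental_neq0 (model_tr m1.1).
have x20 := transcendental_neq0 (model_tr m2.1).
have Rx2 : R x2 = const H a * x2 by rewrite rmorphM /= Rc Rx1 /x2; ring.
have Sx2 : S x2 = x2^-1.
  by rewrite rmorphM /= Sc Sx1 -db rmorphXn /x2 fmorphV /=; field; rewrite cd.
have [_ [_ [_ _ f_odd]]] := dihedral_R m2 a0 Rx2.
clearbody x2; exists x2, y1, f2; split=> //.
have m3 := genus4_inv m2.
have m4 := genus4_iso Si m2; rewrite Sx2 in m4.
have [e e0 Sy] := genus4_same_x two_neq0 m3 m4.
have e2 : e ^+ 2 = 1.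
  apply: (fmorph_inj (const H)); apply: (mulIf (model_y_neq0 m2.1)).
  have h := S2 y1; rewrite Sy !rmorphM /= Sc Sy fmorphV rmorphXn /= Sx2 in h.
  by rewrite rmorph1 mul1r -[RHS]h rmorphXn /=; field; rewrite x20 oner_neq0.
apply: (pev_inj (model_tr m3.1)).
rewrite -(model_sqr m3.1) -(model_sqr m4.1) Sy exprMn -rmorphXn /= e2.
by rewrite rmorph1 mul1r.
Qed.

End DihedralNormalForm.

(** * Odd palindromic polynomials of degree 9 *)

Section PalindromicPolynomial.

Variable k : closedFieldType.
Hypothesis two_neq0 : 2%:R != 0 :> k.

(** This is [x^5 (u^2 - a^2) (u^2 - b^2)] with [u = x + 1/x], see [fiber_sqr]. *)
Definition branch_poly (a b : k) : {poly k} :=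
  'X * ('X^2 - a *: 'X + 1) * ('X^2 + a *: 'X + 1)
     * ('X^2 - b *: 'X + 1) * ('X^2 + b *: 'X + 1).

Lemma branch_polyE a b (s := 2%:R - a ^+ 2) (t := 2%:R - b ^+ 2) :
  branch_poly a b = 'X^9 + (s + t) *: 'X^7 + (2%:R + s * t) *: 'X^5
                   + (s + t) *: 'X^3 + 'X.
Proof.
rewrite /branch_poly -!mul_polyC !(rmorphD, rmorphM, rmorphN, rmorphXn) /=.
by rewrite polyC1; ring.
Qed.

Lemma coef_branch_poly a b (s := 2%:R - a ^+ 2) (t := 2%:R - b ^+ 2) i :
  (branch_poly a b)`_i =
    [:: 0; 1; 0; s + t; 0; 2%:R + s * t; 0; s + t; 0; 1]`_i.
Proof.
rewrite branch_polyE !(coefD, coefZ, coefXn, coefX).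
do 10![case: i => [|i] /=; first by rewrite /= ?(mulr0, mulr1, addr0, add0r)].
by rewrite nth_nil !(mulr0, addr0).
Qed.

Lemma size_branch_poly a b : size (branch_poly a b) = 10%N.
Proof.
apply/eqP; rewrite eqn_leq; apply/andP; split.
  apply/leq_sizeP => j j10; rewrite coef_branch_poly nth_default //.
rewrite ltnNge; apply/negP => /leq_sizeP/(_ 9%N (leqnn _)).
by rewrite coef_branch_poly /= => /eqP; rewrite oner_eq0.
Qed.

Lemma branch_poly_odd a b : branch_poly a b \Po (- 'X) = - branch_poly a b.
Proof.
rewrite branch_polyE !(comp_polyD, comp_polyZ, comp_Xn_poly, comp_polyX) /= -!mul_polyC.
by ring.
Qed.

Lemma revp_branch_poly a b : revp 10 (branch_poly a b) = branch_poly a b.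
Proof.
apply/polyP => i; rewrite coef_revp !coef_branch_poly.
by do 11![case: i => [|i] //=]; rewrite nth_nil.
Qed.

(** [f / x^5] is a quadratic polynomial in [u^2], where [u = x + 1/x]; [s] and [t]
    below are its two factors in the form [2 - a^2] and [2 - b^2]. *)
Lemma branch_poly_of (f : {poly k}) : (9 < size f <= 11)%N ->
  (forall i, ~~ odd i -> f`_i = 0) -> f = revp 10 f ->
  exists a b c, c != 0 /\ f = c *: branch_poly a b.
Proof.
move=> /andP[f10 f11] f_odd f_rev; pose c := f`_9.
have frev i : (i <= 10)%N -> f`_i = f`_(10 - i).
  by move=> i10; rewrite {1}f_rev coef_revp i10.
have f_gt i : (9 < i)%N -> f`_i = 0.
  rewrite leq_eqVlt => /orP[/eqP <-|h]; first exact: f_odd.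
  by rewrite nth_default // (leq_trans f11).
have c0 : c != 0.
  have sf : size f = 10%N.
    apply/eqP; rewrite eqn_leq f10 andbT.
    by apply/leq_sizeP => j; apply: f_gt.
  by rewrite /c -[9%N]/(10.-1) -sf -lead_coefE lead_coef_eq0 -size_poly_eq0 sf.
have [t tE] : exists t, t ^+ 2 = (f`_3 / c) * t - (f`_5 / c - 2%:R).
  have [t] := solve_monicpoly (fun i =>
    if i == 0%N then - (f`_5 / c - 2%:R) else f`_3 / c) (ltn0Sn 1).
  rewrite !big_ord_recl big_ord0 /= expr0 mulr1 expr1 addr0 => e.
  by exists t; rewrite e addrC.
pose s := f`_3 / c - t.
have [a aE] := sqrt_exists (2%:R - s); have [b bE] := sqrt_exists (2%:R - t).
exists a, b, c; split=> //; apply/polyP => i.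
have st : c * (s + t) = f`_3 by rewrite subrK mulrC divfK.
have st2 : c * (2%:R + s * t) = f`_5.
  have -> : 2%:R + s * t = 2%:R + (f`_3 / c * t - t ^+ 2) by rewrite /s; ring.
  have -> : t ^+ 2 = f`_3 / c * t - (f`_5 / c - 2) := tE.
  by field.
have aE' : 2%:R - a ^+ 2 = s by rewrite aE opprB addrC subrK.
have bE' : 2%:R - b ^+ 2 = t by rewrite bE opprB addrC subrK.
rewrite coefZ coef_branch_poly aE' bE'; clearbody s.
have [i9|i10] := leqP i 9; last by rewrite f_gt // nth_default ?mulr0.
case: i i9 => [|[|[|[|[|[|[|[|[|[|i]]]]]]]]]] i9 //=; rewrite ?mulr0 ?mulr1 ?st ?st2 //.
- exact: f_odd.
- by rewrite frev.
- exact: f_odd.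
- exact: f_odd.
- exact: f_odd.
- by rewrite frev.
- exact: f_odd.
Qed.

Lemma branch_model_exists (H : curve k) (x y : H) f : genus4_model x y f ->
  (forall i, ~~ odd i -> f`_i = 0) -> f = revp 10 f ->
  exists a b (z : H), model x z (branch_poly a b).
Proof.
move=> [m sf] f_odd f_rev.
have [a [b [c [c0 fE]]]] := branch_poly_of sf f_odd f_rev.
have [d dc] := sqrt_exists c^-1.
have d0 : d != 0 by rewrite -sqrf_eq0 dc invr_eq0.
exists a, b, (const H d * y).
by have := model_scale_y m d0; rewrite dc fE scalerA mulVf // scale1r.
Qed.

(** A coincidence among the values [a, -a, b, -b, 2, -2] of [u = x + 1/x] makes a
    square factor; otherwise the five factors are separable and coprime. *)
Lemma branch_poly_separable a b : separable_poly (branch_poly a b) <->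
  [/\ a != 0, b != 0, a ^+ 2 != b ^+ 2, a ^+ 2 != 4%:R & b ^+ 2 != 4%:R].
Proof.
have quad c : size ('X^2 - c *: 'X + 1 : {poly k}) = 3%N.
  rewrite -addrA size_polyDl ?size_polyXn //.
  apply: leq_ltn_trans (size_polyD _ _) _.
  rewrite size_polyN size_poly1 gtn_max /= andbT.
  by rewrite (leq_ltn_trans (size_scale_leq _ _)) ?size_polyX.
split.
  move=> sep; have sq (u : {poly k}) : size u != 1%N -> u * u %| branch_poly a b -> False.
    move=> su uu; have [/(_ u u uu)] := separable_polyP sep.
    by rewrite coprimepp => /eqP/eqP; rewrite (negPf su).
  split; apply/eqP => h.
  - apply: (sq ('X^2 - 0 *: 'X + 1)); first by rewrite quad.
    apply/dvdpP; exists ('X * ('X^2 - b *: 'X + 1) * ('X^2 + b *: 'X + 1)).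
    by rewrite /branch_poly h !scale0r; ring.
  - apply: (sq ('X^2 - 0 *: 'X + 1)); first by rewrite quad.
    apply/dvdpP; exists ('X * ('X^2 - a *: 'X + 1) * ('X^2 + a *: 'X + 1)).
    by rewrite /branch_poly h !scale0r; ring.
  - apply: (sq ('X^2 - a *: 'X + 1)); first by rewrite quad.
    move/eqP: h; rewrite eqf_sqr => /orP[] /eqP ->.
      apply/dvdpP; exists ('X * ('X^2 + b *: 'X + 1) * ('X^2 + b *: 'X + 1)).
      by rewrite /branch_poly; ring.
    apply/dvdpP; exists ('X * ('X^2 - b *: 'X + 1) * ('X^2 - b *: 'X + 1)).
    by rewrite /branch_poly !scaleNr; ring.
  - apply: (sq ('X - 1)); first by rewrite -polyC1 size_XsubC.
    have : (a == 2%:R) || (a == -2%:R) by rewrite -eqf_sqr h -natrX.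
    move/orP; case=> /eqP ->.
      apply/dvdpP; exists ('X * ('X^2 + 2%:R *: 'X + 1) *
        ('X^2 - b *: 'X + 1) * ('X^2 + b *: 'X + 1)).
      by rewrite /branch_poly -!mul_polyC !polyC_natr; ring.
    apply/dvdpP; exists ('X * ('X^2 + 2%:R *: 'X + 1) *
      ('X^2 - b *: 'X + 1) * ('X^2 + b *: 'X + 1)).
    by rewrite /branch_poly -!mul_polyC !polyCN !polyC_natr; ring.
  - apply: (sq ('X - 1)); first by rewrite -polyC1 size_XsubC.
    have : (b == 2%:R) || (b == -2%:R) by rewrite -eqf_sqr h -natrX.
    move/orP; case=> /eqP ->.
      apply/dvdpP; exists ('X * ('X^2 + 2%:R *: 'X + 1) *
        ('X^2 - a *: 'X + 1) * ('X^2 + a *: 'X + 1)).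
      by rewrite /branch_poly -!mul_polyC !polyC_natr; ring.
    apply/dvdpP; exists ('X * ('X^2 + 2%:R *: 'X + 1) *
      ('X^2 - a *: 'X + 1) * ('X^2 + a *: 'X + 1)).
    by rewrite /branch_poly -!mul_polyC !polyCN !polyC_natr; ring.
move=> [a0 b0 ab a4 b4].
have cop (p q : {poly k}) : (forall r, root p r -> ~~ root q r) -> coprimep p q.
  move=> h; apply/negPn/negP => /closed_rootP[r]; rewrite root_gcd => /andP[/h].
  by move/negP.
have rquad (c r : k) : root ('X^2 - c *: 'X + 1) r = (r ^+ 2 - c * r + 1 == 0).
  by rewrite /root !hornerE.
have quad_sep (c : k) : c ^+ 2 != 4%:R -> separable_poly ('X^2 - c *: 'X + 1).
  move=> c4; rewrite separable_poly.unlock; apply: cop => r.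
  rewrite rquad => /eqP e; apply: contra_neqN c4.
  rewrite !derivE /root !hornerE => /eqP h.
  have -> : c = r *+ 2 by apply/eqP; rewrite eq_sym -subr_eq0 -h; apply/eqP; ring.
  have hc : c = r *+ 2 by apply/eqP; rewrite eq_sym -subr_eq0 -h; apply/eqP; ring.
  rewrite hc in e.
  have -> : (r *+ 2) ^+ 2 = 4%:R - 4%:R * (r ^+ 2 - r *+ 2 * r + 1) by ring.
  by rewrite e mulr0 subr0.
have quad_cop (c d : k) : c != d -> coprimep ('X^2 - c *: 'X + 1) ('X^2 - d *: 'X + 1).
  move=> cd; apply: cop => r; rewrite !rquad => /eqP e; apply: contra_neqN cd.
  move=> /eqP e'; have r0 : r != 0.
    apply/eqP => r0; move/eqP: e; rewrite r0 expr0n mulr0 subr0 add0r.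
    by rewrite oner_eq0.
  apply: (mulIf r0); apply/eqP; rewrite -subr_eq0; apply/eqP.
  by rewrite -[RHS](subrr 0) -{1}e' -{1}e; ring.
have X_cop (c : k) : coprimep 'X ('X^2 - c *: 'X + 1).
  apply: cop => r; rewrite rquad rootX => /eqP ->.
  by rewrite expr0n mulr0 subr0 add0r oner_eq0.
have opp_neq (c : k) : c != 0 -> c != - c.
  by move=> c0; rewrite -subr_eq0 opprK -mulr2n -mulr_natl mulf_neq0.
have E (c : k) : 'X^2 + c *: 'X + 1 = 'X^2 - (- c) *: 'X + 1 by rewrite scaleNr opprK.
have [ab1 ab2] : a != b /\ a != - b.
  by move: ab; rewrite eqf_sqr negb_or => /andP.
have sX : separable_poly ('X : {poly k}).
  by rewrite separable_poly.unlock derivX coprimep1.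
have sN (c : k) : c ^+ 2 != 4%:R -> separable_poly ('X^2 - (- c) *: 'X + 1).
  by move=> h; apply: quad_sep; rewrite sqrrN.
rewrite /branch_poly !E !separable_mul sX !quad_sep ?sN ?coprimepMl ?X_cop //=.
rewrite !quad_cop ?opp_neq //= 1?eq_sym ?ab2 //.
- by rewrite eqr_opp eq_sym.
- by rewrite eq_sym eqr_oppLR.
- by rewrite sqrrN.
- by rewrite sqrrN.
Qed.

End PalindromicPolynomial.

(** * Double covers of the line *)

Section DoubleCovers.

Variable k : closedFieldType.
Hypothesis two_neq0 : 2%:R != 0 :> k.

Definition base_coord (E : curve k) : E := (tofrac 'X)%:A.

Lemma pev_base (E : curve k) P : pev (base_coord E) P = (tofrac P)%:A.
Proof.
elim/poly_ind: P => [|P c IH]; first by rewrite pev0 rmorph0 scale0r.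
rewrite !pevE IH rmorphD rmorphM /= scalerDl -scalerA; congr (_ + _).
by rewrite -[in RHS]mulr_algl.
Qed.

Lemma base_transcendental (E : curve k) : transcendental (base_coord E).
Proof.
move=> P; rewrite pev_base => /eqP; rewrite scaler_eq0 oner_eq0 orbF.
by rewrite tofrac_eq0 => /eqP.
Qed.

Definition quadratic_generator (E : curve k) (y : E) (t : rat_fun k) :=
  y ^+ 2 = t%:A /\ forall z : E, exists r s : rat_fun k, z = r%:A + s%:A * y.

Lemma model_of_generator (E : curve k) (y : E) f :
  separable_poly f -> (1 < size f)%N -> quadratic_generator y (tofrac f) ->
  model (base_coord E) y f.
Proof.
move=> sf f1 [y2 gen]; split=> //.
- by rewrite pev_base.
- exact: base_transcendental.
move=> z; have [r [s ->]] := gen z.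
have [n [d [d0 rd]]] := frac_numden r; have [n' [d' [d0' sd]]] := frac_numden s.
exists (n * d'), (n' * d), (d * d'); split; first by rewrite mulf_neq0.
rewrite !pev_base !tofracM -rd -sd.
have A u v : (u * v)%:A = u%:A * v%:A :> E by rewrite -scalerAl mul1r scalerA.
rewrite !A.
by move: (r%:A) (s%:A) ((tofrac d)%:A) ((tofrac d')%:A) => u v w w'; ring.
Qed.

Lemma model_generator (E : curve k) (y : E) f : model (base_coord E) y f ->
  quadratic_generator y (tofrac f).
Proof.
move=> m; split; first by rewrite (model_sqr m) pev_base.
move=> z; have [A [B [C [C0]]]] := model_gen m z; rewrite !pev_base => e.
have C1 : tofrac C != 0 by rewrite tofrac_eq0.
exists (tofrac A / tofrac C), (tofrac B / tofrac C).
have cC : (tofrac C)%:A != 0 :> E by rewrite scaler_eq0 negb_or C1 oner_eq0.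
apply: (mulIf cC); rewrite e.
have M u v : (u * v)%:A = u%:A * v%:A :> E by rewrite -scalerAl mul1r scalerA.
have W u : (u / tofrac C)%:A * (tofrac C)%:A = u%:A :> E by rewrite -M divfK.
by rewrite mulrDl W mulrAC W.
Qed.

Lemma sqr_irreducible (f : {poly k}) : separable_poly f -> (1 < size f)%N ->
  irreducible_poly ('X^2 - (tofrac f)%:P).
Proof.
move=> sf f1; apply: cubic_irreducible => [|r]; first by rewrite size_XnsubC.
apply/negP; rewrite /root !hornerE subr_eq0 => /eqP r2.
have [a [b [b0 rb]]] := frac_numden r.
have /eqP : tofrac (a ^+ 2) = tofrac (b ^+ 2 * f).
  by rewrite [RHS]tofracM !tofracXn -rb exprMn r2 mulrC.
by rewrite tofrac_eq => /eqP/(sqr_separable sf f1)/eqP; rewrite (negPf b0).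
Qed.

Lemma adjoin_generator (E : curve k) (y : E) t :
  y ^+ 2 = t%:A -> <<1; y>>%VS = fullv -> quadratic_generator y t.
Proof.
move=> y2 full; split=> // z.
pose L w := exists r s : rat_fun k, w = r%:A + s%:A * y.
have M u v : (u * v)%:A = u%:A * v%:A :> E by rewrite -scalerAl mul1r scalerA.
have LD u v : L u -> L v -> L (u + v).
  move=> [r [s ->]] [r' [s' ->]]; exists (r + r'), (s + s').
  rewrite !scalerDl.
  by move: (r%:A) (s%:A) (r'%:A) (s'%:A) => a b c d; ring.
have LM u v : L u -> L v -> L (u * v).
  move=> [r [s ->]] [r' [s' ->]]; exists (r * r' + s * s' * t), (r * s' + s * r').
  rewrite !scalerDl !M -y2.
  by move: (r%:A) (s%:A) (r'%:A) (s'%:A) => a b c d; ring.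
have LA r : L r%:A by exists r, 0; rewrite scale0r mul0r addr0.
have Ly : L y by exists 0, 1; rewrite scale0r scale1r mul1r add0r.
have /Fadjoin_polyP[p /polyOverP p1 ->] : z \in <<1; y>>%VS by rewrite full memvf.
rewrite horner_coef; apply: (big_ind L) => //; first by rewrite -(scale0r 1).
move=> i _; apply: (LM); first by have /vlineP[r ->] := p1 i.
by elim: (nat_of_ord i) => [|n IH]; rewrite ?expr0 ?exprS;
   [rewrite -(scale1r 1) | apply: LM].
Qed.

Lemma curve_exists (f : {poly k}) : separable_poly f -> (1 < size f)%N ->
  exists2 E : curve k, double_cover E & exists y : E, model (base_coord E) y f.
Proof.
move=> sf f1; have [E dimE [y ry gy]] := irredp_FAdjoin (sqr_irreducible sf f1).
exists E; first by rewrite /double_cover dimE size_XnsubC.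
exists y; apply: model_of_generator => //; apply: adjoin_generator => //.
apply/eqP; rewrite -subr_eq0; move: ry.
by rewrite rmorphB /= map_polyXn map_polyC /root !hornerE.
Qed.

Lemma squarefree_part (P : {poly k}) : P != 0 ->
  exists q h, [/\ q != 0, separable_poly h & P = q ^+ 2 * h].
Proof.
have [N] := ubnP (size P); elim: N => // N IH in P * => sP P0.
have [sep|nsep] := boolP (separable_poly P).
  by exists 1, P; rewrite oner_neq0 expr1n mul1r.
have [a /dvdpP[Q PQ]] := double_root nsep.
have Q0 : Q != 0 by apply: contra_neq P0 => h; rewrite PQ h mul0r.
have sQ : (size Q < N)%N.
  move: sP; rewrite PQ size_mul ?expf_neq0 ?polyXsubC_eq0 // size_exp_XsubC.
  by rewrite addn3 /=; move: (size Q) => i; lia.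
have [q [h [q0 sh Qqh]]] := IH _ sQ Q0.
exists (q * ('X - a%:P)), h; split=> //; first by rewrite mulf_neq0 ?polyXsubC_eq0.
by rewrite PQ Qqh exprMn mulrAC.
Qed.

Lemma sqr_class_denom (F : fieldType) (n d q h t : F) : d != 0 -> q != 0 ->
  t * d = n -> n * d = q ^+ 2 * h -> exists2 e : F, e != 0 & h = e ^+ 2 * t.
Proof.
move=> d0 q0 <- nd; exists (d / q); first by rewrite mulf_neq0 ?invr_eq0.
by apply: (mulfI (expf_neq0 2 q0)); rewrite -nd; field.
Qed.

(** Complete the square, clear the denominator, and drop the square part of the
    radicand. The rest is not constant, as constants are squares. *)
Lemma double_cover_model (E : curve k) : double_cover E ->
  exists (y : E) (f : {poly k}), model (base_coord E) y f.
Proof.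
move=> dimE; have t0 := curve_two_neq0 E two_neq0.
have M u v : (u * v)%:A = u%:A * v%:A :> E by rewrite -scalerAl mul1r scalerA.
have Ainj u : (u%:A == 0 :> E) = (u == 0) by rewrite scaler_eq0 oner_eq0 orbF.
have [v nv] : exists v : E, v \notin 1%VS.
  have : ~~ ({:E} <= 1)%VS.
    by apply/negP => /dimvS; rewrite dimv1 dimE.
  by move/subvPn => [v _ nv]; exists v.
have gen z : exists r s : rat_fun k, z = r%:A + s%:A * v.
  have fr : free [:: v; 1].
    by rewrite free_cons span_seq1 nv seq1_free oner_neq0.
  have full : <<[:: v; 1%R]>>%VS = fullv.
    apply/eqP; rewrite eqEdim subvf /= dimE.
    by have := fr; rewrite /free => /eqP ->.
  have : z \in <<in_tuple [:: v; 1%R]>>%VS by rewrite full memvf.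
  move/coord_span; rewrite !big_ord_recl big_ord0 /= addr0 => ->.
  exists (coord (in_tuple [:: v; 1]) (lift ord0 ord0) z), (coord (in_tuple [:: v; 1]) ord0 z).
  by rewrite addrC mulr_algl.
have [r [s v2]] := gen (v ^+ 2).
have two0 : 2%:R != 0 :> rat_fun k.
  by apply: contra_neq t0 => h; rewrite -(scaler_nat 2 (1 : E)) h scale0r.
pose a : E := (s / 2%:R)%:A; pose w := v - a; pose t := r + (s / 2%:R) ^+ 2.
have vw : v = w + a by rewrite subrK.
have sa : s%:A = 2%:R * a by rewrite -[2%:R](scaler_nat 2 (1 : E)) -M mulrC divfK.
have w2 : w ^+ 2 = t%:A.
  rewrite /t scalerDl exprS expr1 M -/a /w.
  have -> : (v - a) * (v - a) = v ^+ 2 - (2%:R * a) * v + a * a by ring.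
  by rewrite v2 sa addrK.
have nw (u : rat_fun k) : w != u%:A.
  apply: contra nv => /eqP wu; rewrite vw wu.
  by apply/vlineP; exists (u + s / 2%:R); rewrite scalerDl.
have [n [d [d0 td]]] := frac_numden t.
have n0 : n != 0.
  apply/eqP => n0; move/eqP: td; rewrite n0 rmorph0 mulf_eq0 tofrac_eq0 (negPf d0) orbF.
  move=> /eqP t_0; move: w2; rewrite t_0 scale0r => /eqP; rewrite sqrf_eq0.
  by move: (nw 0); rewrite scale0r => /negPf ->.
have [q [h [q0 sh nd]]] := squarefree_part (mulf_neq0 n0 d0).
have d1 : tofrac d != 0 by rewrite tofrac_eq0.
have q1 : tofrac q != 0 by rewrite tofrac_eq0.
have [e e0 he] : exists2 e : rat_fun k, e != 0 & tofrac h = e ^+ 2 * t.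
  apply: sqr_class_denom d1 q1 td _.
  by rewrite -tofracM nd tofracM tofracXn.
have y2 : (e%:A * w) ^+ 2 = (tofrac h)%:A.
  by rewrite exprMn w2 he M [e ^+ 2]expr2 M expr2.
exists (e%:A * w), h; apply: model_of_generator => //.
  have h0 := separable_poly_neq0 sh.
  rewrite ltn_neqAle size_poly_gt0 h0 andbT eq_sym.
  apply/negP => /size_poly1P[c c0 hc]; have [b bc] := sqrt_exists c.
  move: y2; rewrite hc -bc polyC_exp tofracXn expr2 [X in _ = X%:A]expr2 M -expr2 -[RHS]expr2.
  move/eqP; rewrite eqf_sqr; have eA : e%:A != 0 :> E by rewrite Ainj.
  case/orP => /eqP h1.
    case/negP: (nw (e^-1 * tofrac b%:P)); apply/eqP; apply: (mulfI eA).
    by rewrite h1 -M mulVKf.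
  case/negP: (nw (- (e^-1 * tofrac b%:P))); apply/eqP; apply: (mulfI eA).
  by rewrite h1 scaleNr mulrN -M mulVKf.
split=> // z; have [r' [s' ->]] := gen z.
exists (r' + s' * (s / 2%:R)), (s' * e^-1).
have -> : (r' + s' * (s / 2%:R))%:A = r'%:A + s'%:A * a by rewrite scalerDl M.
have -> : (s' / e)%:A * (e%:A * w) = s'%:A * w by rewrite mulrA -M divfK.
by rewrite {1}vw mulrDr [X in _ + X]addrC addrA.
Qed.

Lemma rosenhain_model (l1 l2 l3 : k) : uniq [:: 0; 1; l1; l2; l3] ->
  exists y, model (base_coord (rosenhain_curve l1 l2 l3)) y (rosenhain_poly l1 l2 l3).
Proof.
move=> un; have [_ [y [y2 full]]] := rosenhain_curveP l1 l2 l3.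
exists y; apply: model_of_generator; last exact: adjoin_generator.
  have -> : rosenhain_poly l1 l2 l3 = \prod_(c <- [:: 0; 1; l1; l2; l3]) ('X - c%:P).
    by rewrite /rosenhain_poly !big_cons big_nil subr0 polyC1 mulr1 !mulrA.
  by rewrite separable_prod_XsubC.
by rewrite size_rosenhain_poly.
Qed.

End DoubleCovers.

(** * Tensor products as pushouts *)

Section Pushout.

Variable k : closedFieldType.
Variables C1 C2 H : curve k.
Variables (i1 : {rmorphism C1 -> H}) (i2 : {rmorphism C2 -> H}).
Variables (y2 : C2) (t : rat_fun k).
Hypothesis i12 : forall r : rat_fun k, i1 r%:A = i2 r%:A.
Hypothesis gen2 : quadratic_generator y2 t.
Hypothesis y2_out : forall c, i1 c != i2 y2.

Definition span_of (z : H) := exists a b, z = i1 a + i1 b * i2 y2.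

Lemma sqr_image : i2 y2 ^+ 2 = i1 t%:A.
Proof. by rewrite -rmorphXn /= gen2.1 i12. Qed.

Lemma span_inj a b a' b' :
  i1 a + i1 b * i2 y2 = i1 a' + i1 b' * i2 y2 -> a = a' /\ b = b'.
Proof.
move=> e; have [bb|bb] := eqVneq b b'.
  by move: e; rewrite bb => /addIr/fmorph_inj.
have nb : i1 (b - b') != 0 by rewrite fmorph_eq0 subr_eq0.
have /eqP[] := y2_out ((a' - a) / (b - b')).
rewrite fmorph_div; apply: (mulIf nb); rewrite divfK //.
rewrite !rmorphB mulrBr ![i2 y2 * _]mulrC /=.
have -> : i1 a' = i1 a + i1 b * i2 y2 - i1 b' * i2 y2 by rewrite e addrK.
by ring.
Qed.

Lemma span_image1 a : span_of (i1 a).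
Proof. by exists a, 0; rewrite rmorph0 mul0r addr0. Qed.

Lemma span_image2 : span_of (i2 y2).
Proof. by exists 0, 1; rewrite rmorph0 rmorph1 mul1r add0r. Qed.

Lemma span_D z w : span_of z -> span_of w -> span_of (z + w).
Proof.
move=> [a [b ->]] [a' [b' ->]]; exists (a + a'), (b + b').
by rewrite !rmorphD; ring.
Qed.

Lemma span_M z w : span_of z -> span_of w -> span_of (z * w).
Proof.
move=> [a [b ->]] [a' [b' ->]]; exists (a * a' + b * b' * t%:A), (a * b' + b * a').
by rewrite !rmorphD !rmorphM /= -sqr_image; ring.
Qed.

Lemma span_N z : span_of z -> span_of (- z).
Proof. by move=> [a [b ->]]; exists (- a), (- b); rewrite !rmorphN; ring. Qed.

(** Inverses come from the norm to the image of [C1]. *)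
Lemma span_V z : span_of z -> span_of z^-1.
Proof.
have [->|] := eqVneq z 0; first by rewrite invr0.
move=> z0 [a [b e]]; pose n := a ^+ 2 - b ^+ 2 * t%:A.
have nE : i1 n = z * (i1 a - i1 b * i2 y2).
  by rewrite e rmorphB !rmorphM /= -sqr_image; ring.
have n0 : i1 n != 0.
  rewrite nE mulf_neq0 // subr_eq0; apply/eqP => ab.
  have [b0|b0] := eqVneq b 0.
    by move: z0; rewrite e ab b0 rmorph0 mul0r addr0 eqxx.
  have ib0 : i1 b != 0 by rewrite fmorph_eq0.
  by have /eqP[] := y2_out (a / b); rewrite fmorph_div /= ab mulrAC divff // mul1r.
have -> : z^-1 = i1 n^-1 * (i1 a + - i1 b * i2 y2).
  apply: (mulfI z0); rewrite divff // mulrCA mulNr -nE.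
  by rewrite fmorphV mulVf.
apply: span_M; first exact: span_image1.
by exists a, (- b); rewrite rmorphN.
Qed.

Hypothesis spanning : forall z, span_of z.

(** [H] is then [C1[Y] / (Y^2 - t)], the tensor product of [C1] with
    [C2 = k(x)[Y] / (Y^2 - t)]. *)
Lemma pushout_of_span (A : comPzRingType)
    (j1 : {rmorphism C1 -> A}) (j2 : {rmorphism C2 -> A}) :
  (forall r : rat_fun k, j1 r%:A = j2 r%:A) ->
  exists h : {rmorphism H -> A},
    [/\ h \o i1 =1 j1, h \o i2 =1 j2
      & forall h' : {rmorphism H -> A},
          h' \o i1 =1 j1 -> h' \o i2 =1 j2 -> h' =1 h].
Proof.
move=> j12.
have ex z : exists p : C1 * C1, z == i1 p.1 + i1 p.2 * i2 y2.
  by have [a [b ->]] := spanning z; exists (a, b).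
pose h z := j1 (xchoose (ex z)).1 + j1 (xchoose (ex z)).2 * j2 y2.
have hE z a b : z = i1 a + i1 b * i2 y2 -> h z = j1 a + j1 b * j2 y2.
  move=> e; rewrite /h; have /eqP := xchooseP (ex z).
  by rewrite {1}e => /span_inj[<- <-].
have j2y : j2 y2 * j2 y2 = j1 t%:A by rewrite -rmorphM -expr2 gen2.1 j12.
have h_zmod : zmod_morphism h.
  move=> z w; have [a [b ez]] := spanning z; have [a' [b' ew]] := spanning w.
  rewrite (hE _ _ _ ez) (hE _ _ _ ew) (hE _ (a - a') (b - b')).
    by rewrite !rmorphB /= mulrBl opprD addrACA.
  by rewrite ez ew !rmorphB /= mulrBl opprD addrACA.
have h_mon : monoid_morphism h.
  split=> [|z w].
    rewrite (hE _ 1 0); first by rewrite rmorph1 rmorph0 mul0r addr0.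
    by rewrite rmorph1 rmorph0 mul0r addr0.
  have [a [b ez]] := spanning z; have [a' [b' ew]] := spanning w.
  rewrite (hE _ _ _ ez) (hE _ _ _ ew).
  rewrite (hE _ (a * a' + b * b' * t%:A) (a * b' + b * a')).
    rewrite !rmorphD !rmorphM /= -j2y.
    by ring.
  by rewrite ez ew !rmorphD !rmorphM /= -sqr_image; ring.
pose hM : {rmorphism H -> A} := HB.pack h
  (GRing.isZmodMorphism.Build _ _ h h_zmod)
  (GRing.isMonoidMorphism.Build _ _ h h_mon).
exists hM; split=> [a|c|h' h1 h2 z] /=.
- by rewrite (hE _ a 0) rmorph0 mul0r addr0.
- have [r [s ->]] := gen2.2 c; rewrite (hE _ r%:A s%:A).
    by rewrite rmorphD rmorphM /= !j12.
  by rewrite rmorphD rmorphM /= !i12.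
- have [a [b e]] := spanning z; rewrite (hE _ _ _ e) e rmorphD rmorphM /=.
  by have /= -> := h1 a; have /= -> := h1 b; have /= -> := h2 y2.
Qed.

End Pushout.

(** * The two quotient curves *)

Section FiberProduct.

Variable k : closedFieldType.
Hypothesis two_neq0 : 2%:R != 0 :> k.
Variables (a b l1 l2 l3 l3' : k).
Hypothesis a_neq0 : a != 0.
Hypothesis l1E : l1 = (a - b) / (2%:R * a).
Hypothesis l2E : l2 = (a + b) / (2%:R * a).
Hypothesis l3E : l3 = (a + 2%:R) / (2%:R * a).
Hypothesis l3E' : l3' = (a - 2%:R) / (2%:R * a).

Variables (H : curve k) (x y : H).
Hypothesis m : model x y (branch_poly a b).

(* [X] is the Rosenhain coordinate on the line with coordinate [u], and [Y1],
   [Y2] below are the square roots that generate the two quotient fields;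
   [kappa] absorbs the leading coefficient in [X] *)
Let u := x + x^-1.
Let w := (u ^+ 2 - const H a ^+ 2) * (u ^+ 2 - const H b ^+ 2).
Let X := (const H a - u) / (2%:R * const H a).

Fact x_neq0 : x != 0.
Proof. exact: transcendental_neq0 (model_tr m). Qed.

Fact two_H_neq0 : 2%:R != 0 :> H.
Proof. exact: curve_two_neq0. Qed.

Fact const_a_neq0 : const H a != 0.
Proof. by rewrite fmorph_eq0. Qed.

Lemma fiber_sqr : y ^+ 2 = x ^+ 5 * w.
Proof.
rewrite (model_sqr m) /branch_poly !pevE /w /u; field.
exact: x_neq0.
Qed.

Lemma fiber_tr : transcendental X.
Proof.
apply: transcendentalP => c; apply/eqP => Xc.
have u_c : u = const H (a - c * (2%:R * a)).
  rewrite rmorphB !rmorphM rmorph_nat /= -Xc /X; field.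
  by rewrite two_H_neq0 const_a_neq0.
have : pev x ('X^2 - (a - c * (2%:R * a)) *: 'X + 1) = 0.
  by rewrite !pevE -u_c /u; field; exact: x_neq0.
move/(model_tr m)/(congr1 (fun P : {poly k} => P`_2)).
rewrite !coefE /= mulr0 subr0 addr0 => /eqP.
by rewrite oner_eq0.
Qed.

Variable kappa : k.
Hypothesis kappaE : kappa ^+ 2 = (- 2%:R * a) ^+ 5.

Let Y1 := y * (1 + x) / x ^+ 3 / const H kappa.
Let Y2 := y * (1 - x) / x ^+ 3 / const H kappa.

Fact kappa_neq0 : const H kappa != 0.
Proof.
by rewrite fmorph_eq0 -sqrf_eq0 kappaE expf_neq0 // mulf_neq0 ?oppr_eq0.
Qed.

Fact const_kappa : const H kappa ^+ 2 = (- 2%:R * const H a) ^+ 5.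
Proof. by rewrite -rmorphXn /= kappaE rmorphXn rmorphM rmorphN rmorph_nat. Qed.

Fact fiber_branch c c' : c = (a - c') / (2%:R * a) ->
  X - const H c = (u - const H c') / (- 2%:R * const H a).
Proof.
move=> ->; rewrite fmorph_div !(rmorphB, rmorphM, rmorph_nat) /= /X; field.
by rewrite oppr_eq0 two_H_neq0 const_a_neq0.
Qed.

Lemma fiber_curve c c' : c = (a - c') / (2%:R * a) ->
  pev X (rosenhain_poly l1 l2 c) = w * (u - const H c') / const H kappa ^+ 2.
Proof.
move=> cE; rewrite /rosenhain_poly !pevM pevX !pev_XsubC.
rewrite (fiber_branch cE) (fiber_branch l1E).
rewrite (@fiber_branch l2 (- b)) ?opprK // rmorphN /= opprK.
rewrite (@fiber_branch 1 (- a)); last first.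
  by field; rewrite two_neq0 a_neq0.
rewrite rmorphN /= opprK const_kappa /X /w; field.
by rewrite ?oppr_eq0 two_H_neq0 const_a_neq0 ?oner_neq0.
Qed.

Lemma fiber_Y1 : Y1 ^+ 2 = pev X (rosenhain_poly l1 l2 l3).
Proof.
rewrite (@fiber_curve l3 (- 2%:R)) ?opprK // rmorphN rmorph_nat /= opprK.
have -> : Y1 ^+ 2 = y ^+ 2 * (1 + x) ^+ 2 / x ^+ 6 / const H kappa ^+ 2.
  by rewrite /Y1; field; rewrite x_neq0 kappa_neq0.
rewrite fiber_sqr /u; move: w => W; field.
by rewrite x_neq0 kappa_neq0.
Qed.

Lemma fiber_Y2 : Y2 ^+ 2 = pev X (rosenhain_poly l1 l2 l3').
Proof.
rewrite (@fiber_curve l3' 2%:R) // rmorph_nat.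
have -> : Y2 ^+ 2 = y ^+ 2 * (1 - x) ^+ 2 / x ^+ 6 / const H kappa ^+ 2.
  by rewrite /Y2; field; rewrite x_neq0 kappa_neq0.
rewrite fiber_sqr /u; move: w => W; field.
by rewrite x_neq0 kappa_neq0.
Qed.

(** The lift of [x -> 1/x], which shows that [Y2] is not in the field generated
    by [X] and [Y1]. *)
Lemma fiber_involution : exists T : {rmorphism H -> H},
  [/\ forall c, T (const H c) = const H c, T X = X, T Y1 = Y1 & T Y2 = - Y2].
Proof.
have sF : (9 < size (branch_poly a b) <= 11)%N by rewrite size_branch_poly.
have m' := @model_inv _ _ _ _ _ m 4 sF; rewrite revp_branch_poly in m'.
have [T [Tc Tx Ty]] := model_hom m (model_tr m') (model_sqr m').
have Tu : T u = u by rewrite /u rmorphD fmorphV /= Tx invrK addrC.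
have x0 := x_neq0; have k0 := kappa_neq0.
exists T; split=> //.
- by rewrite /X !(fmorph_div, rmorphB, rmorphM, rmorph_nat) /= Tu !Tc.
- rewrite /Y1 !(fmorph_div, fmorphV, rmorphD, rmorphM, rmorphXn, rmorph1) /= Tx Ty !Tc.
  by field; rewrite x0 k0 oner_neq0.
- rewrite /Y2 !(fmorph_div, fmorphV, rmorphB, rmorphM, rmorphXn, rmorph1) /= Tx Ty !Tc.
  by field; rewrite x0 k0 oner_neq0.
Qed.

Variables (C1 C2 : curve k) (y1 : C1) (y2 : C2).
Hypothesis m1 : model (base_coord C1) y1 (rosenhain_poly l1 l2 l3).
Hypothesis m2 : model (base_coord C2) y2 (rosenhain_poly l1 l2 l3').

(** The span of 1 and [Y2] over the first field is a field. It contains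
    [u = x + 1/x] and, from the product [Y1 Y2], also [1/x - x]; hence [x], and
    then [y]. *)
Theorem fiber_product : birational_fiber_product H C1 C2.
Proof.
have [i1 [i1c i1x i1y]] := model_hom m1 fiber_tr fiber_Y1.
have [i2 [i2c i2x i2y]] := model_hom m2 fiber_tr fiber_Y2.
have x0 := x_neq0; have k0 := kappa_neq0; have a0 := const_a_neq0.
have t0 := two_H_neq0; have tx := model_tr m.
have i12 (r : rat_fun k) : i1 r%:A = i2 r%:A.
  have [n [d [d0 rd]]] := frac_numden r.
  have M (E : curve k) : r%:A * pev (base_coord E) d = pev (base_coord E) n.
    by rewrite !pev_base -rd -scalerAl mul1r scalerA.
  have dX : pev X d != 0 by rewrite pev_eq0 //; exact: fiber_tr.
  have e1 := congr1 i1 (M _); rewrite rmorphM /= !(pev_morph i1c) i1x in e1.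
  have e2 := congr1 i2 (M _); rewrite rmorphM /= !(pev_morph i2c) i2x in e2.
  by apply: (mulIf dX); rewrite e1 e2.
have y0 := model_y_neq0 m.
have Y20 : Y2 != 0.
  rewrite /Y2 !mulf_neq0 ?invr_eq0 ?expf_neq0 //.
  rewrite subr_eq0 eq_sym; have := transcendental_neq 1 tx.
  by rewrite rmorph1.
have y2_out c : i1 c != i2 y2.
  rewrite i2y; apply/eqP => ic; have [T [Tc TX TY1 TY2]] := fiber_involution.
  have Ti : T \o i1 =1 i1.
    apply: (model_hom_eq m1) => [d||] /=; first by rewrite i1c Tc.
      by rewrite i1x.
    by rewrite i1y.
  have := Ti c; rewrite /= ic TY2 => /eqP.
  by rewrite eq_sym -subr_eq0 opprK -mulr2n -mulr_natl mulf_eq0 (negPf t0) (negPf Y20).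
have gen2 := model_generator m2.
exists i1, i2; split=> //.
move=> A j1 j2; apply: (pushout_of_span i12 gen2 y2_out).
set L := span_of _ _ _.
have LD p q : L p -> L q -> L (p + q) by exact: span_D.
have LN p : L p -> L (- p) by exact: span_N.
have LM p q : L p -> L q -> L (p * q) by exact: (span_M i12 gen2).
have LV p : L p -> L p^-1 by exact: (span_V i12 gen2 y2_out).
have L1 c : L (i1 c) by exact: span_image1.
have Lc c : L (const H c) by rewrite -i1c.
have Ln n : L n%:R by rewrite -(rmorph_nat (const H)); exact: Lc.
have Lu : L u.
  have -> : u = const H a + - (2%:R * const H a * X).
    by rewrite /X; field; rewrite t0 a0.
  by apply: LD => //; apply/LN/LM; [apply: LM | rewrite -i1x].
have LY1 : L Y1 by rewrite -i1y.
have LY2 : L Y2 by rewrite -i2y; exact: span_image2.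
have w0 : w != 0.
  by apply: contra_neq y0 => w0; apply/eqP; rewrite -sqrf_eq0 fiber_sqr w0 mulr0.
have Lw : L w.
  have L2 v : L v -> L (v ^+ 2) by move=> h; rewrite expr2; apply: LM.
  by apply: LM; apply: (LD); [exact: L2 | apply/LN/L2 | exact: L2 | apply/LN/L2].
have Lx : L x.
  have e : x^-1 - x = Y1 * Y2 * (const H kappa * const H kappa) / w.
    have -> : Y1 * Y2 * (const H kappa * const H kappa) =
      y ^+ 2 * (1 - x ^+ 2) / x ^+ 6.
      by rewrite /Y1 /Y2; field; rewrite x0 k0.
    by rewrite fiber_sqr; move: w w0 => W W0; field; rewrite x0 W0.
  have -> : x = (u + - (x^-1 - x)) / 2%:R by rewrite /u; field; rewrite t0 x0.
  apply: (LM); last exact: (LV _ (Ln 2%N)).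
  apply: (LD) => //; apply: (LN); rewrite e; apply: (LM); last exact: (LV).
  by apply: (LM); apply: (LM).
have Ly : L y.
  have -> : y = Y1 * const H kappa * (x * x * x) / (1 + x).
    rewrite /Y1; field; rewrite x0 k0 /=.
    have := transcendental_neq (-1) tx.
    by rewrite rmorphN1 -subr_eq0 opprK addrC => ->.
  apply: (LM); last by apply: (LV); apply: (LD) => //; exact: (Ln 1%N).
  by apply: (LM); [apply: (LM) | apply: (LM) => //; apply: (LM)].
have Lp P : L (pev x P).
  elim/poly_ind: P => [|P c IH]; first by rewrite pev0; exact: (Ln 0%N).
  by rewrite !pevE; apply: (LD) => //; apply: (LM).
move=> z; have [P [Q [C [C0 e]]]] := model_gen m z.
have nC : pev x C != 0 by rewrite pev_eq0.
rewrite -[z](mulfK nC) e.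
by apply: (LM); [apply: (LD) => //; apply: (LM) | apply: (LV)].
Qed.

End FiberProduct.

(** * The dihedral group of order 8 *)

Section Dihedral.

Local Open Scope group_scope.

Lemma D8_generators : exists r s : 'D_8,
  [/\ #[r] = 4%N, #[s] = 2%N, s \notin <[r]> & s * r = r ^+ 3 * s].
Proof.
have [[r s] [_ _ r4 /setDP[_ nsr]] [s2 rs]] :=
  generators_2dihedral (isT : (1 < 3)%N) (isog_refl [set: 'D_8]).
exists r, s; split=> //.
have rV : r ^+ 3 = r^-1 by apply/eqP; rewrite eq_sym eq_invg_mul -expgS -order_dvdn r4.
have ss : s * s = 1 by rewrite -(expg_order s) s2.
have sV : s^-1 = s by apply/eqP; rewrite eq_invg_mul ss.
by rewrite rV -rs conjgE sV -!mulgA ss mulg1.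
Qed.

(** Distinct pairs give distinct elements since [s] is not a power of [r], and
    there are 8 of both. *)
Lemma D8_normal_form (r s : 'D_8) : #[r] = 4%N -> #[s] = 2%N -> s \notin <[r]> ->
  bijective (fun ij : 'I_4 * 'I_2 => r ^+ ij.1 * s ^+ ij.2).
Proof.
move=> r4 s2 nsr; pose F (ij : 'I_4 * 'I_2) := r ^+ ij.1 * s ^+ ij.2.
have Finj : injective F.
  move=> [i j] [i' j']; rewrite /F /= => e.
  have jj : j = j'.
    apply/eqP/negPn/negP => jj; case/negP: nsr.
    have : s ^+ j * s ^- j' \in <[r]>.
      have -> : s ^+ j * s ^- j' = r ^- i * r ^+ i'.
        by apply: (mulgI (r ^+ i)); rewrite mulgA e mulgK mulgA mulgV mul1g.
      by rewrite groupM ?groupV ?mem_cycle.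
    case: j j' jj {e} => [[|[|//]] ?] [[|[|//]] ?] // _ /=.
      by rewrite expg0 mul1g expg1 groupV.
    by rewrite expg0 invg1 mulg1 expg1.
  move: e; rewrite jj => /mulIg/eqP; rewrite eq_expg_mod_order r4.
  by rewrite !modn_small // => /eqP/val_inj ->.
apply: (inj_card_bij Finj).
by rewrite card_prod !card_ord -cardsT (@card_2dihedral 3).
Qed.

End Dihedral.

Section DihedralAction.

Variable k : closedFieldType.
Variable H : curve k.

Lemma D4_action : aut_contains_D4 H -> exists R S : {rmorphism H -> H},
  [/\ curve_iso R, curve_iso S, (forall z, R (R (R (R z))) = z),
      (forall z, S (S z) = z)
    & (forall z, S (R z) = R (R (R (S z))))] /\
  [/\ ~ (forall z, R (R z) = z), ~ (forall z, S z = z),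
      ~ (forall z, S z = R (R z)), ~ (forall z, S (R z) = z)
    & ~ (forall z, S (R z) = R (R z))].
Proof.
move=> [phi [phi_iso phiM phi_inj]].
have [r [s [r4 s2 nsr sr]]] := D8_generators.
have phi1 : phi 1%g =1 id.
  move=> z; have := phiM 1%g 1%g z; rewrite mulg1 /= => /fmorph_inj.
  by move=> <-.
have M g h z : phi g (phi h z) = phi (g * h)%g z by rewrite phiM.
have no g : (forall z, phi g z = z) -> g = 1%g.
  by move=> e; apply: phi_inj => z; rewrite e phi1.
have no2 g h : (forall z, phi g z = phi h z) -> g = h by move=> e; apply: phi_inj.
exists (phi r), (phi s); split; split; rewrite //.
- by move=> z; rewrite !M -[RHS]phi1 -(expg_order r) r4 !expgS expg0 mulg1 !mulgA.
- by move=> z; rewrite !M -[RHS]phi1 -(expg_order s) s2.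
- by move=> z; rewrite !M sr !expgS expg0 mulg1 !mulgA.
- move=> e; have : (r * r)%g = 1%g by apply: no => z; rewrite -M.
  by move/eqP; rewrite -[(r * r)%g]/(r ^+ 2)%g -order_dvdn r4.
- by move=> /no s1; rewrite s1 group1 in nsr.
- move=> e; have s_rr : s = (r * r)%g by apply: no2 => z; rewrite -M.
  by rewrite s_rr groupM ?cycle_id in nsr.
- move=> e; have : (s * r)%g = 1%g by apply: no => z; rewrite -M.
  by move/(canRL (mulgK _)) => s_r; rewrite s_r mul1g groupV cycle_id in nsr.
- move=> e; have : (s * r)%g = (r * r)%g by apply: no2 => z; rewrite -!M.
  by move/mulIg => s_r; rewrite s_r cycle_id in nsr.
Qed.

Fixpoint iter_morph (f : {rmorphism H -> H}) n : {rmorphism H -> H} :=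
  if n is n'.+1 then f \o iter_morph f n' else idfun.

Lemma iter_morphE f n z : iter_morph f n z = iter n f z.
Proof. by elim: n => //= n ->. Qed.

(** The action sends [r^i s^j] to [R^i S^j]. Both families obey the rule
    [s^j r^i = r^(3^j i) s^j], which makes it multiplicative. *)
Lemma aut_D4_of (R S : {rmorphism H -> H}) :
  curve_iso R -> curve_iso S -> (forall z, R (R (R (R z))) = z) ->
  (forall z, S (S z) = z) -> (forall z, S (R z) = R (R (R (S z)))) ->
  (forall i j i' j', (i < 4)%N -> (j < 2)%N -> (i' < 4)%N -> (j' < 2)%N ->
     (forall z, iter i R (iter j S z) = iter i' R (iter j' S z)) ->
     i = i' /\ j = j') ->
  aut_contains_D4 H.
Proof.
move=> Ri Si R4 S2 SR sep.
have [r [s [r4 s2 nsr sr]]] := D8_generators.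
have [ix FK KF] := D8_normal_form r4 s2 nsr.
have iter_mod (f : {rmorphism H -> H}) n i z : (forall w, iter n f w = w) ->
    iter (i %% n) f z = iter i f z.
  move=> fn; rewrite {2}(divn_eq i n) addnC iterD; congr (iter _ _ _).
  by elim: (i %/ n)%N => //= q IH; rewrite mulSn iterD -IH fn.
pose phi g : {rmorphism H -> H} := iter_morph R (ix g).1 \o iter_morph S (ix g).2.
have phiE g z : phi g z = iter (ix g).1 R (iter (ix g).2 S z).
  by rewrite /phi /= !iter_morphE.
have phi_rs i j z : phi (r ^+ i * s ^+ j)%g z = iter i R (iter j S z).
  have -> : (r ^+ i * s ^+ j)%g =
      (r ^+ (inord (i %% 4) : 'I_4) * s ^+ (inord (j %% 2) : 'I_2))%g.
    have ri := expg_mod_order r i; have sj := expg_mod_order s j.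
    by rewrite r4 in ri; rewrite s2 in sj; rewrite !inordK ?ltn_pmod // ri sj.
  rewrite phiE (FK (inord (i %% 4), inord (j %% 2))) /= !inordK ?ltn_pmod //.
  by rewrite !iter_mod.
have SRi i z : S (iter i R z) = iter (3 * i) R (S z).
  by elim: i => [|i IH] //; rewrite mulnS iterD /= SR IH.
have SjRi j i z : iter j S (iter i R z) = iter (3 ^ j * i) R (iter j S z).
  elim: j => [|j IH] /=; first by rewrite mul1n.
  by rewrite IH SRi expnS mulnA.
have sjri j i : (s ^+ j * r ^+ i = r ^+ (3 ^ j * i) * s ^+ j)%g.
  have sri n : (s * r ^+ n = r ^+ (3 * n) * s)%g.
    elim: n => [|n IH]; first by rewrite muln0 !expg0 mulg1 mul1g.
    by rewrite expgS mulgA sr -mulgA IH mulgA -expgD mulnS.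
  elim: j => [|j IH]; first by rewrite mul1n expg0 mul1g mulg1.
  by rewrite expgS -mulgA IH mulgA sri -mulgA expnS mulnA.
exists phi; split=> [g|g h z|g h e].
- have it f n : curve_iso f -> curve_iso (iter_morph f n).
    by move=> fi; elim: n => [|n IH] /=; [exact: curve_iso_id | exact: curve_iso_comp].
  by apply: curve_iso_comp; apply: it.
- have gh : (g * h = r ^+ ((ix g).1 + 3 ^ (ix g).2 * (ix h).1)
                       * s ^+ ((ix g).2 + (ix h).2))%g.
    have := KF g; have := KF h => /=.
    move: (ix g).1 (ix g).2 (ix h).1 (ix h).2 => i j i' j' <- <-.
    by rewrite !expgD !mulgA -(mulgA _ (s ^+ j)%g) sjri !mulgA.
  by rewrite gh phi_rs /= !iter_morphE !iterD SjRi.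
- rewrite -(KF g) -(KF h).
  have [] := sep (ix g).1 (ix g).2 (ix h).1 (ix h).2; rewrite ?ltn_ord //.
    by move=> z; rewrite -!phiE.
  by move=> -> ->.
Qed.

End DihedralAction.

(** * Branch points *)

Section BranchPoints.

Variable k : closedFieldType.
Hypothesis two_neq0 : 2%:R != 0 :> k.

(** [y] has order 1 there, and [y^2 = (x - a) g(x)] with [g] a unit. *)
Lemma ramified_place (E : curve k) (x y : E) f a : model x y f -> root f a ->
  exists2 v : E -> int, place v & v (x - const E a) = 2.
Proof.
move=> m ra; have y0 := model_y_neq0 m.
have ab : 0 ^+ 2 = f.[a] by rewrite expr0n (rootP ra).
have [v [pv vy vu _]] := place_over two_neq0 m ab; exists v => //.
have [g [fg ga]] := separable_factor (model_sep m) ra.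
have xa : x - const E a != 0.
  by rewrite subr_eq0 transcendental_neq //; exact: model_tr m.
have g0 : pev x g != 0.
  rewrite pev_eq0; last exact: model_tr m.
  by apply: contra_neq ga => ->; rewrite horner0.
have vg : v (pev x g) = 0.
  have := vu (g, 0); rewrite affine_fun_poly; apply.
  by rewrite /affine_ev /= mulr0 addr0.
rewrite /affine_param eqxx in vy.
have := place_X pv 2 y0; rewrite (model_sqr m) fg pevM pev_XsubC place_M //.
by rewrite vg addr0 vy => ->.
Qed.

Section Unramified.

Variables (E : curve k) (x y : E) (f : {poly k}) (a : k) (v : E -> int).
Hypothesis m : model x y f.
Hypothesis fa : f.[a] != 0.
Hypothesis pv : place v.
Let n := v (x - const E a).
Hypothesis n_gt1 : 2 <= n.

Fact xa_neq0 : x - const E a != 0.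
Proof. by rewrite subr_eq0 transcendental_neq //; exact: model_tr m. Qed.

Definition positive_at (z : E) := z = 0 \/ 1 <= v z.

Lemma positive_add z w : positive_at z -> positive_at w -> positive_at (z + w).
Proof.
have [->|z0] := eqVneq z 0; first by rewrite add0r.
have [->|w0] := eqVneq w 0; first by rewrite addr0.
move=> [/eqP|vz]; first by rewrite (negPf z0).
move=> [/eqP|vw]; first by rewrite (negPf w0).
have [->|zw0] := eqVneq (z + w) 0; [by left | right].
exact: place_D.
Qed.

Lemma positive_opp z : positive_at z -> positive_at (- z).
Proof.
by move=> [->|vz]; [left; rewrite oppr0 | right; rewrite place_N].
Qed.

Lemma unit_not_positive z : z != 0 -> v z = 0 -> ~ positive_at z.
Proof. by move=> z0 vz [/eqP|]; [rewrite (negPf z0) | rewrite vz]. Qed.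

Lemma unramified_x : in_local_ring v x.
Proof.
rewrite -[x](subrK (const E a)); apply: (local_ringD pv).
  by right; apply: le_trans n_gt1.
exact: local_ring_const.
Qed.

Lemma nonneg_not_positive z : z != 0 -> in_local_ring v z -> ~ positive_at z -> v z = 0.
Proof.
move=> z0 [/eqP|vz]; first by rewrite (negPf z0).
by move=> np; apply/eqP; rewrite eq_le vz andbT leNgt; apply/negP => h; case: np; right.
Qed.

Lemma unramified_unit (P : {poly k}) : P.[a] != 0 -> v (pev x P) = 0.
Proof.
move=> Pa; have P0 : P != 0 by apply: contra_neq Pa => ->; rewrite horner0.
apply: nonneg_not_positive.
- by rewrite pev_eq0 //; exact: model_tr m.
- exact: (local_ring_pev pv _ unramified_x).
have [Q eQ] : exists Q, P - P.[a]%:P = Q * ('X - a%:P).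
  by apply/factor_theorem; rewrite /root !hornerE subrr.
have ca : const E P.[a] != 0 by rewrite fmorph_eq0.
move=> pos; apply: (unit_not_positive ca); first by rewrite place_const.
have -> : const E P.[a] = pev x P + - (pev x Q * (x - const E a)).
  by rewrite -pev_XsubC -pevM -eQ !pevE; ring.
apply: positive_add => //; apply: positive_opp.
have [Q0|Q0] := eqVneq (pev x Q) 0; first by left; rewrite Q0 mul0r.
right; rewrite (place_M pv Q0 xa_neq0).
have [/eqP|vQ] := local_ring_pev pv Q unramified_x; first by rewrite (negPf Q0).
by apply: le_trans (_ : 0 + 2 <= _) => //; apply: lerD.
Qed.

Lemma unramified_poly (P : {poly k}) : P != 0 -> exists q : int, v (pev x P) = q * n.
Proof.
move=> P0; have [j [q]] := multiplicity_XsubC P a; rewrite P0 /= => qa ->.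
have q0 : q != 0 by apply: contraNneq qa => ->; rewrite root0.
exists j%:Z; rewrite pevM pevXn pev_XsubC place_M //.
- by rewrite (unramified_unit qa) add0r (place_X pv) ?xa_neq0 // -mulr_natl natz.
- by rewrite pev_eq0 //; exact: model_tr m.
- by rewrite expf_neq0 // xa_neq0.
Qed.

(** At a point where [f] does not vanish, [x - a] is a uniformizer up to units:
    an element of [k[x, y]] not divisible by [x - a] cannot vanish together with
    its conjugate, so its order is 0 or that of its norm. *)
Lemma unramified_order p : affine_fun x y p != 0 ->
  exists q : int, v (affine_fun x y p) = q * n.
Proof.
have [N] := ubnP (size p.1 + size p.2); elim: N => // N IH in p * => sN p0.
have [/andP[/factor_theorem[A eA] /factor_theorem[B eB]]|nr] :=
  boolP (root p.1 a && root p.2 a).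
  have ep : affine_fun x y p = affine_fun x y (A, B) * (x - const E a).
    by rewrite /affine_fun eA eB !pevM pev_XsubC /=; ring.
  have p1 : affine_fun x y (A, B) != 0.
    by apply: contra_neq p0 => h; rewrite ep h mul0r.
  have sAB : (size A + size B < N)%N.
    move: sN; rewrite ltnS; apply: leq_trans; rewrite eA eB.
    have sz (C : {poly k}) : size (C * ('X - a%:P)) = (size C + (C != 0%R))%N.
      have [->|C0] := eqVneq C 0; first by rewrite mul0r size_poly0.
      by rewrite size_mul ?polyXsubC_eq0 // size_XsubC addn2 addn1.
    rewrite !sz; move: p1; rewrite (affine_fun_eq0 m) -pair_eqE /= negb_and.
    move: (size A) (size B) => i j.
    by case: (A != 0); case: (B != 0) => //= _; rewrite ?addn0 ?addn1; lia.
  have [q eq] := IH (A, B) sAB p1; exists (q + 1).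
  by rewrite ep place_M ?xa_neq0 // eq mulrDl mul1r.
have y0 := model_y_neq0 m.
have oy : in_local_ring v y.
  apply: (local_ring_sqrt pv); rewrite (model_sqr m).
  exact: (local_ring_pev pv _ unramified_x).
have vy : v y = 0.
  have := place_X pv 2 y0; rewrite (model_sqr m) (unramified_unit fa) => /esym/eqP.
  by rewrite mulrn_eq0 => /eqP.
have oR q : in_local_ring v (affine_fun x y q).
  have ox := unramified_x.
  by apply: (local_ringD pv); [|apply: (local_ringM pv) => //]; apply: (local_ring_pev pv).
have N0 : affine_norm f p != 0 by rewrite (affine_norm_eq0 m) -(affine_fun_eq0 m).
have pc0 : affine_fun x y (affine_conj p) != 0.
  have : pev x (affine_norm f p) != 0 by rewrite pev_eq0 //; exact: model_tr m.
  by rewrite -(affine_normE m) mulf_eq0 negb_or => /andP[].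
have two : const E 2%:R != 0 by rewrite fmorph_eq0.
have vtwo z : z != 0 -> v (const E 2%:R * z) = v z.
  by move=> z0; rewrite place_M // place_const // add0r.
have [vc|vc] := eqVneq (v (affine_fun x y (affine_conj p))) 0.
  have [q eq] := unramified_poly N0; exists q.
  by rewrite -eq -(affine_normE m) place_M // vc addr0.
exists 0; rewrite mul0r; apply: nonneg_not_positive => // pos.
have posc : positive_at (affine_fun x y (affine_conj p)).
  right; have [/eqP|h] := oR (affine_conj p); first by rewrite (negPf pc0).
  by move: vc h; case: (v _) => [[|?]|?].
have pvals (P : {poly k}) : P.[a] != 0 -> pev x P != 0.
  move=> Pa; rewrite pev_eq0; last exact: model_tr m.
  by apply: contra_neq Pa => ->; rewrite horner0.
case/negP: nr; apply/andP; split; apply/negPn/negP => r.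
- have := pvals _ r => P0; have := @unit_not_positive (const E 2%:R * pev x p.1).
  rewrite mulf_neq0 // vtwo // (unramified_unit r) => /(_ isT erefl); apply.
  have -> : const E 2%:R * pev x p.1 = affine_fun x y p + affine_fun x y (affine_conj p).
    by rewrite /affine_fun /= pevN rmorph_nat; ring.
  exact: positive_add.
- have := pvals _ r => P0; have := @unit_not_positive (const E 2%:R * (pev x p.2 * y)).
  rewrite !mulf_neq0 // vtwo ?mulf_neq0 // place_M // (unramified_unit r) vy.
  move/(_ isT erefl); apply.
  have -> : const E 2%:R * (pev x p.2 * y) = affine_fun x y p + - affine_fun x y (affine_conj p).
    by rewrite /affine_fun /= pevN rmorph_nat; ring.
  by apply: positive_add => //; apply: positive_opp.
Qed.

(** A place takes the value 1, which is no multiple of the order of [x - a]. *)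
Lemma unramified_absurd : False.
Proof.
have [_ _ _ [t t0 vt]] := pv.
have [A [B [C [C0 e]]]] := model_gen m t.
have C1 : pev x C != 0 by rewrite pev_eq0 //; exact: model_tr m.
have [q eq] := unramified_poly C0.
have r0 : affine_fun x y (A, B) != 0 by rewrite /affine_fun /= -e mulf_neq0.
have [s es] := unramified_order r0.
have : v (t * pev x C) = s * n by rewrite e -es.
rewrite place_M // vt eq => h.
have h1 : (s - q) * n = 1 by rewrite mulrBl -h addrK.
move: n (s - q) n_gt1 h1 => d c d1 h1.
have [c0|c0] : c <= 0 \/ 1 <= c by lia.
  by nia.
by nia.
Qed.

End Unramified.

Lemma branch_point_root (C : curve k) (y : C) f a : model (base_coord C) y f ->
  branch_point C (Some a) <-> root f a.
Proof.
move=> m; have e : (local_param (Some a))%:A = base_coord C - const C a.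
  by rewrite /= -pev_base pev_XsubC.
split=> [[v [pv]]|ra]; rewrite ?e.
  move=> v2; apply/negPn/negP => fa; exact: (unramified_absurd m fa pv v2).
have [v pv v2] := ramified_place m ra.
by exists v; rewrite e v2.
Qed.

(** In odd degree, 0 is a root of the reversed polynomial. *)
Lemma branch_point_infinity (C : curve k) (y : C) f g :
  model (base_coord C) y f -> size f = g.*2.+2 -> branch_point C None.
Proof.
move=> m sf; have x0 := transcendental_neq0 (model_tr m).
have m' := @model_inv _ _ _ _ _ m g; rewrite sf !ltnS leqnn leqnSn in m'.
have r0 : root (revp g.*2.+2 f) 0.
  by rewrite /root horner_coef0 coef_revp subn0 nth_default ?sf.
have [v pv v2] := ramified_place (m' isT) r0; exists v; split=> //.
rewrite rmorph0 subr0 in v2.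
suff -> : (local_param None)%:A = (base_coord C)^-1 by rewrite v2.
apply: (mulIf x0); rewrite mulVf // /base_coord /= -scalerAl mul1r scalerA mulVf ?scale1r //.
by rewrite tofrac_eq0 polyX_eq0.
Qed.

Lemma share_rosenhain (C1 C2 : curve k) (y1 : C1) (y2 : C2) l1 l2 l3 l3' :
  uniq [:: 0; 1; l1; l2; l3; l3'] ->
  model (base_coord C1) y1 (rosenhain_poly l1 l2 l3) ->
  model (base_coord C2) y2 (rosenhain_poly l1 l2 l3') ->
  share_branch_points C1 C2 5.
Proof.
move=> un m1 m2; exists [:: None; Some 0; Some 1; Some l1; Some l2].
have rootE c a : root (rosenhain_poly l1 l2 c) a = (a \in [:: 0; 1; l1; l2; c]).
  have -> : rosenhain_poly l1 l2 c = \prod_(d <- [:: 0; 1; l1; l2; c]) ('X - d%:P).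
    by rewrite /rosenhain_poly !big_cons big_nil subr0 polyC1 mulr1 !mulrA.
  by rewrite root_prod_XsubC.
have [un4 l33] : uniq [:: 0; 1; l1; l2] /\ l3 != l3'.
  move: un; rewrite -[X in uniq X]/([:: 0; 1; l1; l2] ++ [:: l3; l3']) cat_uniq.
  by case/and3P=> h _ /=; rewrite inE andbT.
split=> //.
case=> [a|].
  rewrite (branch_point_root _ m1) (branch_point_root _ m2) !rootE.
  have -> : (Some a \in [:: None; Some 0; Some 1; Some l1; Some l2]) =
            (a \in [:: 0; 1; l1; l2]) by rewrite !inE.
  rewrite -[[:: 0; 1; l1; l2; l3]]/([:: 0; 1; l1; l2] ++ [:: l3]).
  rewrite -[[:: 0; 1; l1; l2; l3']]/([:: 0; 1; l1; l2] ++ [:: l3']) !mem_cat.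
  split=> [-> //|[/orP[//|a3] /orP[//|a3']]].
  by move: l33; rewrite !inE in a3 a3'; rewrite -(eqP a3) -(eqP a3') eqxx.
split=> // _; split.
  exact: (@branch_point_infinity _ _ _ 2 m1 (size_rosenhain_poly _ _ _)).
exact: (@branch_point_infinity _ _ _ 2 m2 (size_rosenhain_poly _ _ _)).
Qed.

End BranchPoints.

(** * Pairs of Rosenhain curves *)

Section RosenhainPairs.

Variable k : closedFieldType.
Hypothesis two_neq0 : 2%:R != 0 :> k.

(** Up to factors [l3 - l3'], the two products are 1 exactly when [l3 + l3' = 1]
    and [l1 + l2 = l3 + l3']. *)
Lemma rosenhain_relations (l1 l2 l3 l3' : k) : uniq [:: 0; 1; l1; l2; l3; l3'] ->
  l3' / l3 * ((1 - l3') / (1 - l3)) = 1 /\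
  (l1 - l3') / (l1 - l3) * ((l2 - l3') / (l2 - l3)) = 1 <->
  l3' = 1 - l3 /\ l2 = 1 - l1.
Proof.
move=> un.
have [n0 [n1 [nl1 [nl2 n33]]]] : l3 != 0 /\ 1 - l3 != 0 /\ l1 - l3 != 0 /\
    l2 - l3 != 0 /\ l3 - l3' != 0.
  rewrite !subr_eq0 [l3 == 0]eq_sym; move: un; rewrite /= !inE !negb_or -!andbA.
  by do ![case/andP=> ?].
split=> [[e e']|[s33 s12]]; last first.
  by subst l2 l3'; split; field; rewrite ?n0 ?n1 ?nl1 ?nl2.
have s33 : l3' = 1 - l3.
  have h : l3' * (1 - l3') = l3 * (1 - l3).
    have -> : l3' * (1 - l3') = l3' / l3 * ((1 - l3') / (1 - l3)) * (l3 * (1 - l3)).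
      by field; rewrite n0 n1.
    by rewrite e mul1r.
  apply: (mulfI n33); apply/eqP; rewrite -subr_eq0; apply/eqP.
  by rewrite -[RHS](subrr (l3 * (1 - l3))) -{1}h; ring.
split=> //; apply: (mulfI n33); apply/eqP; rewrite -subr_eq0; apply/eqP.
have h : (l1 - l3') * (l2 - l3') = (l1 - l3) * (l2 - l3).
  have -> : (l1 - l3') * (l2 - l3') =
    (l1 - l3') / (l1 - l3) * ((l2 - l3') / (l2 - l3)) * ((l1 - l3) * (l2 - l3)).
    by field; rewrite nl1 nl2.
  by rewrite e' mul1r.
rewrite -[RHS](subrr ((l1 - l3) * (l2 - l3))) -{1}h s33.
by ring.
Qed.

(** The affine coordinate in which the branch points [a, -a, b, -b, -2, 2] of
    the two quotient curves become [0, 1, l1, l2, l3, l3']. *)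
Definition rosenhain_coord (a r : k) := (a - r) / (2%:R * a).

Lemma uniq_rosenhain_coord a b : a != 0 ->
  uniq [:: 0; 1; rosenhain_coord a b; rosenhain_coord a (- b);
           rosenhain_coord a (- 2%:R); rosenhain_coord a 2%:R] =
  [&& b != 0, a ^+ 2 != b ^+ 2, a ^+ 2 != 4%:R & b ^+ 2 != 4%:R].
Proof.
move=> a0.
have -> : [:: 0; 1; rosenhain_coord a b; rosenhain_coord a (- b);
           rosenhain_coord a (- 2%:R); rosenhain_coord a 2%:R] =
   map (rosenhain_coord a) [:: a; - a; b; - b; - 2%:R; 2%:R].
  have g0 : rosenhain_coord a a = 0 by rewrite /rosenhain_coord subrr mul0r.
  have g1 : rosenhain_coord a (- a) = 1.
    by rewrite /rosenhain_coord; field; rewrite two_neq0 a0.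
  by rewrite /= g0 g1.
have inj : injective (rosenhain_coord a).
  move=> r s /mulIf; rewrite invr_eq0 mulf_neq0 // => /(_ isT)/eqP.
  by rewrite (inj_eq (addrI _)) eqr_opp => /eqP.
rewrite (map_inj_uniq inj) /= !inE !negb_or.
have opp (c : k) : (c == - c) = (c == 0).
  by rewrite -subr_eq0 opprK -mulr2n -mulr_natl mulf_eq0 (negPf two_neq0).
have -> : 4%:R = 2%:R ^+ 2 :> k by rewrite -natrX.
rewrite !eqf_sqr !negb_or !opp !eqr_opp a0 /= [- 2%:R == 2%:R]eq_sym opp two_neq0.
rewrite !eqr_oppLR.
by case: (b == 0); case: (a == b); case: (a == - b); case: (a == - 2%:R);
   case: (a == 2%:R); case: (b == 2%:R); case: (b == - 2%:R).
Qed.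

Variables (l1 l3 : k).
Let l2 := 1 - l1.
Let l3' := 1 - l3.

Lemma rosenhain_swap_poly (l l' : k) : l' = 1 - l ->
  rosenhain_poly l1 l2 l \Po (- 1 *: 'X + 1) = - rosenhain_poly l1 l2 l'.
Proof.
move=> ->; rewrite /rosenhain_poly !comp_polyM !comp_polyB !comp_polyX !comp_polyC.
rewrite /l2 -mul_polyC !(polyCB, polyCN, polyC1).
by ring.
Qed.

Section Isomorphism.

Variables (C1 C2 : curve k) (y1 : C1) (y2 : C2).
Hypothesis m1 : model (base_coord C1) y1 (rosenhain_poly l1 l2 l3).
Hypothesis m2 : model (base_coord C2) y2 (rosenhain_poly l1 l2 l3').

(** The substitution [x -> 1 - x] permutes [0, 1, l1, l2] and exchanges [l3] and
    [l3']; [i] corrects the sign of the quintic. *)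
Lemma rosenhain_swap_hom (D1 D2 : curve k) (z1 : D1) (z2 : D2) l l' i :
  l' = 1 - l -> i ^+ 2 = -1 ->
  model (base_coord D1) z1 (rosenhain_poly l1 l2 l) ->
  model (base_coord D2) z2 (rosenhain_poly l1 l2 l') ->
  exists h : {rmorphism D1 -> D2},
    [/\ forall c, h (const D1 c) = const D2 c,
        h (base_coord D1) = 1 - base_coord D2 & h z1 = const D2 i * z2].
Proof.
move=> ll i2 n1 n2.
have n1_neq0 : -1 != 0 :> k by rewrite oppr_eq0 oner_neq0.
have n3 := model_affine n2 1 n1_neq0.
have e : const D2 (-1) * base_coord D2 + const D2 1 = 1 - base_coord D2.
  by rewrite rmorphN1 rmorph1 mulN1r addrC.
rewrite e in n3; apply: (model_hom n1 (model_tr n3)).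
rewrite exprMn (model_sqr n2) -rmorphXn /= i2 rmorphN1 mulN1r -pevN.
rewrite -(rosenhain_swap_poly ll) pev_comp; congr (pev _ _).
by rewrite !pevE rmorphN1 mulN1r addrC.
Qed.

Lemma rosenhain_isomorphic : isomorphic C1 C2.
Proof.
have [i i2] := sqrt_exists (-1 : k).
have i2' : (- i) ^+ 2 = -1 by rewrite sqrrN.
have [h [hc hx hy]] := rosenhain_swap_hom (erefl _) i2 m1 m2.
have l33 : l3 = 1 - l3' by rewrite opprB addrC subrK.
have [h' [hc' hx' hy']] := rosenhain_swap_hom l33 i2' m2 m1.
exists h; split=> //; exists h' => z.
- apply: (model_hom_eq m1 (g := h' \o h) (h := idfun)) => [c||] /=.
  + by rewrite hc hc'.
  + by rewrite hx rmorphB rmorph1 /= hx' opprB addrC subrK.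
  + rewrite hy rmorphM /= hc' hy' mulrA -rmorphM mulrN -expr2 i2 opprK.
    by rewrite rmorph1 mul1r.
- apply: (model_hom_eq m2 (g := h \o h') (h := idfun)) => [c||] /=.
  + by rewrite hc' hc.
  + by rewrite hx' rmorphB rmorph1 /= hx opprB addrC subrK.
  + rewrite hy' rmorphM /= hc hy mulrA -rmorphM mulNr -expr2 i2 opprK.
    by rewrite rmorph1 mul1r.
Qed.

End Isomorphism.

End RosenhainPairs.

Section BranchCurve.

Variable k : closedFieldType.
Hypothesis two_neq0 : 2%:R != 0 :> k.
Variables (H : curve k) (x y : H) (a b : k).
Hypothesis m : model x y (branch_poly a b).

(** The generators are [(x, y) -> (- x, i y)] and [(x, y) -> (1/x, y / x^5)]. They
    are automorphisms because [branch_poly] is odd and palindromic. *)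
Lemma branch_curve_D4 : aut_contains_D4 H.
Proof.
have [i i2] := sqrt_exists (-1 : k).
have x0 := transcendental_neq0 (model_tr m); have y0 := model_y_neq0 m.
have tx := model_tr m.
have n1_neq0 : -1 != 0 :> k by rewrite oppr_eq0 oner_neq0.
have mN := model_affine m 0 n1_neq0.
rewrite rmorphN1 rmorph0 mulN1r addr0 in mN.
have [|R [Rc Rx Ry]] := @model_hom _ _ _ _ _ m H (- x) (const H i * y) (model_tr mN).
  rewrite exprMn (model_sqr m) -rmorphXn /= i2 rmorphN1 mulN1r -pevN.
  by rewrite -branch_poly_odd pev_comp pevN pevX.
have sF : (9 < size (branch_poly a b) <= 11)%N by rewrite size_branch_poly.
have m' := @model_inv _ _ _ _ _ m 4 sF; rewrite revp_branch_poly in m'.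
have [S [Sc Sx Sy]] := model_hom m (model_tr m') (model_sqr m').
have R2x : R (R x) = x by rewrite Rx rmorphN /= Rx opprK.
have R2y : R (R y) = - y.
  by rewrite Ry rmorphM /= Rc Ry mulrA -rmorphM -expr2 i2 rmorphN1 mulN1r.
have R4 z : R (R (R (R z))) = z.
  apply: (model_hom_eq m (g := R \o R \o R \o R) (h := idfun)) => [c||] /=.
  - by rewrite !Rc.
  - by rewrite !R2x.
  - by rewrite R2y !rmorphN /= R2y opprK.
have S2 z : S (S z) = z.
  apply: (model_hom_eq m (g := S \o S) (h := idfun)) => [c||] /=.
  - by rewrite !Sc.
  - by rewrite Sx fmorphV /= Sx invrK.
  - by rewrite Sy fmorph_div rmorphXn /= Sx Sy; field; rewrite x0 oner_neq0.
have SR z : S (R z) = R (R (R (S z))).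
  apply: (model_hom_eq m (g := S \o R) (h := R \o R \o R \o S)) => [c||] /=.
  - by rewrite !(Rc, Sc).
  - by rewrite Rx rmorphN /= Sx !fmorphV /= R2x Rx invrN.
  - rewrite Ry rmorphM /= Sc Sy !(fmorph_div, rmorphXn) /= R2y R2x.
    by rewrite !rmorphN /= Ry Rx; field; rewrite oppr_eq0 x0.
have Ri : curve_iso R by split=> //; exists (R \o R \o R) => z /=; rewrite R4.
have Si : curve_iso S by split=> //; exists S.
apply: (aut_D4_of Ri Si R4 S2 SR).
have Rix n : iter n R x = const H ((-1) ^+ n) * x.
  elim: n => [|n IH] /=; first by rewrite rmorph1 mul1r.
  by rewrite IH rmorphM /= Rc Rx exprS mulN1r rmorphN mulrN mulNr.
have Riy n : iter n R y = const H (i ^+ n) * y.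
  elim: n => [|n IH] /=; first by rewrite rmorph1 mul1r.
  by rewrite IH rmorphM /= Rc Ry exprSr rmorphM mulrA.
move=> n1 j1 n2 j2 n14 j12 n24 j22 e.
have jj : j1 = j2.
  have xx c : x != const H c * x^-1.
    apply/eqP => h; have := tx ('X^2 - c%:P).
    rewrite !pevE expr2 {2}h mulrCA divff // mulr1 subrr => /(_ erefl)/eqP.
    by rewrite -size_poly_eq0 size_XnsubC.
  have rx n : iter n R x^-1 = const H ((-1) ^+ n) * x^-1.
    elim: n => [|n IH] /=; first by rewrite rmorph1 mul1r.
    by rewrite IH rmorphM fmorphV /= Rc Rx exprS mulN1r rmorphN invrN mulrN mulNr.
  have sgn n d : const H ((-1) ^+ n) * x = d -> x = const H ((-1) ^+ n) * d.
    by move=> <-; rewrite mulrA -rmorphM -expr2 sqrr_sign rmorph1 mul1r.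
  have clash u w : const H ((-1) ^+ u) * x <> const H ((-1) ^+ w) / x.
    by move/sgn/eqP; rewrite mulrA -rmorphM (negPf (xx _)).
  have ex := e x; case: j1 j2 j12 j22 ex {e} => [|[|//]] [|[|//]] // _ _ /=;
    rewrite Sx rx Rix; first by move/clash.
  by move/esym/clash.
split=> //; move: (e (iter j2 S y)); rewrite jj.
have -> : iter j2 S (iter j2 S y) = y.
  by case: j2 j22 {e jj} => [|[|]] //= _; rewrite S2.
rewrite !Riy => /(mulIf y0)/fmorph_inj.
have in1 : i != 1 by apply: contra_neq (opp1_neq1 two_neq0) => i1; rewrite -i2 i1 expr1n.
have inN1 : i != -1.
  by apply: contra_neq (opp1_neq1 two_neq0) => i1; rewrite -i2 i1 sqrrN expr1n.
have i0 : i != 0 by rewrite -sqrf_eq0 i2.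
have pow n d : (d < 4)%N -> i ^+ n = i ^+ (n + d) -> d = 0%N.
  move=> d4; rewrite exprD -{1}[i ^+ n]mulr1 => /(mulfI (expf_neq0 n i0)).
  case: d d4 => [|[|[|[|//]]]] // _ /esym/eqP.
  - by rewrite expr1 (negPf in1).
  - by rewrite i2 (negPf (opp1_neq1 two_neq0)).
  - by rewrite exprS i2 mulrN1 eqr_oppLR (negPf inN1).
have [le|/ltnW le] := leqP n1 n2.
  rewrite -(subnKC le) => /pow -> //; first by rewrite addn0.
  exact: leq_ltn_trans (leq_subr _ _) n24.
rewrite -(subnKC le) => /esym/pow -> //; first by rewrite addn0.
exact: leq_ltn_trans (leq_subr _ _) n14.
Qed.

End BranchCurve.

(** * Genus 4 curves with a dihedral action and pairs of Rosenhain curves *)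

Section MainSteps.

Variable k : closedFieldType.
Hypothesis two_neq0 : 2%:R != 0 :> k.

Lemma rosenhain_genus2 (l1 l2 l3 : k) : uniq [:: 0; 1; l1; l2; l3] ->
  genus2_double_cover (rosenhain_curve l1 l2 l3).
Proof.
move=> un; split; first exact: (rosenhain_curveP l1 l2 l3).1.
have [y m] := rosenhain_model un.
by apply: (genus_of_model two_neq0 m (g := 2)); rewrite size_rosenhain_poly.
Qed.

Lemma uniq_branch (l1 l2 l3 l3' : k) : uniq [:: 0; 1; l1; l2; l3; l3'] ->
  uniq [:: 0; 1; l1; l2; l3] /\ uniq [:: 0; 1; l1; l2; l3'].
Proof.
move=> un; split; first exact: (take_uniq 5 un).
by apply: subseq_uniq un; rewrite /= !eqxx; case: eqP => // _; rewrite eqxx.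
Qed.

Lemma hyperelliptic_D4_model (H : curve k) :
  hyperelliptic H 4 -> aut_contains_D4 H ->
  exists (x y : H) a b, model x y (branch_poly a b).
Proof.
move=> [_ g4 [E [dE [e e_iso]]]] /D4_action[R [S [[Ri Si R4 S2 SR] [nR nS nSR2 nSR nSR3]]]].
have [y [f m0]] := double_cover_model two_neq0 dE.
have m := model_iso e_iso m0.
have [g sf] : exists g, (g.*2.+1 < size f <= g.*2.+3)%N.
  exists (size f - 2)./2; have := model_size m.
  move: (size f) => n n1; have := odd_double_half (n - 2).
  by case: (odd _); lia.
have g_4 : 4 = g by apply: (genus_uniq two_neq0 m sf g4).
rewrite -g_4 in sf.
have [x1 [y1 [f1 [[m1 sf1] f_odd f_rev]]]] :=
  dihedral_normal_form two_neq0 Ri Si R4 S2 SR nR nS nSR2 nSR nSR3 (conj m sf).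
have [a [b [z mz]]] := branch_model_exists (conj m1 sf1) f_odd f_rev.
by exists x1, z, a, b.
Qed.

Lemma branch_curve_quotients (H : curve k) (x y : H) a b
    (l1 := rosenhain_coord a b) (l2 := rosenhain_coord a (- b))
    (l3 := rosenhain_coord a (- 2%:R)) (l3' := rosenhain_coord a 2%:R) :
  a != 0 -> uniq [:: 0; 1; l1; l2; l3; l3'] ->
  model x y (branch_poly a b) ->
  birational_fiber_product H (rosenhain_curve l1 l2 l3) (rosenhain_curve l1 l2 l3').
Proof.
move=> a0 /uniq_branch[un1 un2] m.
have [y1 m1] := rosenhain_model un1; have [y2 m2] := rosenhain_model un2.
have [kappa kE] := sqrt_exists ((- 2%:R * a) ^+ 5).
apply: (fiber_product two_neq0 a0 _ _ _ _ m kE m1 m2).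
- by [].
- by rewrite /l2 /rosenhain_coord opprK.
- by rewrite /l3 /rosenhain_coord opprK.
- by [].
Qed.

Lemma rosenhain_coord_swap (a b : k) : a != 0 ->
  rosenhain_coord a (- b) = 1 - rosenhain_coord a b.
Proof. by move=> a0; rewrite /rosenhain_coord; field; rewrite two_neq0 a0. Qed.

End MainSteps.

Theorem lemma3p1p1 (k : closedFieldType) (p : nat) (pk : p \in [pchar k])
    (p7 : (7 <= p)%N) :
  (forall H : curve k, hyperelliptic H 4 -> aut_contains_D4 H ->
     exists C1 C2 : curve k,
       [/\ genus2_double_cover C1,
           genus2_double_cover C2,
           isomorphic C1 C2,
           share_branch_points C1 C2 5
         & birational_fiber_product H C1 C2] /\
       exists l1 l2 l3 l3' : k,
         let c2 := l3' / l3 in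
         let c3 := (1 - l3') / (1 - l3) in
         let c4 := (l1 - l3') / (l1 - l3) in
         let c5 := (l2 - l3') / (l2 - l3) in
         [/\ uniq [:: 0; 1; l1; l2; l3; l3'],
             C1 = rosenhain_curve l1 l2 l3,
             C2 = rosenhain_curve l1 l2 l3',
             c2 * c3 = 1
           & c4 * c5 = 1]) /\
  (forall l1 l2 l3 l3' : k,
     uniq [:: 0; 1; l1; l2; l3; l3'] ->
     let c2 := l3' / l3 in
     let c3 := (1 - l3') / (1 - l3) in
     let c4 := (l1 - l3') / (l1 - l3) in
     let c5 := (l2 - l3') / (l2 - l3) in
     c2 * c3 = 1 -> c4 * c5 = 1 ->
     isomorphic (rosenhain_curve l1 l2 l3) (rosenhain_curve l1 l2 l3') /\
     exists H : curve k,
       [/\ hyperelliptic H 4,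
           aut_contains_D4 H
         & birational_fiber_product H (rosenhain_curve l1 l2 l3)
             (rosenhain_curve l1 l2 l3')]).
Proof.
have two_neq0 : 2%:R != 0 :> k.
  rewrite -(dvdn_pcharf pk); apply/negP => /dvdn_leq; lia.
split=> [H hH dH | l1 l2 l3 l3' un c2 c3 c4 c5 c23 c45].
- have [x [y [a [b m]]]] := hyperelliptic_D4_model two_neq0 hH dH.
  have [a0 b0 ab a4 b4] := (branch_poly_separable two_neq0 a b).1 (model_sep m).
  have un := uniq_rosenhain_coord two_neq0 b a0.
  rewrite b0 ab a4 b4 in un.
  have fib := branch_curve_quotients two_neq0 a0 un m.
  have [un1 un2] := uniq_branch un.
  have s12 := rosenhain_coord_swap two_neq0 b a0.
  have s33 : rosenhain_coord a 2%:R = 1 - rosenhain_coord a (- 2%:R).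
    by rewrite -(rosenhain_coord_swap two_neq0) // opprK.
  move: (rosenhain_coord a b) (rosenhain_coord a (- b)) (rosenhain_coord a (- 2%:R))
    (rosenhain_coord a 2%:R) un fib un1 un2 s12 s33 => l1 l2 l3 l3' un fib un1 un2 s12 s33.
  have [y1 m1] := rosenhain_model un1; have [y2 m2] := rosenhain_model un2.
  exists (rosenhain_curve l1 l2 l3), (rosenhain_curve l1 l2 l3'); split.
    split.
    + exact: rosenhain_genus2.
    + exact: rosenhain_genus2.
    + by subst l2 l3'; apply: rosenhain_isomorphic m1 m2.
    + exact: share_rosenhain un m1 m2.
    + exact: fib.
  exists l1, l2, l3, l3'; cbv zeta; split=> //.
  + exact: ((rosenhain_relations un).2 (conj s33 s12)).1.
  + exact: ((rosenhain_relations un).2 (conj s33 s12)).2.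
- have [s33 s12] := (rosenhain_relations un).1 (conj c23 c45).
  have [un1 un2] := uniq_branch un.
  have [y1 m1] := rosenhain_model un1; have [y2 m2] := rosenhain_model un2.
  split; first by subst l2 l3'; apply: rosenhain_isomorphic m1 m2.
  have d0 : 2%:R * l3 - 1 != 0.
    apply/eqP => h; move: un; rewrite s33.
    have -> : 1 - l3 = l3 by apply/eqP; rewrite -subr_eq0 -opprB oppr_eq0 -h; apply/eqP; ring.
    by rewrite /= !inE eqxx ?orbT ?andbF.
  pose a := 2%:R / (2%:R * l3 - 1); pose b := a * (1 - 2%:R * l1).
  have a0 : a != 0 by rewrite mulf_neq0 ?invr_eq0.
  have aE : a * (2%:R * l3 - 1) = 2%:R by rewrite divfK.
  have e1 : l1 = rosenhain_coord a b.
    have e c : c != 0 -> l1 = (c - c * (1 - 2%:R * l1)) / (2%:R * c).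
      by move=> c0; field; rewrite two_neq0 c0.
    exact: e.
  have e2 : l2 = rosenhain_coord a (- b).
    by rewrite s12 e1 rosenhain_coord_swap.
  have e3 : l3 = rosenhain_coord a (- 2%:R).
    have e : l3 * (2%:R * a) = a + a * (2%:R * l3 - 1) by ring.
    rewrite aE in e.
    have na : 2%:R * a != 0 by apply: mulf_neq0.
    by apply: (mulIf na); rewrite /rosenhain_coord opprK divfK.
  have e3' : l3' = rosenhain_coord a 2%:R.
    by rewrite s33 e3 -(rosenhain_coord_swap two_neq0) // opprK.
  have un' := un; rewrite e1 e2 e3 e3' in un'; clearbody a b.
  have := uniq_rosenhain_coord two_neq0 b a0; rewrite un' => /esym/and4P[b0 ab a4 b4].
  have sep : separable_poly (branch_poly a b) by apply/(branch_poly_separable two_neq0).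
  have sF : (1 < size (branch_poly a b))%N by rewrite size_branch_poly.
  have [H dH [y m]] := curve_exists sep sF.
  exists H; split.
  + split=> //.
      by apply: (genus_of_model two_neq0 m (g := 4)); rewrite size_branch_poly.
    by exists H; split=> //; exists idfun; apply: curve_iso_id.
  + exact: branch_curve_D4 m.
  + rewrite e1 e2 e3 e3'; exact: (branch_curve_quotients two_neq0 a0 un' m).
Qed.
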